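(* Let $g^0\in\mathcal{C}$ and $\xi^0\in\mathcal{P}^\perp$ with $\xi^0\in\mathcal{J}(\mathbf{g}^0)$. Let $\xi:[0,\infty)\to\mathcal{P}^\perp$ be a weak solution of $\partial E^*(\dot\xi(t))+\mathcal{J}^*(\xi(t))\ni0$ (a.e. $t\ge0$) with finite $E^*$ variation and $\xi(0)|_{\mathcal{C}}=\xi^0|_{\mathcal{C}}$, and let $\mathbf{g}:[0,\infty)\to C(\mathbb{S}^2)/\mathcal{P}$ be a corresponding mapping as in the definition of weak solution such that $\mathbf{g}\in L^2([0,\infty);\mathcal{V}/\mathcal{P})$ and $t\mapsto E(\mathbf{g}(t))$ is essentially nonincreasing. Then there is a null set $N\subset[0,\infty)$ such that $$\lim_{\substack{t\to\infty\\ t\notin N}}t\,E(\mathbf{g}(t))=0\quad\text{and}\quad\lim_{\substack{t\to\infty\\ t\notin N}}\|\mathbf{g}(t)\|=0.$$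
   Context: A constant width body is a compact convex $K\subset\mathbb{R}^3$ in which parallel supporting planes are at distance $1$ in every direction; equivalently its support function $H(u)=\max_{x\in K}x\cdot u$ satisfies $H(u)+H(-u)=|u|$ for all $u\in\mathbb{R}^3$. $\sigma$ is the surface measure on the unit sphere $\mathbb{S}^2\subset\mathbb{R}^3$, $\sigma(\mathbb{S}^2)=4\pi$. Spaces. $C(\mathbb{S}^2)$ has the sup norm; $\mathcal{P}=\{u\mapsto a\cdot u: a\in\mathbb{R}^3\}\subset C(\mathbb{S}^2)$; $\mathbf{g}=g+\mathcal{P}$ denotes the class of $g$; $\|\mathbf{g}\|=\inf_{a\in\mathbb{R}^3}\max_{|u|=1}|g(u)+a\cdot u|$ on $C(\mathbb{S}^2)/\mathcal{P}$. $M(\mathbb{S}^2)$ is the space of finite signed Radon measures, $\langle\xi,g\rangle=\int_{\mathbb{S}^2}g\,d\xi$, and $\mathcal{P}^\perp=\{\xi\in M(\mathbb{S}^2):\xi|_{\mathcal{P}}=0\}$, the dual of $C(\mathbb{S}^2)/\mathcal{P}$, with norm $\|\xi\|_*=\sup\{\langle\xi,g\rangle:\|\mathbf{g}\|\le1\}$. $\mathcal{C}$ is the set of $g\in C(\mathbb{S}^2)$ such that $g+\frac12=H|_{\mathbb{S}^2}$ for the support function $H$ of some constant width body. $\mathcal{V}=\{g\in H^1(\mathbb{S}^2):\int g\,d\sigma=0\}$; $\mathcal{V}/\mathcal{P}$ is a Hilbert space with inner product $(\mathbf{g},\mathbf{h})=\int_{\mathbb{S}^2}(\nabla g\cdot\nabla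 h-2gh)\,d\sigma$. $\mathbf{g}\in L^2([0,\infty);\mathcal{V}/\mathcal{P})$ means $t\mapsto\mathbf{g}(t)$ is a.e. $\mathcal{V}/\mathcal{P}$-valued and measurable with $\int_0^\infty(\mathbf{g}(t),\mathbf{g}(t))\,dt<\infty$. Functionals. $E(\mathbf{g})=\int_{\mathbb{S}^2}(\frac12|\nabla g|^2-g^2)\,d\sigma$ if $g\in\mathcal{C}$ and $+\infty$ otherwise (well defined on classes). $E^*(\zeta)=\sup\{\langle\zeta,g\rangle-E(\mathbf{g}):g\in\mathcal{C}\}$ for $\zeta\in\mathcal{P}^\perp$. $\mathcal{J}$ is the subdifferential of $\mathbf{g}\mapsto\frac12\|\mathbf{g}\|^2$ and $\mathcal{J}^*$ that of $\xi\mapsto\frac12\|\xi\|_*^2$ (with $\mathcal{J}^*(\xi)\subset C(\mathbb{S}^2)/\mathcal{P}$); $\xi\in\mathcal{J}(\mathbf{g})$ iff $\mathbf{g}\in\mathcal{J}^*(\xi)$ iff $\|\mathbf{g}\|^2=\langle\xi,g\rangle=\|\xi\|_*^2$. $E^*$ variation. For $\xi:[0,\infty)\to\mathcal{P}^\perp$ and $0\le s<t$, $$E^*V(\xi,s,t)=\sup\Big\{\sum_{k=1}^N(\tau_k-\tau_{k-1})E^*\Big(\tfrac{\xi(\tau_k)-\xi(\tau_{k-1})}{\tau_k-\tau_{k-1}}\Big): s=\tau_0<\dots<\tau_N=t\Big\},$$ with $E^*V(\xi,s,s)=0$. $\xi$ has locally finite $E^*$ variation if $E^*V(\xi,s,t)<\infty$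 for all $[s,t]\subset[0,\infty)$, and finite $E^*$ variation if $\lim_{t\to\infty}E^*V(\xi,0,t)$ is finite. Weak solution. A measurable $\xi:[0,\infty)\to\mathcal{P}^\perp$ (i.e. $t\mapsto\langle\xi(t),g\rangle$ is Lebesgue measurable for every $g\in C(\mathbb{S}^2)$) with locally finite $E^*$ variation is a weak solution if there is a measurable $\mathbf{g}:[0,\infty)\to C(\mathbb{S}^2)/\mathcal{P}$ such that $\mathbf{g}(t)\in\mathcal{J}^*(\xi(t))$ for a.e. $t\ge0$ and $$\tfrac12\|\xi(s)\|_*^2-\tfrac12\|\xi(t)\|_*^2=E^*V(\xi,s,t)+\int_s^tE(\mathbf{g}(\tau))\,d\tau$$ for almost every $0\le s\le t$, i.e. for all $0\le s\le t$ outside some null set of times. A function $f$ on $[0,\infty)$ is essentially nonincreasing if there is a null set $N$ with $f(t)\le f(s)$ whenever $t\ge s$ and $s,t\notin N$. *)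

(* Defs.v *)
From HB Require Import structures.
From mathcomp Require Import all_boot all_order all_algebra.
From mathcomp Require Import all_classical all_reals all_analysis.
From mathcomp Require Import measurable_realfun ring lra.

Set Implicit Arguments.
Unset Strict Implicit.
Unset Printing Implicit Defensive.

Import Order.TTheory GRing.Theory Num.Theory.
Import numFieldNormedType.Exports.

Local Open Scope classical_set_scope.
Local Open Scope ring_scope.

Section euclidean.
Context {R : realType}.
Implicit Types x y u : 'rV[R]_3.

Definition dot x y : R := \sum_i x 0 i * y 0 i.

(* The library norm on 'rV[R]_3 is the maximum norm (same topology). *)
Definition enorm x : R := Num.sqrt (dot x x).

Definition vec3 (a b c : R) : 'rV[R]_3 :=
  \row_i (if i == 0 then a else if i == 1 then b else c).

Lemma dot_vec3 a b c : dot (vec3 a b c) (vec3 a b c) = a ^+ 2 + b ^+ 2 + c ^+ 2.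
Proof.
rewrite /dot /vec3 !big_ord_recl big_ord0 !mxE /= addr0 addrA.
by rewrite -!expr2.
Qed.

End euclidean.

Definition sphere (R : realType) : set 'rV[R]_3 := [set u | dot u u = 1].
Arguments sphere R : clear implicits.

Definition S2 (R : realType) : Type := set_type (sphere R).
HB.instance Definition _ (R : realType) :=
  Topological.copy (S2 R) (set_type (sphere R)).

Definition emb {R : realType} (u : S2 R) : 'rV[R]_3 := set_val (u : set_type _).

Section spherical_coordinates.
Context {R : realType}.

Definition angles_vec (p : R * R) : 'rV[R]_3 :=
  vec3 (sin p.1 * cos p.2) (sin p.1 * sin p.2) (cos p.1).

Lemma angles_sphere p : angles_vec p \in sphere R.
Proof.
apply/mem_set; rewrite /sphere /= dot_vec3.
have h1 := cos2Dsin2 p.1; have h2 := cos2Dsin2 p.2.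
have -> : (sin p.1 * cos p.2) ^+ 2 + (sin p.1 * sin p.2) ^+ 2 + cos p.1 ^+ 2
   = sin p.1 ^+ 2 * (cos p.2 ^+ 2 + sin p.2 ^+ 2) + cos p.1 ^+ 2 by ring.
by rewrite h2 mulr1 addrC h1.
Qed.

Definition angles (p : R * R) : S2 R := exist _ (angles_vec p) (angles_sphere p).

End spherical_coordinates.

HB.instance Definition _ (R : realType) := isPointed.Build (S2 R) (angles (0, 0)).
HB.instance Definition _ (R : realType) :=
  Measurable.copy (S2 R) (g_sigma_algebraType (@open (S2 R))).

Section surface_measure.
Context {R : realType}.
Local Notation plane := (measurableTypeR R * measurableTypeR R)%type.
Local Notation leb := (@lebesgue_measure R).

Lemma open_prod_measurable (A : set (R * R)) :
  open A -> measurable (A : set plane).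
Proof.
move=> oA.
pose sq (q : rat * rat * nat) : set plane :=
  ball (ratr q.1.1 : R) (q.2.+1%:R^-1 : R) `*` ball (ratr q.1.2 : R) (q.2.+1%:R^-1 : R).
have -> : A = \bigcup_q (if `[< sq q `<=` A >] then sq q else set0).
  apply/seteqP; split => [p Ap|p [q _]]; last first.
    by case: asboolP => // + qp; exact.
  have : nbhs p A by exact: open_nbhs_nbhs.
  move=> /nbhs_ballP[e /= e0 eA].
  have [n ne] : exists n : nat, n.+1%:R^-1 < e / 2.
    have e20 : 0 < e / 2 by rewrite divr_gt0.
    have [n _ hn] := near_infty_natSinv_lt (PosNum e20).
    by exists n; apply: hn => /=.
  have n0 : 0 < n.+1%:R^-1 :> R by rewrite invr_gt0 ltr0n.
  have rt x : exists q : rat, ball (ratr q : R) n.+1%:R^-1 x.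
    move: (n.+1%:R^-1) n0 => d d0.
    have xl : x - d < x + d by lra.
    have [q] := rat_in_itvoo xl; rewrite in_itv /= => /andP[q1 q2].
    by exists q; rewrite /ball /= ltr_distl; apply/andP; split; lra.
  have [q1 hq1] := rt p.1; have [q2 hq2] := rt p.2.
  exists (q1, q2, n) => //; rewrite asboolT//=.
  move=> -[x y] [/= hx hy]; apply: eA.
  rewrite /ball /= in hq1 hq2 hx hy.
  move: (n.+1%:R^-1 : R) ne hq1 hq2 hx hy => d ne hq1 hq2 hx hy.
  split; rewrite /ball /=; move: hq1 hq2 hx hy; rewrite !ltr_distl.
    by move=> /andP[? ?] _ /andP[? ?] _; apply/andP; split; lra.
  by move=> _ /andP[? ?] _ /andP[? ?]; apply/andP; split; lra.
apply: countable_bigcupT_measurable => // q.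
case: asboolP => // _; apply: measurableX; apply: open_measurable;
  by apply: ball_open; rewrite invr_gt0 ltr0n.
Qed.

Lemma continuous_angles_vec : continuous (@angles_vec R).
Proof.
have cs f : continuous f -> continuous (fun p : R * R => f p.1 : R).
  by move=> cf p; apply: (continuous_comp (g := f)); [exact: cvg_fst|exact: cf].
have cc f : continuous f -> continuous (fun p : R * R => f p.2 : R).
  by move=> cf p; apply: (continuous_comp (g := f)); [exact: cvg_snd|exact: cf].
have ce i j : continuous (fun p => @angles_vec R p i j).
  move=> p; rewrite /angles_vec /vec3; under eq_fun do rewrite mxE.
  case: ifP => _; [|case: ifP => _].
  - apply: continuousM; first by apply: cs; exact: continuous_sin.
    by apply: cc; exact: continuous_cos.
  - apply: continuousM; first by apply: cs; exact: continuous_sin.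
    by apply: cc; exact: continuous_sin.
  - by apply: cs; exact: continuous_cos.
move=> p B /nbhs_ballP[e /= e0 eB].
have : \forall q \near p, forall i j, ball (angles_vec p i j) e (angles_vec q i j).
  pose P i j q := ball (angles_vec p i j) e (angles_vec q i j).
  apply: (@filter_forall _ _ (fun i q => forall j, P i j q) (nbhs p)) => i.
  apply: (@filter_forall _ _ (P i) (nbhs p)) => j.
  by have /cvgrPdist_lt/(_ _ e0) := ce i j p.
by apply: filterS => q hq; apply: eB.
Qed.

Lemma continuous_angles : continuous (@angles R).
Proof.
apply/continuousP => _ [B oB <-]; rewrite -comp_preimage.
by move/continuousP : continuous_angles_vec => /(_ B oB).
Qed.

Lemma measurable_angles : measurable_fun [set: plane] (@angles R : plane -> S2 R).
Proof.
apply: (@measurability _ _ plane (S2 R) setT _ (@open (S2 R))) => //.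
move=> _ [B oB <-]; rewrite setTI; apply: open_prod_measurable.
by move/continuousP : continuous_angles; exact.
Qed.

Definition angle_domain : set plane := `[0, pi] `*` `[0, 2 * pi].

(* Pushforward of sin(theta) dtheta dphi under spherical coordinates. *)
Definition surface_measure (A : set (S2 R)) : \bar R :=
  (\int[leb \x leb]_(p in angle_domain `&` angles @^-1` A) (sin p.1)%:E)%E.

Let measurable_dom A : measurable A ->
  measurable (angle_domain `&` angles @^-1` A : set plane).
Proof.
move=> mA; apply: measurableI; first exact: measurableX.
by rewrite -[X in measurable X]setTI; exact: measurable_angles.
Qed.

Let density_ge0 p : angle_domain p -> (0 <= (sin p.1)%:E :> \bar R)%E.
Proof.
move=> [/=]; rewrite in_itv /= => h0 _.
by rewrite lee_fin; exact: sin_ge0_pi.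
Qed.

Let surface0 : surface_measure set0 = 0%E.
Proof. by rewrite /surface_measure preimage_set0 setI0 integral_set0. Qed.

Let surface_ge0 A : (0 <= surface_measure A)%E.
Proof. by apply: integral_ge0 => p [/density_ge0]. Qed.

Let surface_sigma_additive : semi_sigma_additive surface_measure.
Proof.
move=> F mF tF mUF; rewrite /surface_measure preimage_bigcup setI_bigcupr.
rewrite ge0_integral_bigcup//=.
- by apply: is_cvg_ereal_nneg_natsum_cond => // n _ _; exact: surface_ge0.
- by move=> k; exact: measurable_dom.
- have msin : measurable_fun [set: plane] (EFin \o (fun p => sin p.1)).
    apply/measurable_EFinP.
    apply: (measurableT_comp (f := sin)); last exact: measurable_fst.
    by apply: continuous_measurable_fun; exact: continuous_sin.
  exact: (measurable_funS measurableT _ msin).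
- by move=> p [n _ [/density_ge0]].
- apply: trivIset_setIl => i j _ _ [p [/= Fi Fj]].
  by apply: tF => //; exists (angles p).
Qed.

HB.instance Definition _ := isMeasure.Build _ _ _ surface_measure
  surface0 surface_ge0 surface_sigma_additive.

End surface_measure.

Arguments surface_measure {R}.

Section constant_width.
Context {R : realType}.

Definition support_function (K : set 'rV[R]_3) (u : 'rV[R]_3) : R :=
  sup [set dot x u | x in K].

Definition constant_width_body (K : set 'rV[R]_3) : Prop :=
  [/\ compact K, convex_set K &
      forall u, support_function K u + support_function K (- u) = enorm u].

Definition width_class (g : S2 R -> R) : Prop :=
  exists2 K, constant_width_body K &
    forall u, g u + 2^-1 = support_function K (emb u).

End constant_width.

Section function_spaces.
Context {R : realType}.
Local Notation sigma := (@surface_measure R).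

Definition CS2 : Type := continuousType (S2 R) R.

Definition restr_linear (a : 'rV[R]_3) : S2 R -> R := fun u => dot a (emb u).

Definition sup_norm (f : S2 R -> R) : R := sup [set `|f u| | u in [set: S2 R]].

(* Norm of the class of f modulo restrictions of linear functions.  Classes are
   handled through representatives: all notions below are invariant under
   adding [restr_linear a]. *)
Definition class_norm (f : S2 R -> R) : R :=
  inf [set sup_norm (f \+ restr_linear a) | a in [set: 'rV[R]_3]].

Definition C1 (phi : 'rV[R]_3 -> R) : Prop :=
  (forall x, differentiable phi x) /\ forall v, continuous ('D_v phi).

Definition full_grad (phi : 'rV[R]_3 -> R) (x : 'rV[R]_3) : 'rV[R]_3 :=
  \row_i 'D_(delta_mx 0 i) phi x.

Definition tangential_grad (phi : 'rV[R]_3 -> R) (u : S2 R) : 'rV[R]_3 :=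
  full_grad phi (emb u) - dot (full_grad phi (emb u)) (emb u) *: emb u.

(* H^1(S^2) is the closure of the C^1 functions (every C^1 function on the
   sphere is the restriction of one on the ambient space) for the norm
   (|g|^2 + |grad g|^2)^(1/2) in L^2; the gradient is unique almost everywhere. *)
Definition is_sobolev_grad (g : S2 R -> R) (G : S2 R -> 'rV[R]_3) : Prop :=
  [/\ measurable_fun [set: S2 R] g,
      forall i, measurable_fun [set: S2 R] (fun u => G u 0 i) &
      exists2 phi : nat -> 'rV[R]_3 -> R, forall n, C1 (phi n) &
        (\int[sigma]_u ((g u - phi n (emb u)) ^+ 2)%:E)%E
          @[n --> \oo] --> (0 : \bar R)%E /\
        (\int[sigma]_u (enorm (G u - tangential_grad (phi n) u) ^+ 2)%:E)%E
          @[n --> \oo] --> (0 : \bar R)%E].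

Definition H1 (g : S2 R -> R) : Prop := exists G, is_sobolev_grad g G.

Definition sgrad (g : S2 R -> R) : S2 R -> 'rV[R]_3 :=
  xget (fun=> 0) [set G | is_sobolev_grad g G].

Definition Vspace (g : S2 R -> R) : Prop := H1 g /\ \int[sigma]_u g u = 0.

Definition Vinner (g h : S2 R -> R) : R :=
  \int[sigma]_u (dot (sgrad g u) (sgrad h u) - 2 * g u * h u).

Definition energy (g : S2 R -> R) : \bar R :=
  if `[< width_class g >]
  then (\int[sigma]_u (2^-1 * enorm (sgrad g u) ^+ 2 - g u ^+ 2))%:E
  else +oo%E.

End function_spaces.
Arguments CS2 : clear implicits.

Section duality.
Context {R : realType}.

(* On the compact metric space S^2 finite signed Radon measures are exactly
   the finite signed Borel measures. *)
Definition MS2 : Type := {charge set (S2 R) -> \bar R}.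
Implicit Types (xi zeta : MS2).

Definition hahn_sets xi :
  {PN : set (S2 R) * set (S2 R) | hahn_decomposition xi PN.1 PN.2}.
Proof.
by apply: cid; have [P [N PN]] := Hahn_decomposition xi; exists (P, N).
Defined.

Definition pairing xi (f : S2 R -> R) : R :=
  \int[jordan_pos (projT2 (hahn_sets xi))]_u f u
  - \int[jordan_neg (projT2 (hahn_sets xi))]_u f u.

Definition Pperp : set MS2 := [set xi | forall a, pairing xi (restr_linear a) = 0].

Definition dual_norm xi : R :=
  sup [set pairing xi g | g in [set g : CS2 R | class_norm g <= 1]].

Definition duality_map (g : CS2 R) : set MS2 :=
  [set xi | Pperp xi /\ forall h : CS2 R,
    2^-1 * class_norm g ^+ 2 + pairing xi (h \- g) <= 2^-1 * class_norm h ^+ 2].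

Definition duality_map_dual xi : set (CS2 R) :=
  [set g | forall zeta, Pperp zeta ->
    2^-1 * dual_norm xi ^+ 2 + (pairing zeta g - pairing xi g)
    <= 2^-1 * dual_norm zeta ^+ 2].

Definition energy_dual zeta : \bar R :=
  ereal_sup [set ((pairing zeta g)%:E - energy g)%E |
             g in [set g : CS2 R | width_class g]].

End duality.
Arguments MS2 : clear implicits.

Section evolution.
Context {R : realType}.

(* Lebesgue (completed) sigma-algebra and measure on the time axis. *)
Definition time : Type := caratheodory_type (wlength (@idfun R))^*%mu.
HB.instance Definition _ := Measurable.copy time
  (caratheodory_type (wlength (@idfun R))^*%mu).
Local Notation leb := (@completed_lebesgue_measure R).

Implicit Types (xi : R -> MS2 R) (g : R -> CS2 R).

Definition null_times (N : set R) : Prop := N `<=` `[0, +oo[ /\ leb.-negligible N.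

Definition ae_time (P : R -> Prop) : Prop :=
  exists2 N, null_times N & forall t, 0 <= t -> ~ N t -> P t.

Definition difference_quotient xi (a b : R) : MS2 R :=
  cscale (b - a)^-1 (cadd (xi b) (copp (xi a))).

(* For s < t every admissible N is positive; for s = t only N = 0 is
   admissible and the value is 0. *)
Definition energy_variation xi (s t : R) : \bar R :=
  ereal_sup [set x | exists (N : nat) (tau : nat -> R),
    [/\ tau 0%N = s, tau N = t, forall k, (k < N)%N -> tau k < tau k.+1 &
        x = (\sum_(k < N) (tau k.+1 - tau k)%:E *
             energy_dual (difference_quotient xi (tau k) (tau k.+1)))%E]].

Definition locally_finite_variation xi : Prop :=
  forall s t, 0 <= s -> s <= t -> (energy_variation xi s t < +oo)%E.

Definition finite_variation xi : Prop :=
  exists l : R, energy_variation xi 0 t @[t --> +oo%R] --> l%:E.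

Definition measurable_dual_path xi : Prop :=
  forall f : CS2 R, measurable_fun (`[0, +oo[ : set time) (fun t : time => pairing (xi t) f).

Definition class_open (U : set (CS2 R)) : Prop :=
  forall f, U f -> exists2 e : R, 0 < e &
    forall h : CS2 R, class_norm (h \- f) < e -> U h.

Definition measurable_class_path g : Prop :=
  forall U, class_open U -> measurable [set t : time | 0 <= t /\ U (g t)].

Definition V_open (U : set (S2 R -> R)) : Prop :=
  forall f, Vspace f -> U f -> exists2 e : R, 0 < e &
    forall h, Vspace h -> Vinner (h \- f) (h \- f) < e -> U h.

Definition L2_V_path g : Prop :=
  [/\ ae_time (fun t => Vspace (g t)),
      forall U, V_open U ->
        measurable [set t : time | [/\ 0 <= t, Vspace (g t) & U (g t)]] &
      (\int[leb]_(t in `[0%R, +oo[) (Vinner (g t) (g t))%:E < +oo)%E].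

Definition ess_nonincreasing (f : R -> \bar R) : Prop :=
  exists2 N, null_times N & forall s t, 0 <= s -> s <= t -> ~ N s -> ~ N t ->
    (f t <= f s)%E.

Definition corresponding xi g : Prop :=
  [/\ measurable_class_path g,
      ae_time (fun t => duality_map_dual (xi t) (g t)) &
      exists2 N, null_times N & forall s t, 0 <= s -> s <= t -> ~ N s -> ~ N t ->
        ((2^-1 * dual_norm (xi s) ^+ 2 - 2^-1 * dual_norm (xi t) ^+ 2)%:E
         = energy_variation xi s t + \int[leb]_(r in `[s, t]) energy (g r))%E].

Definition weak_solution xi : Prop :=
  [/\ forall t, 0 <= t -> Pperp (xi t), measurable_dual_path xi,
      locally_finite_variation xi & exists g, corresponding xi g].

End evolution.

(* Main.v *)
(* For H^1 functions of a width class the energy controls the distance to linear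
   functions.  Such a g is odd, so folding the sphere to the octant
   (theta, phi) in [0, pi/2]^2 and splitting into characters of the sign group
   leaves four components; each vanishes on coordinate planes where one of the
   linear functions x, y, z, z vanishes.  These are positive Dirichlet
   eigenfunctions with eigenvalue 2, so writing a component as psi h gives
   int |grad f|^2 - 2 f^2 = int psi^2 |grad h|^2: the energy is nonnegative, and
   if it is small then h is almost constant away from the boundary.  Modulo a
   linear function g is 1-Lipschitz, which turns this L^2 statement into a
   uniform one: small energy forces a small norm of the class.
   In time, the energy identity forces the energy to be finite at almost every
   time, where it is half the V-norm squared.  It is thus an integrable,
   essentially nonincreasing, nonnegative function, so t E(g(t)) -> 0, and then
   the norm tends to 0 as well. *)
Require Import Defs.
From mathcomp Require Import all_boot all_order all_algebra.
From mathcomp Require Import all_classical all_reals all_analysis.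
From mathcomp Require Import measurable_realfun ring lra.
Import Order.TTheory GRing.Theory Num.Theory.
Import numFieldNormedType.Exports.

Set Implicit Arguments.
Unset Strict Implicit.
Unset Printing Implicit Defensive.

Local Open Scope classical_set_scope.
Local Open Scope ring_scope.

(** * Integrals over intervals and rectangles *)

(** The quadratic form is negative on constants and zero on linear functions, so its sign rests on
    oddness: the sign characters that are even under the antipode, the constant one among them,
    vanish on [g]. For each odd character the substitution turns the missing spectral gap into an
    integration by parts on a rectangle of angles. That needs a C^1 function, whereas [g] is only an
    L^2 limit of such functions together with their gradients, and an approximant [Phi] is neither
    odd nor Lipschitz with a uniform constant. The even part of [Phi] is therefore charged to the
    L^2 error, the ground state estimate is run on the odd components of [Phi], and its outcome is
    carried to [g] through averages over squares of side [rho]; the Lipschitz bound of [g] alone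
    recovers values from averages. A body may lie anywhere, so no constant may depend on the linear
    part [dot p] of [g]. The parameters are fixed in the order [delta] (collar along the boundary of
    the octant), [rho], [lam] (weight in the passage from L^2 to L^1), [kappa] (approximation
    error), each depending on the previous ones. *)

Section bounded_measurable.
Context d {T : measurableType d} {R : realType}.
Implicit Types (B : set T) (f g : T -> R).

(** On sets of finite measure this implies integrability, and unlike integrability it is stable
    under products, so side conditions follow the shape of the integrand. *)
Definition bmeas B f :=
  measurable_fun B f /\ exists M, forall x, B x -> `|f x| <= M.

Lemma bmeas_cst B (c : R) : bmeas B (cst c).
Proof. by split; [exact: measurable_cst|exists `|c|]. Qed.

Lemma bmeasD B f g : bmeas B f -> bmeas B g -> bmeas B (fun x => f x + g x).
Proof.
move=> [mf [M fM]] [mg [N gN]]; split; first exact: measurable_funD.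
exists (M + N) => x Bx; apply: le_trans (ler_normD _ _) _.
by apply: lerD; [exact: fM|exact: gN].
Qed.

Lemma bmeasM B f g : bmeas B f -> bmeas B g -> bmeas B (fun x => f x * g x).
Proof.
move=> [mf [M fM]] [mg [N gN]]; split; first exact: measurable_funM.
exists (M * N) => x Bx; rewrite normrM.
by apply: ler_pM => //; [exact: fM|exact: gN].
Qed.

Lemma bmeasN B f : bmeas B f -> bmeas B (fun x => - f x).
Proof.
move=> bf; have := bmeasM (bmeas_cst B (-1)) bf.
by congr bmeas; apply/funext => x /=; rewrite mulN1r.
Qed.

Lemma bmeasB B f g : bmeas B f -> bmeas B g -> bmeas B (fun x => f x - g x).
Proof. by move=> bf bg; apply: bmeasD => //; exact: bmeasN. Qed.

Lemma bmeasX B f n : bmeas B f -> bmeas B (fun x => f x ^+ n).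
Proof.
move=> bf; elim: n => [|n ih]; first exact: bmeas_cst.
have := bmeasM bf ih; congr bmeas.
by apply/funext => x; rewrite exprS.
Qed.

Lemma bmeas_norm B f : bmeas B f -> bmeas B (fun x => `|f x|).
Proof.
move=> [mf [M fM]]; split; first exact: measurableT_comp.
by exists M => x Bx; rewrite normr_id fM.
Qed.

Lemma bmeasS B C f : measurable C -> B `<=` C -> bmeas C f -> bmeas B f.
Proof.
move=> mC BC [mf [M fM]]; split; first exact: measurable_funS mf.
by exists M => x /BC; exact: fM.
Qed.

Lemma bmeas_eq B f g : {in B, f =1 g} -> bmeas B f -> bmeas B g.
Proof.
move=> fg [mf [M fM]]; split; first exact: eq_measurable_fun mf.
by exists M => x Bx; rewrite -fg ?inE//; exact: fM.
Qed.

Lemma bmeas_integrable (mu : {measure set T -> \bar R}) B f :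
  measurable B -> (mu B < +oo)%E -> bmeas B f -> mu.-integrable B (EFin \o f).
Proof.
move=> mB Boo [mf [M fM]]; apply: measurable_bounded_integrable => //.
exists M; split; first exact: num_real.
by move=> N MN x Bx; apply: le_trans (fM _ Bx) (ltW MN).
Qed.

End bounded_measurable.

Section interval_integral.
Context {R : realType}.
Local Notation leb := (@lebesgue_measure R).
Implicit Types (a b c : R) (f g F : R -> R).

Definition itvI a b f : R := \int[leb]_(x in `[a, b]) f x.

Lemma itv_lty a b : (leb `[a, b] < +oo)%E.
Proof. by rewrite lebesgue_measure_itv /=; case: ifP => _; rewrite ?ltry. Qed.

Lemma bmeas_itv_integrable a b f :
  bmeas `[a, b] f -> leb.-integrable `[a, b] (EFin \o f).
Proof.
apply: (@bmeas_integrable _ (measurableTypeR R) R leb) => //.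
exact: itv_lty.
Qed.

Lemma continuous_in_bmeas a b f : {in `[a, b], continuous f} -> bmeas `[a, b] f.
Proof.
move=> cf; have cf' : {within `[a, b], continuous f}.
  by apply: continuous_in_subspaceT => x; rewrite inE; exact: cf.
split; first exact: subspace_continuous_measurable_fun.
have /compact_bounded[M [_ fM]] : compact (f @` `[a, b]).
  by apply: continuous_compact => //; exact: segment_compact.
exists (M + 1) => x Bx; apply: (fM (M + 1)); first by rewrite ltrDl.
by exists x.
Qed.

Lemma continuous_bmeas a b f : continuous f -> bmeas `[a, b] f.
Proof. by move=> cf; apply: continuous_in_bmeas => x _; exact: cf. Qed.

Lemma itvI_FTC a b f F : a <= b -> {in `[a, b], continuous f} ->
  {in `[a, b], forall x : R, is_derive x 1 (F : R -> R^o) (f x)} ->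
  itvI a b f = F b - F a.
Proof.
rewrite le_eqVlt => /predU1P[<- _ _|ab cf dF].
  by rewrite subrr /itvI set_itv1 Rintegral_set1.
have cF x : x \in `[a, b] -> {for x, continuous F}.
  move=> xab; apply: differentiable_continuous; apply/derivable1_diffP.
  by have [] := dF _ xab.
rewrite /itvI /Rintegral (@continuous_FTC2 _ f F)//.
- apply: continuous_in_subspaceT => x; rewrite inE; exact: cf.
- split.
  + by move=> x /subset_itv_oo_cc xab; have [] := dF _ xab.
  + by apply: cvg_at_right_filter; apply: cF; rewrite in_itv /= lexx ltW.
  + by apply: cvg_at_left_filter; apply: cF; rewrite in_itv /= lexx ltW.
- move=> x /subset_itv_oo_cc xab; rewrite derive1E.
  by have [_ ->] := dF _ xab.
Qed.

Lemma itvI_cst a b (c : R) : a <= b -> itvI a b (cst c) = c * (b - a).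
Proof.
move=> ab; rewrite /itvI Rintegral_cst//.
congr (_ * _); transitivity (fine (leb `[a, b])) => //.
rewrite lebesgue_measure_itv /= lte_fin.
case: ltP => [_|ba]; first by rewrite EFinN -EFinB.
by rewrite (le_anti (introT andP (conj ab ba))) subrr.
Qed.

Lemma itvI_le a b f g : bmeas `[a, b] f -> bmeas `[a, b] g ->
  (forall x, a <= x <= b -> f x <= g x) -> itvI a b f <= itvI a b g.
Proof.
move=> bf bg fg; apply: le_Rintegral => //; exact: bmeas_itv_integrable.
Qed.

Lemma itvI_eq a b f g :
  (forall x, a <= x <= b -> f x = g x) -> itvI a b f = itvI a b g.
Proof. by move=> fg; apply: eq_Rintegral => x; rewrite inE /= in_itv => /fg. Qed.

Lemma itvID a b f g : bmeas `[a, b] f -> bmeas `[a, b] g ->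
  itvI a b (fun x => f x + g x) = itvI a b f + itvI a b g.
Proof. by move=> bf bg; apply: RintegralD => //; exact: bmeas_itv_integrable. Qed.

Lemma itvIB a b f g : bmeas `[a, b] f -> bmeas `[a, b] g ->
  itvI a b (fun x => f x - g x) = itvI a b f - itvI a b g.
Proof. by move=> bf bg; apply: RintegralB => //; exact: bmeas_itv_integrable. Qed.

Lemma itvI_split a b c f : bmeas `[a, c] f -> a <= b -> b <= c ->
  itvI a c f = itvI a b f + itvI b c f.
Proof.
move=> bf ab bc; rewrite /itvI.
have fi := bmeas_itv_integrable bf.
have := @Rintegral_itvB _ f (BLeft a) (BRight c) b fi.
rewrite !bnd_simp => /(_ ab bc) h.
rewrite -(@Rintegral_itv_obnd_cbnd _ b); first by rewrite -h addrC subrK.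
apply: integrableS fi => //; apply: subset_itvr.
by rewrite bnd_simp.
Qed.

Lemma itvI_sub a b a' b' f : bmeas `[a', b'] f -> a' <= a -> a <= b -> b <= b' ->
  (forall x, a' <= x <= b' -> 0 <= f x) -> itvI a b f <= itvI a' b' f.
Proof.
move=> bf aa ab bb f0.
have bf' : bmeas `[a, b'] f by apply: bmeasS bf => //; apply: subset_itvr; rewrite bnd_simp.
rewrite (@itvI_split a' a b')//; last exact: le_trans bb.
rewrite (@itvI_split a b b')// addrCA lerDl addr_ge0//; apply: Rintegral_ge0 => x /=;
  rewrite in_itv /= => /andP[x1 x2]; apply: f0; apply/andP; split => //.
- exact: le_trans x2 (le_trans ab bb).
- exact: le_trans aa (le_trans ab x1).
Qed.

Lemma itvI_refl a b (r : R) f : a <= b -> continuous f ->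
  itvI (r - b) (r - a) f = itvI a b (fun x => f (r - x)).
Proof.
move=> ab cf; rewrite /itvI /Rintegral; congr fine.
have dE : (fun x : R => r - x : R)^`()%classic = cst (-1) :> (R -> R).
  by apply/funext => x; rewrite derive1E deriveB// derive_id derive_cst sub0r.
have cr : continuous (fun x : R => r - x).
  by move=> x; apply: cvgB; [exact: cvg_cst|exact: cvg_id].
rewrite (@integration_by_substitution_decreasing _ (fun x => r - x))//.
- by rewrite dE; apply: eq_integral => x _; rewrite !fctE opprK mulr1.
- by move=> x y _ _ xy; rewrite ltrD2l ltrN2.
- by rewrite dE => x _; exact: cvg_cst.
- by rewrite dE; exact: is_cvg_cst.
- by rewrite dE; exact: is_cvg_cst.
- split.
  + by move=> x _; exact: derivableB.
  + by apply: cvg_at_right_filter; exact: cr.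
  + by apply: cvg_at_left_filter; exact: cr.
- exact: continuous_subspaceT.
Qed.

(** Used in both angles to bring the integral over the sphere down to a single octant. *)
Lemma itvI_fold b f : 0 <= b -> continuous f ->
  itvI 0 (2 * b) f = itvI 0 b (fun x => f x + f (2 * b - x)).
Proof.
move=> b0 cf; have b2 : b <= 2 * b by lra.
rewrite (@itvI_split 0 b)//; last exact: continuous_bmeas.
rewrite itvID; [|exact: continuous_bmeas|apply: continuous_bmeas].
  congr (_ + _); rewrite -itvI_refl// subr0.
  by rewrite (_ : 2 * b - b = b)// mulr_natl mulr2n addrK.
move=> x; apply: continuous_comp; last exact: cf.
by apply: cvgB; [exact: cvg_cst|exact: cvg_id].
Qed.

End interval_integral.

Lemma continuous_pair (S T U : topologicalType) (f : S -> T) (g : S -> U) :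
  continuous f -> continuous g -> continuous (fun x => (f x, g x)).
Proof. by move=> cf cg x; apply: cvg_pair; [exact: cf|exact: cg]. Qed.

Section double_integral.
Context {R : realType}.
Local Notation leb := (@lebesgue_measure R).
Local Notation plane := (measurableTypeR R * measurableTypeR R)%type.
Local Notation mu2 := (leb \x leb)%E.
Implicit Types (a b c d : R) (F G : R * R -> R).

Definition box a b c d : set plane := `[a, b] `*` `[c, d].

Definition boxI a b c d F : R := \int[mu2]_(p in box a b c d) F p.

Lemma measurable_box a b c d : measurable (box a b c d).
Proof. exact: measurableX. Qed.
Hint Resolve measurable_box : core.

Lemma boxE a b c d (p : R * R) :
  box a b c d p <-> (a <= p.1 <= b) /\ (c <= p.2 <= d).
Proof. by rewrite /box /= !in_itv. Qed.

Lemma in_box a b c d (x y : R) : a <= x <= b -> c <= y <= d -> box a b c d (x, y).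
Proof. by move=> xab ycd; apply/boxE. Qed.

Lemma box_measureE a b c d : a <= b -> c <= d ->
  mu2 (box a b c d) = ((b - a) * (d - c))%:E.
Proof.
move=> ab cd; rewrite /box product_measure1E// EFinM.
have le x y : x <= y -> leb `[x, y] = (y - x)%:E.
  move=> xy; rewrite lebesgue_measure_itv /= lte_fin.
  case: ltP => [_|yx]; first by rewrite EFinN -EFinB.
  by rewrite (le_anti (introT andP (conj xy yx))) subrr.
by congr (_ * _)%E; exact: le.
Qed.

Lemma box_measure_lty a b c d : (mu2 (box a b c d) < +oo)%E.
Proof.
have [ab|ba] := leP a b; last first.
  rewrite /box (_ : `[a, b]%classic = set0) ?set0X ?measure0//.
  by apply/seteqP; split => // x /=; rewrite in_itv /=; lra.
have [cd|dc] := leP c d; last first.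
  rewrite /box (_ : `[c, d]%classic = set0) ?setX0 ?measure0//.
  by apply/seteqP; split => // x /=; rewrite in_itv /=; lra.
by rewrite box_measureE// ltry.
Qed.

Lemma bmeas_box_integrable a b c d F : bmeas (box a b c d) F ->
  mu2.-integrable (box a b c d) (EFin \o F).
Proof. by apply: bmeas_integrable => //; exact: box_measure_lty. Qed.

Lemma continuous_measurable_plane F : continuous F ->
  measurable_fun [set: plane] (F : plane -> R).
Proof.
move=> /continuousP cF; apply: (measurability _ (RGenOpens.measurableE R)).
move=> _ [_ [a [b ->]] <-]; rewrite setTI; apply: open_prod_measurable.
by apply: cF; exact: interval_open.
Qed.

Lemma continuous_bmeas_box a b c d F : continuous F -> bmeas (box a b c d) F.
Proof.
move=> cF; split; first by apply: measurable_funTS; exact: continuous_measurable_plane.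
have /compact_bounded[M [_ fM]] : compact (F @` ((`[a, b] `*` `[c, d]) : set (R * R))).
  apply: continuous_compact; last by apply: compact_setX; exact: segment_compact.
  exact: continuous_subspaceT.
exists (M + 1) => x Bx; apply: (fM (M + 1)); first by rewrite ltrDl.
by exists x.
Qed.

Lemma bmeas_fst a b c d (f : R -> R) : bmeas `[a, b] f ->
  bmeas (box a b c d) (fun p => f p.1).
Proof.
move=> [mf [M fM]]; split.
  apply: (@measurable_comp _ _ _ _ _ _ `[a, b]) => //.
    by move=> _ [[x y] [/= xab _] <-].
  exact: measurable_funTS measurable_fst.
by exists M => -[x y] [/= xab _]; exact: fM.
Qed.

Lemma bmeas_snd a b c d (f : R -> R) : bmeas `[c, d] f ->
  bmeas (box a b c d) (fun p => f p.2).
Proof.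
move=> [mf [M fM]]; split.
  apply: (@measurable_comp _ _ _ _ _ _ `[c, d]) => //.
    by move=> _ [[x y] [/= _ ycd] <-].
  exact: measurable_funTS measurable_snd.
by exists M => -[x y] [/= _ ycd]; exact: fM.
Qed.

Lemma bmeas_sec1 a b c d F x : bmeas (box a b c d) F -> a <= x <= b ->
  bmeas `[c, d] (fun y => F (x, y)).
Proof.
move=> [mF [M FM]] xab; split.
  apply: (@measurable_comp _ _ _ _ _ _ (box a b c d)) => //.
    by move=> _ [y ycd <-]; split => //=; rewrite in_itv.
  by apply: measurable_funTS; exact: pair1_measurable.
by exists M => y ycd; apply: FM; split => //=; rewrite in_itv.
Qed.

Lemma bmeas_sec2 a b c d F y : bmeas (box a b c d) F -> c <= y <= d ->
  bmeas `[a, b] (fun x => F (x, y)).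
Proof.
move=> [mF [M FM]] ycd; split.
  apply: (@measurable_comp _ _ _ _ _ _ (box a b c d)) => //.
    by move=> _ [x xab <-]; split => //=; rewrite in_itv.
  by apply: measurable_funTS; exact: pair2_measurable.
by exists M => x xab; apply: FM; split => //=; rewrite in_itv.
Qed.

Lemma boxID a b c d F G : bmeas (box a b c d) F -> bmeas (box a b c d) G ->
  boxI a b c d (fun p => F p + G p) = boxI a b c d F + boxI a b c d G.
Proof. by move=> bF bG; apply: RintegralD => //; exact: bmeas_box_integrable. Qed.

Lemma boxIB a b c d F G : bmeas (box a b c d) F -> bmeas (box a b c d) G ->
  boxI a b c d (fun p => F p - G p) = boxI a b c d F - boxI a b c d G.
Proof. by move=> bF bG; apply: RintegralB => //; exact: bmeas_box_integrable. Qed.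

Lemma boxIZ a b c d F (r : R) : bmeas (box a b c d) F ->
  boxI a b c d (fun p => r * F p) = r * boxI a b c d F.
Proof. by move=> bF; apply: RintegralZl => //; exact: bmeas_box_integrable. Qed.

Lemma boxI_le a b c d F G : bmeas (box a b c d) F -> bmeas (box a b c d) G ->
  (forall p, box a b c d p -> F p <= G p) -> boxI a b c d F <= boxI a b c d G.
Proof. by move=> bF bG FG; apply: le_Rintegral => //; exact: bmeas_box_integrable. Qed.

Lemma boxI_eq a b c d F G :
  (forall p, box a b c d p -> F p = G p) -> boxI a b c d F = boxI a b c d G.
Proof. by move=> FG; apply: eq_Rintegral => p; rewrite inE => /FG. Qed.

Lemma boxI_ge0 a b c d F :
  (forall p, box a b c d p -> 0 <= F p) -> 0 <= boxI a b c d F.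
Proof. by move=> F0; exact: Rintegral_ge0. Qed.

Lemma boxI_cst a b c d (r : R) : a <= b -> c <= d ->
  boxI a b c d (cst r) = r * ((b - a) * (d - c)).
Proof.
move=> ab cd; rewrite /boxI Rintegral_cst//; congr (_ * _).
transitivity (fine (mu2 (box a b c d))) => //.
by rewrite box_measureE.
Qed.

Lemma boxI_sub a b c d a' b' c' d' F :
  bmeas (box a' b' c' d') F -> (forall p, box a' b' c' d' p -> 0 <= F p) ->
  box a b c d `<=` box a' b' c' d' ->
  boxI a b c d F <= boxI a' b' c' d' F.
Proof.
move=> bF F0 sB; rewrite /boxI.
have bF' := bmeasS (measurable_box _ _ _ _) sB bF.
have iF := bmeas_box_integrable bF; have iF' := bmeas_box_integrable bF'.
apply: fine_le; [exact: integrable_fin_num iF'|exact: integrable_fin_num iF|].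
apply: ge0_subset_integral => //.
by have [mF _] := bF; apply/measurable_EFinP.
Qed.

Section iterated.
Variables (a b c d : R) (F : R * R -> R).
Hypothesis bF : bmeas (box a b c d) F.

(** Extension by zero, because Fubini's theorem is applied on the whole plane. *)
Let Fr : plane -> \bar R := (EFin \o F) \_ (box a b c d).

Let intFr : mu2.-integrable setT Fr.
Proof.
have := bmeas_box_integrable bF.
by move/(integrable_mkcond _ (measurable_box _ _ _ _)).
Qed.

Let FrE1 x : a <= x <= b -> (\int[leb]_y Fr (x, y))%E = (itvI c d (fun y => F (x, y)))%:E.
Proof.
move=> xab; have b1 := bmeas_sec1 bF xab.
rewrite /itvI /Rintegral fineK; last exact/integrable_fin_num/bmeas_itv_integrable.
rewrite [RHS]integral_mkcond; apply: eq_integral => y _.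
rewrite /Fr !patchE; congr (if _ then _ else _).
apply/idP/idP; rewrite !inE; first by case.
by move=> ycd; split => //=; rewrite in_itv.
Qed.

Let FrE2 y : c <= y <= d -> (\int[leb]_x Fr (x, y))%E = (itvI a b (fun x => F (x, y)))%:E.
Proof.
move=> ycd; have b1 := bmeas_sec2 bF ycd.
rewrite /itvI /Rintegral fineK; last exact/integrable_fin_num/bmeas_itv_integrable.
rewrite [RHS]integral_mkcond; apply: eq_integral => x _.
rewrite /Fr !patchE; congr (if _ then _ else _).
apply/idP/idP; rewrite !inE; first by case.
by move=> xab; split => //=; rewrite in_itv.
Qed.

Let Fr01 x : ~~ (a <= x <= b) -> (\int[leb]_y Fr (x, y))%E = 0%E.
Proof.
move=> xab; apply: integral0_eq => y _; rewrite /Fr patchE ifF//.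
apply/negP; rewrite inE => -[/=]; rewrite in_itv /= => xab'.
by rewrite xab' in xab.
Qed.

Let Fr02 y : ~~ (c <= y <= d) -> (\int[leb]_x Fr (x, y))%E = 0%E.
Proof.
move=> xab; apply: integral0_eq => x _; rewrite /Fr patchE ifF//.
apply/negP; rewrite inE => -[/= _]; rewrite in_itv /= => xab'.
by rewrite xab' in xab.
Qed.

Lemma boxI_iter1 : boxI a b c d F = itvI a b (fun x => itvI c d (fun y => F (x, y))).
Proof.
rewrite /boxI [RHS]/itvI {1 2}/Rintegral; congr fine.
rewrite [LHS]integral_mkcond -integral12_prod_meas1//.
rewrite [RHS]integral_mkcond; apply: eq_integral => x _.
rewrite /fubini_F patchE; case: ifPn => [/set_mem|/negP nx].
  by rewrite /= in_itv => /FrE1.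
by apply: Fr01; apply/negP => xab; apply: nx; rewrite inE /= in_itv.
Qed.

Lemma boxI_iter2 : boxI a b c d F = itvI c d (fun y => itvI a b (fun x => F (x, y))).
Proof.
rewrite /boxI [RHS]/itvI {1 2}/Rintegral; congr fine.
rewrite [LHS]integral_mkcond -integral21_prod_meas1//.
rewrite [RHS]integral_mkcond; apply: eq_integral => x _.
rewrite /fubini_G patchE; case: ifPn => [/set_mem|/negP nx].
  by rewrite /= in_itv => /FrE2.
by apply: Fr02; apply/negP => xab; apply: nx; rewrite inE /= in_itv.
Qed.

Lemma bmeas_inner2 : a <= b -> bmeas `[c, d] (fun y => itvI a b (fun x => F (x, y))).
Proof.
move=> ab; split.
  apply/measurable_EFinP.
  apply: (@eq_measurable_fun _ _ _ _ _ (fun y => \int[leb]_x Fr (x, y))%E).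
    by move=> y /set_mem /=; rewrite in_itv => /FrE2.
  by apply: measurable_funTS; exact: (measurable_fubini_G intFr).
have [_ [M FM]] := bF; exists (M * (b - a)) => y; rewrite /= in_itv /= => ycd.
have bs := bmeas_sec2 bF ycd.
apply: le_trans (le_normr_Rintegral _ (bmeas_itv_integrable bs)) _ => //.
rewrite -itvI_cst//; apply: itvI_le; [exact: bmeas_norm|exact: bmeas_cst|].
by move=> x xab; apply: FM; apply/boxE.
Qed.

End iterated.

Lemma boxI_norm a b c d F : bmeas (box a b c d) F ->
  `|boxI a b c d F| <= boxI a b c d (fun p => `|F p|).
Proof. by move=> bF; apply: le_normr_Rintegral => //; exact: bmeas_box_integrable. Qed.

Lemma boxI_fold1 a c d F : 0 <= a -> continuous F ->
  boxI 0 (2 * a) c d F = boxI 0 a c d (fun p => F p + F (2 * a - p.1, p.2)).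
Proof.
move=> a0 cF.
have cid : continuous (fun x : R => x) by move=> x; exact: cvg_id.
have cy y : continuous (fun x => F (x, y)).
  move=> x; apply: (continuous_comp (g := F)); last exact: cF.
  by apply: continuous_pair => // z; exact: cvg_cst.
have cG : continuous (fun p : R * R => F (2 * a - p.1, p.2)).
  move=> p; apply: (continuous_comp (g := F)); last exact: cF.
  apply: continuous_pair => [q|q]; last exact: cvg_snd.
  by apply: cvgB; [exact: cvg_cst|exact: cvg_fst].
rewrite boxI_iter2; last exact: continuous_bmeas_box.
under itvI_eq do rewrite itvI_fold//.
by rewrite boxI_iter2//; apply: bmeasD; exact: continuous_bmeas_box.
Qed.

Lemma boxI_fold2 a b c F : 0 <= c -> continuous F ->
  boxI a b 0 (2 * c) F = boxI a b 0 c (fun p => F p + F (p.1, 2 * c - p.2)).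
Proof.
move=> c0 cF.
have cid : continuous (fun x : R => x) by move=> x; exact: cvg_id.
have cx x : continuous (fun y => F (x, y)).
  move=> y; apply: (continuous_comp (g := F)); last exact: cF.
  by apply: continuous_pair => // z; exact: cvg_cst.
have cG : continuous (fun p : R * R => F (p.1, 2 * c - p.2)).
  move=> p; apply: (continuous_comp (g := F)); last exact: cF.
  apply: continuous_pair => [q|q]; first exact: cvg_fst.
  by apply: cvgB; [exact: cvg_cst|exact: cvg_snd].
rewrite boxI_iter1; last exact: continuous_bmeas_box.
under itvI_eq do rewrite itvI_fold//.
by rewrite boxI_iter1//; apply: bmeasD; exact: continuous_bmeas_box.
Qed.

End double_integral.
#[global] Hint Resolve measurable_box : core.

(** * The surface integral in spherical coordinates *)

Section surface_integral.
Context {R : realType}.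
Local Notation leb := (@lebesgue_measure R).
Local Notation plane := (measurableTypeR R * measurableTypeR R)%type.
Local Notation mu2 := (leb \x leb)%E.
Local Notation sigma := (@surface_measure R).
Import HBNNSimple.

Lemma measurable_angle_domain : measurable (@angle_domain R).
Proof. exact: measurableX. Qed.
Hint Resolve measurable_angle_domain : core.

Lemma continuous_sin1 : continuous (fun p : R * R => sin p.1).
Proof.
move=> p; apply: (continuous_comp (g := sin)); first exact: cvg_fst.
exact: continuous_sin.
Qed.

Lemma sin1_ge0 (p : plane) : angle_domain p -> 0 <= sin p.1.
Proof. by move=> [/=]; rewrite in_itv /= => h0 _; exact: sin_ge0_pi. Qed.

Let msin D : measurable_fun (D : set plane) (fun p => (sin p.1)%:E).
Proof.
apply/measurable_EFinP; apply: measurable_funTS.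
by apply: continuous_measurable_plane; exact: continuous_sin1.
Qed.

Let mangles A : measurable A -> measurable (@angles R @^-1` A : set plane).
Proof. by move=> mA; rewrite -[X in measurable X]setTI; exact: measurable_angles. Qed.

(** The surface measure is given by its values on sets, which settles indicators. Simple functions
    follow by linearity, and monotone convergence is applied on both sides. *)
Lemma ge0_integral_surface (F : S2 R -> \bar R) :
  measurable_fun setT F -> (forall u, 0 <= F u)%E ->
  (\int[sigma]_u F u = \int[mu2]_(p in angle_domain) (F (angles p) * (sin p.1)%:E))%E.
Proof.
move=> mF F0.
pose h := nnsfun_approx measurableT mF.
have mh n (D : set plane) : measurable_fun D (fun p => (h n (angles p))%:E).
  apply/measurable_EFinP; apply: measurable_funTS.
  by apply: measurableT_comp => //; exact: measurable_angles.
have -> : (\int[sigma]_u F u = limn (fun n => \int[sigma]_u (EFin \o h n) u))%E.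
  have fE x : F x = lim ((EFin \o h n) x @[n --> \oo]).
    by apply/esym/cvg_lim => //; exact: cvg_nnsfun_approx.
  under eq_integral do rewrite fE.
  apply: monotone_convergence => //.
  - by move=> n; apply/measurable_EFinP.
  - by move=> n x _ //=; rewrite lee_fin.
  - by move=> x _ a b ab; rewrite lee_fin; exact/lefP/nd_nnsfun_approx.
have -> : (\int[mu2]_(p in angle_domain) (F (angles p) * (sin p.1)%:E)
    = limn (fun n => \int[mu2]_(p in angle_domain) ((h n (angles p))%:E * (sin p.1)%:E)))%E.
  have fg (p : plane) : (F (angles p) * (sin p.1)%:E
      = lim ((((h n (angles p))%:E * (sin p.1)%:E) @[n --> \oo])))%E.
    apply/esym/cvg_lim => //; apply: cvgeZr => //.
    by apply: (@cvg_nnsfun_approx _ _ _ _ measurableT _ mF).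
  under eq_integral do rewrite fg.
  apply: monotone_convergence => //.
  - by move=> n; apply: emeasurable_funM.
  - by move=> n p /sin1_ge0 ? /=; rewrite mule_ge0 ?lee_fin.
  - move=> p /sin1_ge0 ? a b ab; rewrite lee_wpmul2r ?lee_fin//.
    exact/lefP/nd_nnsfun_approx.
congr (limn _); apply/funext => n.
rewrite integralT_nnsfun sintegralE.
transitivity (\int[mu2]_(p in angle_domain) (\sum_(y \in range (h n))
    (y * \1_(h n @^-1` [set y]) (angles p))%:E * (sin p.1)%:E))%E; last first.
  apply: eq_integral => p _; rewrite -ge0_mule_fsuml => [|y]; last exact: nnfun_muleindic_ge0.
  by rewrite fsumEFin// -(fimfunE _ _).
rewrite ge0_integral_fsum//; last 2 first.
- move=> y; apply: emeasurable_funM => //; apply/measurable_EFinP.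
  apply: measurable_funM => //; apply: measurable_funTS.
  by apply: measurableT_comp => //; exact: measurable_angles.
- by move=> y p /sin1_ge0 ?; apply: mule_ge0; [exact: nnfun_muleindic_ge0|rewrite lee_fin].
apply: eq_fsbigr => r; rewrite inE => -[u _ <-].
under eq_integral do rewrite EFinM -muleA.
rewrite ge0_integralZl//; last 3 first.
- apply: emeasurable_funM => //; apply/measurable_EFinP; apply: measurable_funTS.
  by apply: measurableT_comp => //; exact: measurable_angles.
- by move=> p /sin1_ge0 ?; rewrite mule_ge0 ?lee_fin.
- by rewrite lee_fin.
congr (_ * _)%E; transitivity (surface_measure (h n @^-1` [set h n u])) => //.
rewrite /surface_measure [LHS]integral_mkcondr.
apply: eq_integral => p _; rewrite patchE indicE.
have -> : (p \in angles @^-1` (h n @^-1` [set h n u])) =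
    (angles p \in h n @^-1` [set h n u]) by apply/idP/idP; rewrite !inE.
by case: ifPn; rewrite ?mul1e ?mul0e.
Qed.

End surface_integral.
#[global] Hint Resolve measurable_angle_domain : core.

(** * Ground state substitution *)

Section ground_state.
Context {R : realType}.
Implicit Types (f ft fk : R * R -> R).

(* [fk] is the derivative in the azimuth divided by [sin theta]: the second
   component of the gradient in the orthonormal frame. *)
Definition polar_C1 f ft fk :=
  [/\ continuous f, continuous ft, continuous fk,
      forall x y : R, is_derive x (1 : R) (fun t : R => f (t, y) : R^o) (ft (x, y)) &
      forall x y : R, is_derive y (1 : R) (fun t : R => f (x, t) : R^o) (sin x * fk (x, y))].

Section identity.
Variables (a b c d : R) (p dp q dq : R -> R) (f ft fk : R * R -> R).
Hypotheses (ab : a <= b) (cd : c <= d).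
Hypothesis fC : polar_C1 f ft fk.
Hypothesis cdp : {in `[a, b], continuous dp}.
Hypothesis cdq : {in `[c, d], continuous dq}.
Hypothesis dpE : {in `[a, b], forall x : R, is_derive x (1 : R) (p : R -> R^o) (dp x)}.
Hypothesis dqE : {in `[c, d], forall x : R, is_derive x (1 : R) (q : R -> R^o) (dq x)}.
Hypothesis sin_pos : {in `[a, b], forall x : R, 0 < sin x}.
Hypothesis eigen : forall x y, x \in `[a, b] -> y \in `[c, d] ->
  dp x * sin x + p x * cos x + p x ^+ 2 * sin x + (dq y + q y ^+ 2) / sin x
  = - (2 * sin x).

(* [p] and [q] stand for the logarithmic derivatives of a positive eigenfunction
   psi(theta, phi) in theta and phi; [eigen] is its equation divided by psi. *)
Definition ground_squares (z : R * R) : R :=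
  sin z.1 * (ft z - p z.1 * f z) ^+ 2 +
  (sin z.1 * fk z - q z.2 * f z) ^+ 2 / sin z.1.

(** Twice the energy density times the area element. For [f = psi h] it is [psi^2 |grad h|^2] times
    the area element, up to the divergence terms [T1] and [T2]. *)
Definition polar_energy (z : R * R) : R :=
  sin z.1 * (ft z ^+ 2 + fk z ^+ 2 - 2 * f z ^+ 2).

Let derive_cont (x : R) (g : R -> R) dg :
  is_derive x (1 : R) (g : R -> R^o) dg -> {for x, continuous g}.
Proof.
move=> [dg1 _]; apply: differentiable_continuous; exact/derivable1_diffP.
Qed.

Let cp : {in `[a, b], continuous p}.
Proof. by move=> x /dpE; exact: derive_cont. Qed.

Let cq : {in `[c, d], continuous q}.
Proof. by move=> x /dqE; exact: derive_cont. Qed.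

Let csinV : {in `[a, b], continuous (fun x : R => (sin x)^-1)}.
Proof.
move=> x /sin_pos s0; apply: cvgV; first by rewrite gt_eqF.
exact: continuous_sin.
Qed.

Let bf : bmeas (box a b c d) f.
Proof. by have [cf _ _ _ _] := fC; exact: continuous_bmeas_box. Qed.
Let bft : bmeas (box a b c d) ft.
Proof. by have [_ cf _ _ _] := fC; exact: continuous_bmeas_box. Qed.
Let bfk : bmeas (box a b c d) fk.
Proof. by have [_ _ cf _ _] := fC; exact: continuous_bmeas_box. Qed.
Let bp : bmeas (box a b c d) (fun z => p z.1).
Proof. by apply: bmeas_fst; exact: continuous_in_bmeas. Qed.
Let bdp : bmeas (box a b c d) (fun z => dp z.1).
Proof. by apply: bmeas_fst; exact: continuous_in_bmeas. Qed.
Let bq : bmeas (box a b c d) (fun z => q z.2).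
Proof. by apply: bmeas_snd; exact: continuous_in_bmeas. Qed.
Let bdq : bmeas (box a b c d) (fun z => dq z.2).
Proof. by apply: bmeas_snd; exact: continuous_in_bmeas. Qed.
Let bsV : bmeas (box a b c d) (fun z => (sin z.1)^-1).
Proof. by apply: (bmeas_fst _ _ (f := fun x => (sin x)^-1)); exact: continuous_in_bmeas. Qed.
Let bs : bmeas (box a b c d) (fun z => sin z.1).
Proof. by apply: (bmeas_fst _ _ (f := sin)); apply: continuous_bmeas; exact: continuous_sin. Qed.
Let bc : bmeas (box a b c d) (fun z => cos z.1).
Proof. by apply: (bmeas_fst _ _ (f := cos)); apply: continuous_bmeas; exact: continuous_cos. Qed.

Lemma bmeas_ground_squares : bmeas (box a b c d) ground_squares.
Proof.
apply: bmeasD.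
  by apply: bmeasM => //; apply: bmeasX; apply: bmeasB => //; exact: bmeasM.
apply: bmeasM => //; apply: bmeasX; apply: bmeasB; exact: bmeasM.
Qed.

(** [T1] is the derivative in theta of [p sin(theta) f^2] and [T2] the derivative in phi of
    [q f^2 / sin(theta)], so both integrate to boundary terms. *)
Let T1 z := (dp z.1 * sin z.1 + p z.1 * cos z.1) * f z ^+ 2 +
  2 * (p z.1 * sin z.1 * (f z * ft z)).
Let T2 z := (dq z.2 * f z ^+ 2 + 2 * (q z.2 * (f z * (sin z.1 * fk z)))) / sin z.1.

Let bT1 : bmeas (box a b c d) T1.
Proof.
apply: bmeasD.
  apply: bmeasM; last exact: bmeasX.
  by apply: bmeasD; exact: bmeasM.
apply: bmeasM; first exact: bmeas_cst.
by apply: bmeasM; exact: bmeasM.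
Qed.

Let bT2 : bmeas (box a b c d) T2.
Proof.
apply: bmeasM => //; apply: bmeasD.
  by apply: bmeasM => //; exact: bmeasX.
apply: bmeasM; first exact: bmeas_cst.
by apply: bmeasM => //; apply: bmeasM => //; exact: bmeasM.
Qed.

(** The mixed terms of the squares cancel against those of [T1 + T2]; the coefficient of [f^2] that
    remains is the left side of [eigen]. *)
Let pointwise z : box a b c d z -> polar_energy z = ground_squares z + (T1 z + T2 z).
Proof.
case: z => x y [/= xab ycd].
have s0 := sin_pos xab; have e := eigen xab ycd.
rewrite /polar_energy /ground_squares /T1 /T2 /=.
have -> : sin x * (ft (x, y) ^+ 2 + fk (x, y) ^+ 2 - 2 * f (x, y) ^+ 2) =
  sin x * (ft (x, y) ^+ 2 + fk (x, y) ^+ 2) + - (2 * sin x) * f (x, y) ^+ 2 by ring.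
by rewrite -e; field; rewrite gt_eqF.
Qed.

Let boundary1 y := p b * sin b * f (b, y) ^+ 2 - p a * sin a * f (a, y) ^+ 2.
Let boundary2 x := (q d * f (x, d) ^+ 2 - q c * f (x, c) ^+ 2) / sin x.

Let int_T1 : boxI a b c d T1 = itvI c d boundary1.
Proof.
have [cf cft cfk ft' fk'] := fC.
rewrite boxI_iter2//; apply: itvI_eq => y ycd.
rewrite (@itvI_FTC _ a b _ (fun x => p x * sin x * f (x, y) ^+ 2))//.
  move=> x xab.
  have cfx (g : R * R -> R) : continuous g -> {for x, continuous (fun x => g (x, y))}.
    move=> cg; apply: (continuous_comp (g := g)); last exact: cg.
    by apply: continuous_pair => z; [exact: cvg_id|exact: cvg_cst].
  have := cfx _ cf; have := cfx _ cft => cft1 cf1.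
  have cs := @continuous_sin R x; have cc := @continuous_cos R x.
  have cp1 := cp xab; have cdp1 := cdp xab.
  rewrite /T1 /=.
  apply: cvgD; first apply: cvgM; first by apply: cvgD; apply: cvgM.
    by under eq_fun do rewrite expr2; rewrite expr2; exact: cvgM.
  apply: cvgM; first exact: cvg_cst.
  by apply: cvgM; apply: cvgM.
move=> x xab.
have h1 := dpE xab; have h2 := ft' x y.
apply: is_derive_eq; rewrite /T1 /=.
by rewrite /GRing.scale /=; ring.
Qed.

Let int_T2 : boxI a b c d T2 = itvI a b boundary2.
Proof.
have [cf cft cfk ft' fk'] := fC.
rewrite boxI_iter1//; apply: itvI_eq => x xab.
rewrite (@itvI_FTC _ c d _ (fun y => q y * f (x, y) ^+ 2 / sin x))//.
- by rewrite /boundary2 mulrBl.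
- move=> y ycd.
  have cfx (g : R * R -> R) : continuous g -> {for y, continuous (fun y => g (x, y))}.
    move=> cg; apply: (continuous_comp (g := g)); last exact: cg.
    by apply: continuous_pair => z; [exact: cvg_cst|exact: cvg_id].
  have := cfx _ cf; have := cfx _ cfk => cft1 cf1.
  have cq1 := cq ycd; have cdq1 := cdq ycd.
  rewrite /T2 /=.
  apply: cvgM; last exact: cvg_cst.
  apply: cvgD; first apply: cvgM => //.
    by under eq_fun do rewrite expr2; rewrite expr2; exact: cvgM.
  apply: cvgM; first exact: cvg_cst.
  by do 2 apply: cvgM => //; apply: cvgM => //; exact: cvg_cst.
- move=> y ycd.
  have h1 := dqE ycd; have h2 := fk' x y.
  apply: is_derive_eq; rewrite /T2 /=.
  by rewrite /GRing.scale /=; ring.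
Qed.

Lemma ground_state_ge (K : R) :
  {in `[c, d], forall y, - K <= boundary1 y} ->
  {in `[a, b], forall x, - K <= boundary2 x} ->
  boxI a b c d ground_squares - K * ((b - a) + (d - c)) <=
  boxI a b c d polar_energy.
Proof.
move=> K1 K2; rewrite (boxI_eq pointwise).
rewrite (boxID bmeas_ground_squares (bmeasD bT1 bT2)) lerD2l (boxID bT1 bT2) int_T1 int_T2.
have cf : continuous f by have [] := fC.
have i1 : itvI c d (cst (- K)) <= itvI c d boundary1.
  apply: itvI_le => //; first exact: bmeas_cst.
  have bsec x : bmeas `[c, d] (fun y => f (x, y)).
    by apply: (@bmeas_sec1 _ x x c d f x); [exact: continuous_bmeas_box|rewrite lexx].
  by apply: bmeasB; (apply: bmeasM; [exact: bmeas_cst|exact: bmeasX]).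
have i2 : itvI a b (cst (- K)) <= itvI a b boundary2.
  apply: itvI_le => //; first exact: bmeas_cst.
  apply: bmeasM; last exact: continuous_in_bmeas.
  have bsec y : bmeas `[a, b] (fun x => f (x, y)).
    by apply: (@bmeas_sec2 _ a b y y f y); [exact: continuous_bmeas_box|rewrite lexx].
  by apply: bmeasB; (apply: bmeasM; [exact: bmeas_cst|exact: bmeasX]).
rewrite !itvI_cst// in i1 i2.
lra.
Qed.

End identity.
End ground_state.

Lemma continuous_expr2 (T : topologicalType) (R : realType) (g : T -> R) :
  continuous g -> continuous (fun z => g z ^+ 2).
Proof.
move=> cg z; have -> : (fun z => g z ^+ 2) = (fun z => g z * g z).
  by apply/funext => y; rewrite expr2.
by apply: cvgM; exact: cg.
Qed.

(** * Dirichlet estimates on the octant, with the coordinate functions as ground states *)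

Section octant.
Context {R : realType}.
Implicit Types (f ft fk : R * R -> R).
Local Notation hpi := (pi / 2 : R).

Lemma hpi_bounds : 0 < pi / 2 :> R /\ pi / 2 < 2 :> R.
Proof. by have := @pihalf_02 R => /andP[]. Qed.

Lemma increment_le (F dF : R -> R) (a b M : R) : a <= b -> continuous dF ->
  (forall x : R, is_derive x (1 : R) (F : R -> R^o) (dF x)) ->
  (forall x, a <= x <= b -> `|dF x| <= M) -> `|F b - F a| <= M * (b - a).
Proof.
move=> ab cdF dFE dFM.
have <- : itvI a b dF = F b - F a by apply: itvI_FTC => // x _; exact: cdF.
have bdF := @continuous_bmeas _ a b dF cdF.
apply: le_trans (le_normr_Rintegral _ (bmeas_itv_integrable bdF)) _ => //.
rewrite -itvI_cst//; apply: itvI_le => //; [exact: bmeas_norm|exact: bmeas_cst].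
Qed.

(** The derivative of [sin x - x cos x] is [x sin x]. In the form [al * cot al <= 1] the bound
    controls the pole of the cotangent in the boundary terms. *)
Lemma mulr_cos_le_sin (x : R) : 0 <= x <= hpi -> x * cos x <= sin x.
Proof.
move=> /andP[x0 xh]; have := hpi_bounds => -[h0 h2].
have cg : continuous (fun x : R => x * sin x).
  by move=> y; apply: cvgM; [exact: cvg_id|exact: continuous_sin].
have e : itvI 0 x (fun x => x * sin x) = (sin x - x * cos x) - (sin 0 - 0 * cos 0).
  apply: (@itvI_FTC _ 0 x _ (fun x => sin x - x * cos x)) => // y _.
  by apply: is_derive_eq; rewrite /GRing.scale /=; ring.
rewrite sin0 mul0r subr0 subr0 in e.
rewrite -subr_ge0 -e; apply: Rintegral_ge0 => y /=; rewrite in_itv /= => /andP[y0 yx].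
by rewrite mulr_ge0// sin_ge0_pi//; apply/andP; split => //; lra.
Qed.

Definition cot (x : R) := cos x / sin x.
Definition dcot (x : R) := - (sin x ^+ 2)^-1.
Definition dtan (x : R) := (cos x ^+ 2)^-1.

Lemma is_derive_cot (x : R) : sin x != 0 -> is_derive x (1 : R) (cot : R -> R^o) (dcot x).
Proof.
move=> s0; rewrite /cot.
have h := is_deriveV s0 (is_derive_sin x).
apply: is_derive_eq; rewrite /dcot /GRing.scale /=.
have h1 := cos2Dsin2 x.
transitivity (- (cos x ^+ 2 + sin x ^+ 2) / sin x ^+ 2); first by field.
by rewrite h1; field.
Qed.

Lemma continuous_dcot (x : R) : sin x != 0 -> {for x, continuous dcot}.
Proof.
move=> s0; apply: cvgN; apply: cvgV; first by rewrite expf_eq0.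
by under eq_fun do rewrite expr2; rewrite expr2; apply: cvgM; exact: continuous_sin.
Qed.

Lemma continuous_dtan (x : R) : cos x != 0 -> {for x, continuous dtan}.
Proof.
move=> s0; apply: cvgV; first by rewrite expf_eq0.
by under eq_fun do rewrite expr2; rewrite expr2; apply: cvgM; exact: continuous_cos.
Qed.

Lemma sin_gt0_hpi (x : R) : 0 < x < pi / 2 -> 0 < sin x.
Proof.
by have := hpi_bounds; move=> [h0 _] /andP[x0 xh]; apply: sin_gt0_pi; apply/andP; split => //; lra.
Qed.

Lemma cos_gt0_hpi (x : R) : 0 < x < pi / 2 -> 0 < cos x.
Proof. by have := hpi_bounds; move=> [h0 _] /andP[x0 xh]; apply: cos_gt0_pihalf; apply/andP; split => //; lra. Qed.

Lemma cos_hpiB (x : R) : cos (pi / 2 - x) = sin x.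
Proof. by rewrite cosB cos_pihalf sin_pihalf mul0r mul1r add0r. Qed.

Lemma sin_hpiB (x : R) : sin (pi / 2 - x) = cos x.
Proof. by rewrite sinB cos_pihalf sin_pihalf mul0r mul1r subr0. Qed.

Definition inner (al : R) := box al (pi / 2 - al) al (pi / 2 - al).
Definition innerI (al : R) F := boxI al (pi / 2 - al) al (pi / 2 - al) F.

Section component.
Variables (f ft fk : R * R -> R) (M delta : R).
Hypothesis fC : polar_C1 f ft fk.
Hypotheses (delta0 : 0 < delta) (deltah : delta <= pi / 4).
Hypothesis fM : forall z : R * R, box 0 (pi / 2) 0 (pi / 2) z ->
  [/\ `|f z| <= M, `|ft z| <= M & `|fk z| <= M].

Let M0 : 0 <= M.
Proof.
have [h0 h2] := hpi_bounds; have d0 := delta0; have dh := deltah.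
have [|+ _ _] := @fM (0 : R, 0 : R); first by apply: in_box; lra.
exact: le_trans.
Qed.

(* psi vanishes on part of the boundary of the octant, so the identity is used on
   smaller boxes; its boundary terms are O(al) because f vanishes where psi does. *)
Lemma inner_limit (S : R * R -> R) (K : R) : 0 <= K ->
  (forall al : R, 0 < al <= delta ->
    [/\ bmeas (inner al) S, forall z, inner al z -> 0 <= S z &
        innerI al S - K * al <= innerI al (polar_energy f ft fk)]) ->
  innerI delta S <= boxI 0 (pi / 2) 0 (pi / 2) (polar_energy f ft fk).
Proof.
move=> K0 hS.
have [h0 h2] := hpi_bounds; have d0 := delta0; have dh := deltah.
have [cf cft cfk _ _] := fC.
have cD : continuous (polar_energy f ft fk).
  move=> z; apply: cvgM; first apply: (continuous_comp (g := sin)).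
  - exact: cvg_fst.
  - exact: continuous_sin.
  - apply: cvgB; first by apply: cvgD; exact: continuous_expr2.
    by apply: cvgM; [exact: cvg_cst|exact: continuous_expr2].
have bD a b c d : bmeas (box a b c d) (polar_energy f ft fk) by exact: continuous_bmeas_box.
have main al : 0 < al <= delta -> innerI delta S <=
    boxI 0 (pi / 2) 0 (pi / 2) (polar_energy f ft fk) + (K + 16 * M ^+ 2) * al.
  move=> /andP[al0 ald]; have [bS S0 le1] := hS al (introT andP (conj al0 ald)).
  have le2 : innerI delta S <= innerI al S.
    by apply: boxI_sub => // -[x y] /boxE /= [? ?]; apply: in_box; lra.
  (* The energy density may be negative, but adding [2 * M ^+ 2] makes it nonnegative and its
     integral monotone in the domain. The price is [2 * M ^+ 2] times the area of the frame between
     the boxes, which is at most [8 * al]. *)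
  have le3 : boxI al (pi / 2 - al) al (pi / 2 - al) (fun z => polar_energy f ft fk z + 2 * M ^+ 2) <=
      boxI 0 (pi / 2) 0 (pi / 2) (fun z => polar_energy f ft fk z + 2 * M ^+ 2).
    apply: boxI_sub.
    - by apply: bmeasD => //; exact: bmeas_cst.
    - move=> z Oz; have [fz _ _] := fM Oz.
      have /boxE[/andP[z0 z1] _] := Oz.
      have s0 : 0 <= sin z.1 by apply: sin_ge0_pi; apply/andP; split => //; lra.
      have s1 := sin_le1 z.1.
      have : f z ^+ 2 <= M ^+ 2.
        by rewrite -[leLHS]real_normK ?num_real// lerXn2r// nnegrE.
      rewrite /polar_energy; set s := sin z.1; set F := f z ^+ 2 => FM.
      have F0 : 0 <= F by exact: sqr_ge0.
      have := sqr_ge0 (ft z); have := sqr_ge0 (fk z); set u := ft z ^+ 2; set v := fk z ^+ 2.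
      move=> v0 u0; rewrite -/s in s0 s1.
      have : 0 <= s * (u + v) by rewrite mulr_ge0// addr_ge0.
      have : s * F <= M ^+ 2 by apply: le_trans FM; rewrite ler_piMl.
      by rewrite mulrBr => ? ?; lra.
    - by move=> -[x y] /boxE /= [? ?]; apply: in_box; lra.
  rewrite !boxID// ?boxI_cst in le3; try (lra || exact: bmeas_cst).
  rewrite /innerI in le1 le2 *.
  have e : pi / 2 * (pi / 2) - (pi / 2 - al - al) * (pi / 2 - al - al) <= 8 * al.
    have -> : pi / 2 * (pi / 2) - (pi / 2 - al - al) * (pi / 2 - al - al) =
      4 * al * (pi / 2 - al) :> R by ring.
    by rewrite -mulrA mulrC -mulrA (mulrC 8) ler_wpM2l//; lra.
  have : 2 * M ^+ 2 * (pi / 2 * (pi / 2) - (pi / 2 - al - al) * (pi / 2 - al - al)) <=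
     2 * M ^+ 2 * (8 * al) by rewrite ler_wpM2l// mulr_ge0// sqr_ge0.
  by move=> ?; lra.
have C0 : 0 <= K + 16 * M ^+ 2 by rewrite addr_ge0// mulr_ge0// sqr_ge0.
apply/ler_addgt0Pr => e e0.
pose al := Num.min delta (e / (K + 16 * M ^+ 2 + 1)).
have C1 : 0 < K + 16 * M ^+ 2 + 1 by lra.
have al0 : 0 < al by rewrite lt_min delta0 divr_gt0.
have ald : al <= delta by rewrite ge_min lexx.
apply: le_trans (main al _) _; first by rewrite al0.
rewrite lerD2l.
have : al <= e / (K + 16 * M ^+ 2 + 1) by rewrite ge_min lexx orbT.
rewrite ler_pdivlMr// => hal.
by apply: le_trans hal; rewrite mulrDr mulr1 mulrC lerDl ltW.
Qed.


Let f_theta x0 x y : 0 <= x0 <= hpi -> 0 <= x <= hpi -> 0 <= y <= hpi ->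
  f (x0, y) = 0 -> `|f (x, y)| <= M * `|x - x0|.
Proof.
have [h0 h2] := hpi_bounds; have d0 := delta0; have dh := deltah.
move=> hx0 hx hy f0; have [cf cft cfk dft dfk] := fC.
have cft1 : continuous (fun t => ft (t, y)).
  move=> t; apply: (continuous_comp (g := ft)); last exact: cft.
  by apply: continuous_pair => ?; [exact: cvg_id|exact: cvg_cst].
have b t : 0 <= t <= hpi -> `|ft (t, y)| <= M.
  by move=> ht; have [] := @fM (t, y) => //; exact: in_box.
have [xx|xx] := leP x0 x.
  have := @increment_le (fun t => f (t, y)) (fun t => ft (t, y)) x0 x M xx cft1
    (fun t => dft t y).
  rewrite f0 subr0 (@ger0_norm _ (x - x0)) ?subr_ge0//; apply=> t tx; apply: b; lra.
have := @increment_le (fun t => f (t, y)) (fun t => ft (t, y)) x x0 M (ltW xx) cft1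
    (fun t => dft t y).
by rewrite f0 sub0r normrN (@ltr0_norm _ (x - x0)) ?subr_lt0// opprB; apply=> t tx; apply: b; lra.
Qed.

(** The factor [sin x] must be kept: the boundary terms on the sides [phi = const] are divided by
    [sin x]. *)
Let f_phi x y0 y : 0 <= x <= hpi -> 0 <= y0 <= hpi -> 0 <= y <= hpi ->
  f (x, y0) = 0 -> `|f (x, y)| <= sin x * M * `|y - y0|.
Proof.
have [h0 h2] := hpi_bounds; have d0 := delta0; have dh := deltah.
move=> hx hy0 hy f0; have [cf cft cfk dft dfk] := fC.
have s0 : 0 <= sin x by apply: sin_ge0_pi; lra.
have cfk1 : continuous (fun t => sin x * fk (x, t)).
  move=> t; apply: cvgM; first exact: cvg_cst.
  apply: (continuous_comp (g := fk)); last exact: cfk.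
  by apply: continuous_pair => ?; [exact: cvg_cst|exact: cvg_id].
have b t : 0 <= t <= hpi -> `|sin x * fk (x, t)| <= sin x * M.
  move=> ht; rewrite normrM (ger0_norm s0) ler_wpM2l//.
  by have [] := @fM (x, t) => //; exact: in_box.
have [xx|xx] := leP y0 y.
  have := @increment_le (fun t => f (x, t)) (fun t => sin x * fk (x, t)) y0 y (sin x * M) xx cfk1
    (fun t => dfk x t).
  rewrite f0 subr0 (@ger0_norm _ (y - y0)) ?subr_ge0//; apply=> t tx; apply: b; lra.
have := @increment_le (fun t => f (x, t)) (fun t => sin x * fk (x, t)) y y0 (sin x * M) (ltW xx) cfk1
    (fun t => dfk x t).
by rewrite f0 sub0r normrN (@ltr0_norm _ (y - y0)) ?subr_lt0// opprB; apply=> t tx; apply: b; lra.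
Qed.

Let sq_le (u v : R) : `|u| <= v -> u ^+ 2 <= v ^+ 2.
Proof.
move=> uv; rewrite -[leLHS]real_normK ?num_real// lerXn2r// nnegrE//.
exact: le_trans uv.
Qed.

Let ground_squares_ge0 al p q z : 0 < al <= delta -> inner al z ->
  0 <= ground_squares p q f ft fk z.
Proof.
have [h0 h2] := hpi_bounds; have d0 := delta0; have dh := deltah.
move=> ald /boxE[zx _]; have s0 : 0 < sin z.1 by apply: sin_gt0_hpi; lra.
by apply: addr_ge0; rewrite mulr_ge0 ?invr_ge0 ?sqr_ge0// ltW.
Qed.

(** With [p = cot] the polar part of the eigenvalue equation is [1 / sin - 2 sin], so the azimuthal
    part [x = dq + q ^+ 2] has to be [-1]. This holds for the logarithmic derivatives of both [cos]
    and [sin]. *)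
Let eqeigen1 x (s c : R) : s != 0 -> s ^+ 2 + c ^+ 2 = 1 ->
  - (s ^+ 2)^-1 * s + c / s * c + (c / s) ^+ 2 * s + x / s = - (2 * s) + (x + 1) / s.
Proof.
move=> s0 e.
have c2 : c ^+ 2 = 1 - s ^+ 2 by rewrite -e; ring.
have -> : - (s ^+ 2)^-1 * s + c / s * c + (c / s) ^+ 2 * s + x / s
  = (- 1 + c ^+ 2 + c ^+ 2 + x) / s by field.
by rewrite c2; field.
Qed.

Let component_ge (p dp q dq : R -> R) :
  (forall x, 0 < x < hpi -> is_derive x (1 : R) (p : R -> R^o) (dp x)) ->
  (forall x, 0 < x < hpi -> is_derive x (1 : R) (q : R -> R^o) (dq x)) ->
  (forall x, 0 < x < hpi -> {for x, continuous dp}) ->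
  (forall x, 0 < x < hpi -> {for x, continuous dq}) ->
  (forall x y, 0 < x < hpi -> 0 < y < hpi ->
    dp x * sin x + p x * cos x + p x ^+ 2 * sin x + (dq y + q y ^+ 2) / sin x
    = - (2 * sin x)) ->
  (forall al y, 0 < al <= delta -> al <= y <= hpi - al ->
    - (2 * M ^+ 2 * al) <=
    p (hpi - al) * sin (hpi - al) * f (hpi - al, y) ^+ 2 - p al * sin al * f (al, y) ^+ 2) ->
  (forall al x, 0 < al <= delta -> al <= x <= hpi - al ->
    - (2 * M ^+ 2 * al) * sin x <= q (hpi - al) * f (x, hpi - al) ^+ 2 - q al * f (x, al) ^+ 2) ->
  innerI delta (ground_squares p q f ft fk) <=
  boxI 0 (pi / 2) 0 (pi / 2) (polar_energy f ft fk).
Proof.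
have [h0 h2] := hpi_bounds; have d0 := delta0; have dh := deltah.
(* Each boundary bound [2 * M ^+ 2 * al] gets multiplied by the sum of two sides, each shorter than
   2; [16] leaves room. *)
move=> dp1 dq1 cdp cdq eig b1 b2; apply: (@inner_limit _ (16 * M ^+ 2)).
  by rewrite mulr_ge0// sqr_ge0.
move=> al ald; have /andP[al0 ald'] := ald.
have inn x : x \in `[al, hpi - al] -> 0 < x < hpi by rewrite in_itv /= => ?; lra.
have sP x : x \in `[al, hpi - al] -> 0 < sin x by move/inn; exact: sin_gt0_hpi.
have dp2 : {in `[al, hpi - al], forall x : R, is_derive x (1 : R) (p : R -> R^o) (dp x)}.
  by move=> x /inn; exact: dp1.
have dq2 : {in `[al, hpi - al], forall x : R, is_derive x (1 : R) (q : R -> R^o) (dq x)}.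
  by move=> x /inn; exact: dq1.
have cdp2 : {in `[al, hpi - al], continuous dp} by move=> x /inn; exact: cdp.
have cdq2 : {in `[al, hpi - al], continuous dq} by move=> x /inn; exact: cdq.
have aa : al <= hpi - al by lra.
split; first exact: (bmeas_ground_squares fC dp2 dq2 sP).
  by move=> z; exact: ground_squares_ge0.
have eig2 x y : x \in `[al, hpi - al] -> y \in `[al, hpi - al] ->
    dp x * sin x + p x * cos x + p x ^+ 2 * sin x + (dq y + q y ^+ 2) / sin x = - (2 * sin x).
  by move=> /inn ? /inn ?; exact: eig.
have K1 : {in `[al, hpi - al], forall y, - (2 * M ^+ 2 * al) <=
    p (hpi - al) * sin (hpi - al) * f (hpi - al, y) ^+ 2 - p al * sin al * f (al, y) ^+ 2}.
  by move=> y; rewrite in_itv /= => ?; exact: b1.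
have K2 : {in `[al, hpi - al], forall x, - (2 * M ^+ 2 * al) <=
    (q (hpi - al) * f (x, hpi - al) ^+ 2 - q al * f (x, al) ^+ 2) / sin x}.
  by move=> x xi; rewrite ler_pdivlMr ?sP//; apply: b2; rewrite // in_itv /= in xi.
apply: le_trans (ground_state_ge aa aa fC cdp2 cdq2 dp2 dq2 sP eig2 K1 K2).
rewrite lerD2l lerN2.
have -> : 2 * M ^+ 2 * al * (pi / 2 - al - al + (pi / 2 - al - al)) =
  M ^+ 2 * al * (4 * (pi / 2 - al - al)) by ring.
have -> : 16 * M ^+ 2 * al = M ^+ 2 * al * 16 by ring.
by rewrite ler_wpM2l ?mulr_ge0 ?sqr_ge0 ?(ltW al0)//; lra.
Qed.

(** A simple pole against a double zero: [u^2] is of order [al^2] and [cot al] at most [1 / al], so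
    one power of [al] survives. *)
Let cot_sq_le (al u v : R) : 0 < al <= delta -> 0 <= v -> u ^+ 2 <= (v * al) ^+ 2 ->
  cos al / sin al * u ^+ 2 <= v ^+ 2 * al.
Proof.
have [h0 h2] := hpi_bounds; have d0 := delta0; have dh := deltah.
move=> ald v0 uv.
have sal : 0 < sin al by apply: sin_gt0_hpi; lra.
have cal : 0 < cos al by apply: cos_gt0_hpi; lra.
apply: (@le_trans _ _ (cos al / sin al * (v * al) ^+ 2)).
  by rewrite ler_wpM2l// divr_ge0// ltW.
have -> : cos al / sin al * (v * al) ^+ 2 = v ^+ 2 * al * (al * cos al / sin al) by ring.
rewrite ler_piMr//; first by rewrite mulr_ge0 ?sqr_ge0//; lra.
rewrite ler_pdivrMr// mul1r; apply: mulr_cos_le_sin; lra.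
Qed.

Let sq_sin_le (x al : R) : 0 < al -> 0 < sin x ->
  (sin x * M) ^+ 2 * al <= 2 * M ^+ 2 * al * sin x.
Proof.
move=> al0 s0; have s1 := sin_le1 x.
have -> : (sin x * M) ^+ 2 * al = M ^+ 2 * al * sin x * sin x by ring.
have -> : 2 * M ^+ 2 * al * sin x = M ^+ 2 * al * sin x * 2 by ring.
by rewrite ler_wpM2l// ?mulr_ge0 ?sqr_ge0// ?(ltW al0) ?(ltW s0)//; lra.
Qed.

(** Near the pole [cot * sin = cos] is bounded and [f ^+ 2] is at most [(M * al) ^+ 2]; the term
    near the equator is nonnegative. *)
Let polar_boundary (al y : R) : f (0, y) = 0 -> 0 < al <= delta -> al <= y <= hpi - al ->
  - (2 * M ^+ 2 * al) <= cot (hpi - al) * sin (hpi - al) * f (hpi - al, y) ^+ 2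
    - cot al * sin al * f (al, y) ^+ 2.
Proof.
have [h0 h2] := hpi_bounds; have d0 := delta0; have dh := deltah.
move=> f1 ald yab; have /andP[al0 ald'] := ald.
have sal : 0 < sin al by apply: sin_gt0_hpi; lra.
have cal : 0 < cos al by apply: cos_gt0_hpi; lra.
have fx : f (al, y) ^+ 2 <= (M * al) ^+ 2.
  apply: sq_le; have := @f_theta 0 al y; rewrite subr0 (gtr0_norm al0).
  by apply => //; lra.
rewrite /cot cos_hpiB sin_hpiB !divfK ?gt_eqF//.
have k1 : 0 <= sin al * f (hpi - al, y) ^+ 2 by rewrite mulr_ge0 ?sqr_ge0// ltW.
have k2 : cos al * f (al, y) ^+ 2 <= f (al, y) ^+ 2.
  by rewrite ler_piMl ?sqr_ge0// cos_le1.
have k3 : (M * al) ^+ 2 <= 2 * M ^+ 2 * al.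
  have -> : (M * al) ^+ 2 = M ^+ 2 * al * al by ring.
  have -> : 2 * M ^+ 2 * al = M ^+ 2 * al * 2 by ring.
  by rewrite ler_wpM2l// ?mulr_ge0 ?sqr_ge0// ?(ltW al0)//; lra.
lra.
Qed.

Let eigen_tan (y : R) : 0 < y < hpi -> - (cos y ^- 2) + (- tan y) ^+ 2 = -1.
Proof.
move=> hy; have c0 := cos_gt0_hpi hy.
have e := cos2Dsin2 y; rewrite /tan.
transitivity ((- (cos y ^+ 2 + sin y ^+ 2) + sin y ^+ 2) / cos y ^+ 2).
  by rewrite e; field; rewrite gt_eqF.
by field; rewrite gt_eqF.
Qed.

Let eigen_cot (y : R) : 0 < y < hpi -> dcot y + cot y ^+ 2 = -1.
Proof.
move=> hy; have s0 := sin_gt0_hpi hy.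
have e := cos2Dsin2 y; rewrite /cot /dcot.
transitivity ((- (cos y ^+ 2 + sin y ^+ 2) + cos y ^+ 2) / sin y ^+ 2).
  by rewrite e; field; rewrite gt_eqF.
by field; rewrite gt_eqF.
Qed.

Let eigen_polar x (t : R) : 0 < x < hpi -> t = -1 ->
  dcot x * sin x + cot x * cos x + cot x ^+ 2 * sin x + t / sin x = - (2 * sin x).
Proof.
move=> /sin_gt0_hpi s0 ->; rewrite /dcot /cot eqeigen1 ?gt_eqF//.
  by rewrite addNr mul0r addr0.
by rewrite addrC cos2Dsin2.
Qed.

(** The ground state is [sin(theta) cos(phi)]. Its azimuthal logarithmic derivative [- tan] blows up
    only at [phi = pi / 2], where [f] vanishes; the term at the other end has the favourable
    sign. *)
Lemma component_x : (forall y, f (0, y) = 0) -> (forall x, f (x, pi / 2) = 0) ->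
  innerI delta (ground_squares cot (fun y => - tan y) f ft fk) <=
  boxI 0 (pi / 2) 0 (pi / 2) (polar_energy f ft fk).
Proof.
have [h0 h2] := hpi_bounds; have d0 := delta0; have dh := deltah.
move=> f1 f2; apply: (@component_ge _ dcot _ (fun y => - (cos y ^- 2))).
- by move=> x /sin_gt0_hpi s0; apply: is_derive_cot; rewrite gt_eqF.
- by move=> x /cos_gt0_hpi s0; apply: is_deriveN; apply: is_derive_tan; rewrite gt_eqF.
- by move=> x /sin_gt0_hpi s0; apply: continuous_dcot; rewrite gt_eqF.
- by move=> x /cos_gt0_hpi s0; apply: cvgN; apply: continuous_dtan; rewrite gt_eqF.
- by move=> x y hx hy; apply: eigen_polar => //; exact: eigen_tan.
- by move=> al y ald yab; exact: polar_boundary.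
move=> al x ald xab; have /andP[al0 ald'] := ald.
have s0 : 0 < sin x by apply: sin_gt0_hpi; lra.
have fx : f (x, hpi - al) ^+ 2 <= (sin x * M * al) ^+ 2.
  apply: sq_le; have := @f_phi x hpi (hpi - al).
  rewrite (_ : hpi - al - hpi = - al); last by ring.
  by rewrite normrN (gtr0_norm al0); apply=> //; lra.
have ta : 0 <= tan al * f (x, al) ^+ 2.
  by rewrite mulr_ge0 ?sqr_ge0// divr_ge0// ltW//; [apply: sin_gt0_hpi|apply: cos_gt0_hpi]; lra.
have := cot_sq_le ald (mulr_ge0 (ltW s0) M0) fx.
have := sq_sin_le al0 s0.
rewrite [tan (hpi - al)]/tan cos_hpiB sin_hpiB.
lra.
Qed.

(** The ground state is [sin(theta) sin(phi)]: now the singular side is [phi = 0], where [f]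
    vanishes. *)
Lemma component_y : (forall y, f (0, y) = 0) -> (forall x, f (x, 0) = 0) ->
  innerI delta (ground_squares cot cot f ft fk) <=
  boxI 0 (pi / 2) 0 (pi / 2) (polar_energy f ft fk).
Proof.
have [h0 h2] := hpi_bounds; have d0 := delta0; have dh := deltah.
move=> f1 f2; apply: (@component_ge _ dcot _ dcot).
- by move=> x /sin_gt0_hpi s0; apply: is_derive_cot; rewrite gt_eqF.
- by move=> x /sin_gt0_hpi s0; apply: is_derive_cot; rewrite gt_eqF.
- by move=> x /sin_gt0_hpi s0; apply: continuous_dcot; rewrite gt_eqF.
- by move=> x /sin_gt0_hpi s0; apply: continuous_dcot; rewrite gt_eqF.
- by move=> x y hx hy; apply: eigen_polar => //; exact: eigen_cot.
- by move=> al y ald yab; exact: polar_boundary.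
move=> al x ald xab; have /andP[al0 ald'] := ald.
have s0 : 0 < sin x by apply: sin_gt0_hpi; lra.
have fx : f (x, al) ^+ 2 <= (sin x * M * al) ^+ 2.
  apply: sq_le; have := @f_phi x 0 al; rewrite subr0 (gtr0_norm al0).
  by apply=> //; lra.
have ta : 0 <= cot (hpi - al) * f (x, hpi - al) ^+ 2.
  rewrite mulr_ge0 ?sqr_ge0// /cot cos_hpiB sin_hpiB divr_ge0// ltW//.
    by apply: sin_gt0_hpi; lra.
  by apply: cos_gt0_hpi; lra.
have := cot_sq_le ald (mulr_ge0 (ltW s0) M0) fx.
have := sq_sin_le al0 s0.
rewrite [cot al]/cot; lra.
Qed.

(** The ground state is [cos(theta)], constant in phi, so the only dangerous side is the equator.
    The zero there is all that is asked of [f], which lets the lemma serve two characters. *)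
Lemma component_z : (forall y, f (pi / 2, y) = 0) ->
  innerI delta (ground_squares (fun x => - tan x) (cst 0) f ft fk) <=
  boxI 0 (pi / 2) 0 (pi / 2) (polar_energy f ft fk).
Proof.
have [h0 h2] := hpi_bounds; have d0 := delta0; have dh := deltah.
move=> f1; apply: (@component_ge _ (fun y => - (cos y ^- 2)) _ (cst 0)).
- by move=> x /cos_gt0_hpi s0; apply: is_deriveN; apply: is_derive_tan; rewrite gt_eqF.
- by move=> x /cos_gt0_hpi s0; apply: cvgN; apply: continuous_dtan; rewrite gt_eqF.
- by move=> x _; exact: cvg_cst.
- move=> x y hx hy; rewrite /cst expr0n /= addr0 mul0r addr0.
  have c0 := cos_gt0_hpi hx; have e := eigen_tan hx.
  rewrite addrAC -mulrDl e /tan; field; by rewrite gt_eqF.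
- move=> al y ald yab; have /andP[al0 ald'] := ald.
  have sal : 0 < sin al by apply: sin_gt0_hpi; lra.
  have cal : 0 < cos al by apply: cos_gt0_hpi; lra.
  have fx : f (hpi - al, y) ^+ 2 <= (M * al) ^+ 2.
    apply: sq_le; have := @f_theta hpi (hpi - al) y.
    rewrite (_ : hpi - al - hpi = - al); last by ring.
    by rewrite normrN (gtr0_norm al0); apply=> //; lra.
  have k := cot_sq_le ald M0 fx.
  rewrite /tan cos_hpiB sin_hpiB.
  set u := f (hpi - al, y) ^+ 2 in fx k *; set v := f (al, y) ^+ 2.
  have v0 : 0 <= v by exact: sqr_ge0.
  have u0 : 0 <= u by exact: sqr_ge0.
  have k2 : - (cos al / sin al) * cos al * u >= - (cos al / sin al * u).
    rewrite !mulNr lerN2 mulrAC ler_piMr ?cos_le1//.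
    by rewrite mulr_ge0// divr_ge0// ltW.
  have k3 : 0 <= sin al / cos al * sin al * v.
    by rewrite mulr_ge0// mulr_ge0 ?divr_ge0 ?ltW.
  have k4 : 0 <= M ^+ 2 * al by rewrite mulr_ge0 ?sqr_ge0// ltW.
  lra.
- move=> al x ald xab; rewrite /cst !mul0r subrr.
  have s0 : 0 < sin x by apply: sin_gt0_hpi; lra.
  rewrite mulNr oppr_le0; apply: mulr_ge0; last exact: ltW.
  by rewrite !mulr_ge0 ?sqr_ge0//; lra.
Qed.

End component.
End octant.

(** * Octant coordinates *)

Section octants.
Context {R : realType}.
Implicit Types (z : R * R) (x v : 'rV[R]_3) (Phi : 'rV[R]_3 -> R).

Lemma continuous_rV3 (T : topologicalType) (f : T -> 'rV[R]_3) :
  (forall i j, continuous (fun q => f q i j)) -> continuous f.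
Proof.
move=> ce p B /nbhs_ballP[e /= e0 eB].
have : \forall q \near p, forall i j, ball (f p i j) e (f q i j).
  pose P i j q := ball (f p i j) e (f q i j).
  apply: (@filter_forall _ _ (fun i q => forall j, P i j q) (nbhs p)) => i.
  apply: (@filter_forall _ _ (P i) (nbhs p)) => j.
  by have /cvgrPdist_lt/(_ _ e0) := ce i j p.
by apply: filterS => q hq; apply: eB.
Qed.

Lemma continuous_sub (T : topologicalType) (f g : T -> R) :
  continuous f -> continuous g -> continuous (fun q => f q - g q).
Proof. by move=> cf cg q; apply: cvgB; [exact: cf|exact: cg]. Qed.

Lemma continuous_add (T : topologicalType) (f g : T -> R) :
  continuous f -> continuous g -> continuous (fun q => f q + g q).
Proof. by move=> cf cg q; apply: cvgD; [exact: cf|exact: cg]. Qed.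

Lemma continuous_mul (T : topologicalType) (f g : T -> R) :
  continuous f -> continuous g -> continuous (fun q => f q * g q).
Proof. by move=> cf cg q; apply: cvgM; [exact: cf|exact: cg]. Qed.

Lemma vec3E (a b c : R) i j :
  vec3 a b c i j = if j == 0 then a else if j == 1 then b else c.
Proof. by rewrite mxE. Qed.

Lemma dot3 x v : dot x v = x 0 0 * v 0 0 + x 0 1 * v 0 1 + x 0 2%:R * v 0 2%:R.
Proof.
rewrite /dot !big_ord_recl big_ord0 addr0 addrA.
by congr (_ + _ + _); congr (x 0 _ * v 0 _); apply/val_inj.
Qed.

Lemma continuous_vec3 (T : topologicalType) (a b c : T -> R) :
  continuous a -> continuous b -> continuous c ->
  continuous (fun q => vec3 (a q) (b q) (c q)).
Proof.
move=> ca cb cc; apply: continuous_rV3 => i j.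
rewrite (_ : (fun q => _) = if j == 0 then a else if j == 1 then b else c).
  by case: ifP => _ //; case: ifP.
by apply/funext => q; rewrite vec3E; case: ifP => _ //; case: ifP.
Qed.

(** All eight octants share the angles of the first one and differ by coordinate signs, so that the
    area element [sin z.1] is common to them and sums over signs can be taken under the integral. *)
Definition oct (s t w : bool) z : 'rV[R]_3 :=
  vec3 ((-1) ^+ s * (sin z.1 * cos z.2)) ((-1) ^+ t * (sin z.1 * sin z.2))
    ((-1) ^+ w * cos z.1).

Lemma continuous_oct s t w : continuous (oct s t w).
Proof.
have c1 (h : R -> R) : continuous h -> continuous (fun z : R * R => h z.1).
  by move=> ch z; apply: (continuous_comp (g := h)); [exact: cvg_fst|exact: ch].
have c2 (h : R -> R) : continuous h -> continuous (fun z : R * R => h z.2).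
  by move=> ch z; apply: (continuous_comp (g := h)); [exact: cvg_snd|exact: ch].
have cs := @continuous_sin R; have cc := @continuous_cos R.
apply: continuous_vec3 => z; apply: cvgM; try exact: cvg_cst.
- by apply: cvgM; [exact: (c1 sin)|exact: (c2 cos)].
- by apply: cvgM; [exact: (c1 sin)|exact: (c2 sin)].
- exact: (c1 cos).
Qed.

Definition partial Phi (i : 'I_3) x : R := 'D_(delta_mx 0 i) Phi x.

Lemma derive_along Phi (c1 c2 c3 : R -> R) (t d1 d2 d3 : R) :
  (forall x, differentiable Phi x) ->
  is_derive t (1 : R) (c1 : R -> R^o) d1 ->
  is_derive t (1 : R) (c2 : R -> R^o) d2 ->
  is_derive t (1 : R) (c3 : R -> R^o) d3 ->
  is_derive t (1 : R) ((fun r => Phi (vec3 (c1 r) (c2 r) (c3 r))) : R -> R^o)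
   (d1 * partial Phi 0 (vec3 (c1 t) (c2 t) (c3 t))
    + d2 * partial Phi 1 (vec3 (c1 t) (c2 t) (c3 t))
    + d3 * partial Phi 2%:R (vec3 (c1 t) (c2 t) (c3 t))).
Proof.
move=> dPhi h1 h2 h3; pose ga r := vec3 (c1 r) (c2 r) (c3 r).
have dga (i : 'I_1) (j : 'I_3) : is_derive t (1 : R) ((fun r => ga r i j) : R -> R^o)
    (if j == 0 then d1 else if j == 1 then d2 else d3).
  rewrite (_ : (fun r => _) = if j == 0 then c1 else if j == 1 then c2 else c3).
    by case: ifP => _ //; case: ifP.
  by apply/funext => r; rewrite /ga vec3E; case: ifP => _ //; case: ifP.
have gad : derivable (ga : R -> 'rV[R]_3) t 1.
  by apply/derivable_mxP => i j; have [] := dga i j.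
have gadd : differentiable (ga : R -> 'rV[R]_3) t by exact/derivable1_diffP.
have gaE : 'D_1 (ga : R -> 'rV[R]_3) t = vec3 d1 d2 d3.
  rewrite derive_mx//; apply/matrixP => i j; rewrite mxE vec3E.
  by have [_ ->] := dga i j.
have dc : differentiable (Phi \o ga : R -> R^o) t by exact: differentiable_comp.
split; first exact/derivable1_diffP.
rewrite -/(Phi \o ga) (deriveE _ dc) diff_comp//= -(deriveE _ gadd) gaE.
rewrite [X in 'd _ _ X](_ : _ = d1 *: delta_mx 0 0 + d2 *: delta_mx 0 1 + d3 *: delta_mx 0 2%:R).
  by rewrite !linearD !linearZ /= /partial !deriveE.
apply/rowP => j; rewrite !mxE /=.
by case: j => -[|[|[|//]]] hj; rewrite /= ?mulr1 ?mulr0 ?addr0 ?add0r.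
Qed.

Definition oct_theta Phi (s t w : bool) z : R :=
  (-1) ^+ s * (cos z.1 * cos z.2) * partial Phi 0 (oct s t w z)
  + (-1) ^+ t * (cos z.1 * sin z.2) * partial Phi 1 (oct s t w z)
  + (-1) ^+ w * (- sin z.1) * partial Phi 2%:R (oct s t w z).

(** The azimuthal derivatives of both horizontal coordinates carry a factor [sin z.1]; taking it out
    leaves an expression continuous up to the pole. *)
Definition oct_phi Phi (s t w : bool) z : R :=
  (-1) ^+ s * (- sin z.2) * partial Phi 0 (oct s t w z)
  + (-1) ^+ t * cos z.2 * partial Phi 1 (oct s t w z).

Lemma continuous_partial Phi i : C1 Phi -> continuous (partial Phi i).
Proof. by move=> [_]; apply. Qed.

Lemma C1_continuous Phi : C1 Phi -> continuous Phi.
Proof. by move=> [d _] x; exact: differentiable_continuous. Qed.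

Lemma polar_C1_oct Phi s t w : C1 Phi ->
  polar_C1 (fun z => Phi (oct s t w z)) (oct_theta Phi s t w) (oct_phi Phi s t w).
Proof.
move=> CPhi; have [dPhi _] := CPhi.
have co (F : 'rV[R]_3 -> R) : continuous F -> continuous (fun z => F (oct s t w z)).
  move=> cF z; apply: (continuous_comp (g := F)); first exact: continuous_oct.
  exact: cF.
have cp i := co _ (@continuous_partial Phi i CPhi).
have c1 (h : R -> R) : continuous h -> continuous (fun z : R * R => h z.1).
  by move=> ch z; apply: (continuous_comp (g := h)); [exact: cvg_fst|exact: ch].
have c2 (h : R -> R) : continuous h -> continuous (fun z : R * R => h z.2).
  by move=> ch z; apply: (continuous_comp (g := h)); [exact: cvg_snd|exact: ch].
have cs1 := c1 sin (@continuous_sin R); have cc1 := c1 cos (@continuous_cos R).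
have cs2 := c2 sin (@continuous_sin R); have cc2 := c2 cos (@continuous_cos R).
split.
- by apply: co; exact: C1_continuous.
- move=> z; apply: cvgD; first apply: cvgD.
  + apply: cvgM; last exact: cp.
    by apply: cvgM; [exact: cvg_cst|apply: cvgM; [exact: cc1|exact: cc2]].
  + apply: cvgM; last exact: cp.
    by apply: cvgM; [exact: cvg_cst|apply: cvgM; [exact: cc1|exact: cs2]].
  + apply: cvgM; last exact: cp.
    by apply: cvgM; [exact: cvg_cst|apply: cvgN; exact: cs1].
- move=> z; apply: cvgD.
  + apply: cvgM; last exact: cp.
    by apply: cvgM; [exact: cvg_cst|apply: cvgN; exact: cs2].
  + apply: cvgM; last exact: cp.
    by apply: cvgM; [exact: cvg_cst|exact: cc2].
- move=> x y; rewrite /oct /=.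
  apply: is_derive_eq.
    apply: (@derive_along Phi (fun r => (-1) ^+ s * (sin r * cos y))
      (fun r => (-1) ^+ t * (sin r * sin y)) (fun r => (-1) ^+ w * cos r)
      x ((-1) ^+ s * (cos x * cos y)) ((-1) ^+ t * (cos x * sin y))
      ((-1) ^+ w * (- sin x))) => //;
    apply: is_derive_eq; by rewrite /GRing.scale /=; ring.
  by [].
- move=> x y; rewrite /oct /=.
  apply: is_derive_eq.
    apply: (@derive_along Phi (fun r => (-1) ^+ s * (sin x * cos r))
      (fun r => (-1) ^+ t * (sin x * sin r)) (fun r => (-1) ^+ w * cos x)
      y ((-1) ^+ s * (sin x * - sin y)) ((-1) ^+ t * (sin x * cos y)) 0) => //;
    apply: is_derive_eq; by rewrite /GRing.scale /=; ring.
  rewrite /oct_phi /oct /=; move: (partial Phi _ _) (partial Phi 1 _) (partial Phi 0 _) => A3 A2 A1.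
  ring.
Qed.

Definition osum (G : bool -> bool -> bool -> R) : R :=
  G false false false + G true false false + G false true false + G true true false
  + (G false false true + G true false true + G false true true + G true true true).

(** Fourier coefficient on the sign group [(Z/2)^3]; [true] in a slot selects oddness under the
    corresponding reflection. *)
Definition ochar (a b c : bool) (G : bool -> bool -> bool -> R) : R :=
  8^-1 * osum (fun s t w => (-1) ^+ (a && s) * ((-1) ^+ (b && t) * (-1) ^+ (c && w)) * G s t w).

Lemma osumD F G :
  osum (fun s t w => F s t w + G s t w) = osum F + osum G.
Proof. by rewrite /osum; ring. Qed.

Lemma ochar_parseval G :
  osum (fun s t w => G s t w ^+ 2) =
  8 * (osum (fun a b c => ochar a b c G ^+ 2)).
Proof. by rewrite /ochar /osum /= !expr0 !expr1; field. Qed.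

Lemma ochar_x b c G : (forall t w, G true t w = G false t w) -> ochar true b c G = 0.
Proof. by move=> h; rewrite /ochar /osum /= !h !expr0 !expr1; ring. Qed.

Lemma ochar_y a c G : (forall s w, G s true w = G s false w) -> ochar a true c G = 0.
Proof. by move=> h; rewrite /ochar /osum /= !h !expr0 !expr1; ring. Qed.

Lemma ochar_z a b G : (forall s t, G s t true = G s t false) -> ochar a b true G = 0.
Proof. by move=> h; rewrite /ochar /osum /= !h !expr0 !expr1; ring. Qed.

Lemma polar_C1D (f ft fk g gt gk : R * R -> R) :
  polar_C1 f ft fk -> polar_C1 g gt gk ->
  polar_C1 (fun z => f z + g z) (fun z => ft z + gt z) (fun z => fk z + gk z).
Proof.
move=> [c1 c2 c3 d1 d2] [c1' c2' c3' d1' d2']; split.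
- by move=> z; apply: cvgD; [exact: c1|exact: c1'].
- by move=> z; apply: cvgD; [exact: c2|exact: c2'].
- by move=> z; apply: cvgD; [exact: c3|exact: c3'].
- by move=> x y; apply: is_deriveD.
- by move=> x y; rewrite mulrDr; apply: is_deriveD.
Qed.

Lemma polar_C1Z (r : R) (f ft fk : R * R -> R) : polar_C1 f ft fk ->
  polar_C1 (fun z => r * f z) (fun z => r * ft z) (fun z => r * fk z).
Proof.
move=> [c1 c2 c3 d1 d2]; split.
- by move=> z; apply: cvgM; [exact: cvg_cst|exact: c1].
- by move=> z; apply: cvgM; [exact: cvg_cst|exact: c2].
- by move=> z; apply: cvgM; [exact: cvg_cst|exact: c3].
- by move=> x y; have h := d1 x y; apply: is_deriveZ.
- by move=> x y; have h := d2 x y; rewrite mulrCA; apply: is_deriveZ.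
Qed.

Lemma polar_C1_ochar a b c (F Ft Fk : bool -> bool -> bool -> R * R -> R) :
  (forall s t w, polar_C1 (F s t w) (Ft s t w) (Fk s t w)) ->
  polar_C1 (fun z => ochar a b c (fun s t w => F s t w z))
    (fun z => ochar a b c (fun s t w => Ft s t w z))
    (fun z => ochar a b c (fun s t w => Fk s t w z)).
Proof.
move=> h; apply: polar_C1Z; rewrite /osum.
pose hZ s t w := polar_C1Z ((-1) ^+ (a && s) * ((-1) ^+ (b && t) * (-1) ^+ (c && w))) (h s t w).
exact: (polar_C1D
  (polar_C1D (polar_C1D (polar_C1D (hZ _ _ _) (hZ _ _ _)) (hZ _ _ _)) (hZ _ _ _))
  (polar_C1D (polar_C1D (polar_C1D (hZ _ _ _) (hZ _ _ _)) (hZ _ _ _)) (hZ _ _ _))).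
Qed.

Definition tangential_sq Phi x : R :=
  enorm (full_grad Phi x - dot (full_grad Phi x) x *: x) ^+ 2.

Lemma dot_ge0 v : 0 <= dot v v.
Proof. by apply: sumr_ge0 => i _; rewrite -expr2 sqr_ge0. Qed.

Lemma enorm_sq v : enorm v ^+ 2 = dot v v.
Proof. by rewrite /enorm sqr_sqrtr// dot_ge0. Qed.

(** [oct_theta] and [oct_phi] are the components of the gradient along the orthonormal polar frame;
    since [x] is a unit vector, removing the radial part subtracts exactly [d ^+ 2]. *)
Lemma tangential_sq_oct Phi s t w z :
  tangential_sq Phi (oct s t w z) = oct_theta Phi s t w z ^+ 2 + oct_phi Phi s t w z ^+ 2.
Proof.
rewrite /tangential_sq enorm_sq !dot3 !mxE /=.
rewrite /oct_theta /oct_phi -!/(partial _ _ _).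
move: (partial _ _ _) (partial _ _ _) (partial _ _ _) => A3 A2 A1.
have e1 := cos2Dsin2 z.1; have e2 := cos2Dsin2 z.2.
move: (sin z.1) (cos z.1) (sin z.2) (cos z.2) e1 e2 => S C s' c' e1 e2.
have sq (b : bool) : ((-1) ^+ b : R) ^+ 2 = 1 by rewrite -exprM mulnC exprM sqrrN expr1n expr1n.
have := sq s; have := sq t; have := sq w.
move: ((-1) ^+ s) ((-1) ^+ t) ((-1) ^+ w) => a1 a2 a3 h3 h2 h1.
set d := A1 * (a1 * (S * c')) + A2 * (a2 * (S * s')) + A3 * (a3 * C).
have uu : (a1 * (S * c')) ^+ 2 + (a2 * (S * s')) ^+ 2 + (a3 * C) ^+ 2 = 1.
  rewrite !exprMn h1 h2 h3 !mul1r -mulrDr e2 mulr1 addrC; exact: e1.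
transitivity (A1 ^+ 2 + A2 ^+ 2 + A3 ^+ 2 - 2 * d ^+ 2 +
  d ^+ 2 * ((a1 * (S * c')) ^+ 2 + (a2 * (S * s')) ^+ 2 + (a3 * C) ^+ 2)).
  by rewrite /d; ring.
rewrite uu.
(* [P] and [Q] are the gradient components along the horizontal radius and along the azimuth; [d]
   mixes [P] with the vertical component. *)
pose P := a1 * A1 * c' + a2 * A2 * s'; pose Q := a2 * A2 * c' - a1 * A1 * s'.
have PQ : P ^+ 2 + Q ^+ 2 = A1 ^+ 2 + A2 ^+ 2.
  transitivity ((a1 ^+ 2 * A1 ^+ 2 + a2 ^+ 2 * A2 ^+ 2) * (c' ^+ 2 + s' ^+ 2)).
    by rewrite /P /Q; ring.
  by rewrite e2 h1 h2; ring.
have -> : d = P * S + a3 * A3 * C by rewrite /d /P; ring.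
rewrite -PQ.
have -> : A3 ^+ 2 = a3 ^+ 2 * A3 ^+ 2 by rewrite h3 mul1r.
apply/eqP; rewrite -subr_eq0; apply/eqP.
transitivity ((P ^+ 2 + a3 ^+ 2 * A3 ^+ 2) * (1 - (C ^+ 2 + S ^+ 2))).
  by rewrite /P /Q; ring.
by rewrite e1; ring.
Qed.

Lemma continuous_dot (T : topologicalType) (f g : T -> 'rV[R]_3) :
  continuous f -> continuous g -> continuous (fun q => dot (f q) (g q)).
Proof.
move=> cf cg.
have cfi (h : T -> 'rV[R]_3) i : continuous h -> continuous (fun q => h q 0 i).
  move=> ch q; apply: (continuous_comp (g := fun M : 'rV[R]_3 => M 0 i)); first exact: ch.
  exact: coord_continuous.
rewrite (_ : (fun q => _) = (fun q => f q 0 0 * g q 0 0 + f q 0 1 * g q 0 1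
   + f q 0 2%:R * g q 0 2%:R)); last by apply/funext => q; rewrite dot3.
by move=> q; apply: cvgD; first apply: cvgD; (apply: cvgM; [exact: (cfi _ _ cf)|exact: (cfi _ _ cg)]).
Qed.

Lemma continuous_tangential_sq Phi : C1 Phi -> continuous (tangential_sq Phi).
Proof.
move=> CPhi.
rewrite (_ : tangential_sq Phi = (fun x =>
  dot (full_grad Phi x - dot (full_grad Phi x) x *: x)
      (full_grad Phi x - dot (full_grad Phi x) x *: x))); last first.
  by apply/funext => x; rewrite /tangential_sq enorm_sq.
have cid : continuous (fun x : 'rV[R]_3 => x) by move=> x; exact: cvg_id.
have cg : continuous (full_grad Phi).
  apply: continuous_rV3 => i j; rewrite (_ : (fun q => _) = partial Phi j).
    exact: continuous_partial.
  by apply/funext => x; rewrite mxE.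
have cd : continuous (fun x => full_grad Phi x - dot (full_grad Phi x) x *: x).
  apply: continuous_rV3 => i j.
  rewrite (_ : (fun q => _) =
    (fun q => partial Phi j q - dot (full_grad Phi q) q * q i j)); last first.
    by apply/funext => q; rewrite !mxE.
  apply: continuous_sub; first exact: continuous_partial.
  apply: continuous_mul; [exact: (continuous_dot cg cid)|exact: coord_continuous].
exact: (continuous_dot cd cd).
Qed.

(** One fold in theta and two in phi. The reflections [pi - theta], [2 pi - phi] and [pi - phi] only
    change signs of coordinates, and together they produce all eight. *)
Lemma integral_surface_octants (F : 'rV[R]_3 -> R) : continuous F ->
  (forall x, 0 <= F x) ->
  (\int[@surface_measure R]_u (F (emb u))%:E =
  (boxI 0 (pi / 2) 0 (pi / 2)
    (fun z => sin z.1 * osum (fun s t w => F (oct s t w z))))%:E)%E.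
Proof.
move=> cF F0; have [h0 h2] := @hpi_bounds R.
have cemb : continuous (@emb R) by exact: initial_continuous.
have mF : measurable_fun setT (fun u : S2 R => (F (emb u))%:E).
  apply/measurable_EFinP; apply: (measurability _ (RGenOpens.measurableE R)).
  move=> _ [_ [a [b ->]] <-]; rewrite setTI; apply: sub_sigma_algebra.
  have c1 : continuous (F \o @emb R).
    by move=> u; apply: continuous_comp; [exact: cemb|exact: cF].
  by move/continuousP : c1; apply; exact: interval_open.
rewrite ge0_integral_surface//; last by move=> u; rewrite lee_fin.
pose G (z : R * R) := sin z.1 * F (oct false false false z).
have cG : continuous G.
  move=> z; apply: cvgM; first exact: continuous_sin1.
  apply: (continuous_comp (g := F)); [exact: continuous_oct|exact: cF].
have bG a b c d : bmeas (box a b c d) G by exact: continuous_bmeas_box.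
transitivity (boxI 0 pi 0 (2 * pi) G)%:E.
  rewrite /boxI /Rintegral fineK; last exact/integrable_fin_num/bmeas_box_integrable.
  apply: eq_integral => z _; rewrite -EFinM mulrC; congr (_ * _)%:E.
  by rewrite /oct !expr0 !mul1r.
congr EFin.
have e1 : pi = 2 * (pi / 2) :> R by field.
rewrite {1}e1 boxI_fold1//; last exact: ltW.
have e2 : 2 * pi = 2 * (2 * (pi / 2)) :> R by field.
pose G1 z := G z + G (2 * (pi / 2) - z.1, z.2).
have cfst : continuous (fst : R * R -> R) by move=> p; exact: cvg_fst.
have csnd : continuous (snd : R * R -> R) by move=> p; exact: cvg_snd.
have cr (r : R) (f : R * R -> R) : continuous f -> continuous (fun p => r - f p).
  by move=> cf p; apply: cvgB; [exact: cvg_cst|exact: cf].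
have cp (H : R * R -> R) (f g : R * R -> R) : continuous H -> continuous f -> continuous g ->
    continuous (fun p => H (f p, g p)).
  move=> cH cf cg p; apply: (continuous_comp (g := H)); last exact: cH.
  exact: continuous_pair.
have cG1 : continuous G1.
  by move=> z; apply: cvgD; [exact: cG|exact: (cp G (fun z => _ - z.1) snd cG (cr _ _ cfst) csnd)].
rewrite -/(boxI _ _ _ _ G1) e2 boxI_fold2//; last by rewrite mulr_ge0// ltW.
pose G2 z := G1 z + G1 (z.1, 2 * (2 * (pi / 2)) - z.2).
have cG2 : continuous G2.
  by move=> z; apply: cvgD; [exact: cG1|exact: (cp G1 fst (fun z => _ - z.2) cG1 cfst (cr _ _ csnd))].
rewrite -/(boxI _ _ _ _ G2) boxI_fold2//; last exact: ltW.
apply: boxI_eq => -[x y] _; rewrite /G2 /G1 /G /=.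
rewrite -e1.
have sp : sin (pi - x) = sin x by rewrite sinB sinpi cospi mul0r mulN1r sub0r opprK.
have cpx u : cos (pi - u) = - cos u by rewrite cosB sinpi cospi mul0r mulN1r addr0.
have spx u : sin (pi - u) = sin u by rewrite sinB sinpi cospi mul0r mulN1r sub0r opprK.
have c2 u : cos (2 * pi - u) = cos u.
  by rewrite (_ : 2 * pi - u = - u + pi *+ 2) ?cosD2pi ?cosN//; ring.
have s2 u : sin (2 * pi - u) = - sin u.
  by rewrite (_ : 2 * pi - u = - u + pi *+ 2) ?sinD2pi ?sinN//; ring.
rewrite /osum /oct /= !c2 !s2 !spx !cpx !expr0 !expr1 !mul1r !mulN1r !mulrN.
ring.
Qed.

End octants.

(** * Constant width bodies *)

Section constant_width_geometry.
Context {R : realType}.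
Implicit Types (x y u v p : 'rV[R]_3).

Lemma dotBl x y u : dot (x - y) u = dot x u - dot y u.
Proof. by rewrite !dot3 !mxE; ring. Qed.

Lemma dotBr x u v : dot x (u - v) = dot x u - dot x v.
Proof. by rewrite !dot3 !mxE; ring. Qed.

Lemma dotNl x u : dot (- x) u = - dot x u.
Proof. by rewrite !dot3 !mxE; ring. Qed.

Lemma dotNr x u : dot x (- u) = - dot x u.
Proof. by rewrite !dot3 !mxE; ring. Qed.

Lemma enormN u : enorm (- u) = enorm u.
Proof. by rewrite /enorm dotNl dotNr opprK. Qed.

Lemma continuous_enorm (T : topologicalType) (f : T -> 'rV[R]_3) :
  continuous f -> continuous (fun q => enorm (f q)).
Proof.
move=> cf q.
apply: (@continuous_comp _ _ _ (fun q => dot (f q) (f q)) Num.sqrt).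
  exact: (continuous_dot cf cf).
exact: sqrt_continuous.
Qed.

Lemma continuous_modulus (T : topologicalType) (F : T -> R) (n : T -> T -> R) :
  (forall q, continuous (n q)) -> (forall q, n q q = 0) ->
  (forall q r, `|F q - F r| <= n q r) -> continuous F.
Proof.
move=> cn n0 lip x; apply/cvgrPdist_le => e e0.
have := cn x x; rewrite /continuous_at n0 => /cvgrPdist_le/(_ e e0).
apply: filterS => y; rewrite sub0r normrN; apply: le_trans.
by apply: le_trans (lip x y) _; exact: ler_norm.
Qed.

Lemma enorm_lipschitz_continuous (F : 'rV[R]_3 -> R) :
  (forall x y, `|F x - F y| <= enorm (x - y)) -> continuous F.
Proof.
apply: continuous_modulus => x; last first.
  by rewrite subrr /enorm (_ : dot 0 0 = 0) ?sqrtr0// dot3 !mxE !mul0r !addr0.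
apply: continuous_enorm; apply: continuous_rV3 => i j.
rewrite (_ : (fun q => _) = (fun q : 'rV[R]_3 => x i j - q i j)).
  by apply: continuous_sub; [exact: cst_continuous|exact: coord_continuous].
by apply/funext => y; rewrite !mxE.
Qed.

Section support.
Variable K : set 'rV[R]_3.
Hypothesis KK : constant_width_body K.
Local Notation H := (support_function K).

(** The supremum of the empty set is [0] by convention, so an empty body would have width [0]
    instead of [1] in a unit direction. *)
Lemma body_nonempty : exists p, K p.
Proof.
apply: contrapT => hK.
have K0 x : ~ K x by move=> Kx; apply: hK; exists x.
have [_ _ /(_ (vec3 1 0 0))] := KK.
have H0 u : H u = 0.
  rewrite /support_function (_ : [set _ | _ in _] = set0) ?sup0//.
  by apply/seteqP; split => // r [x Kx _]; case: (K0 x).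
rewrite !H0 addr0 => h.
have : enorm (vec3 1 0 0 : 'rV[R]_3) = 1.
  by rewrite /enorm dot_vec3 expr0n expr1n !addr0 sqrtr1.
by rewrite -h => /eqP; rewrite eq_sym oner_eq0.
Qed.

Lemma support_has_sup u : has_sup [set dot x u | x in K].
Proof.
have [p Kp] := body_nonempty; split; first by exists (dot p u), p.
have [cK _ _] := KK.
have cid : continuous (fun x : 'rV[R]_3 => x) by move=> x; exact: cvg_id.
have cu : continuous (fun x : 'rV[R]_3 => u) by exact: cst_continuous.
have /compact_bounded[M [_ hM]] : compact ((fun x => dot x u) @` K).
  apply: continuous_compact => //; apply: continuous_subspaceT.
  exact: (continuous_dot cid cu).
exists (M + 1) => _ [x Kx <-].
apply: le_trans (ler_norm _) _; apply: (hM (M + 1)); first by rewrite ltrDl.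
by exists x.
Qed.

Lemma dot_le_support x u : K x -> dot x u <= H u.
Proof. by move=> Kx; apply: sup_upper_bound; [exact: support_has_sup|exists x]. Qed.

Lemma support_le u (r : R) : (forall x, K x -> dot x u <= r) -> H u <= r.
Proof.
move=> hr; apply: ge_sup; first by have [] := support_has_sup u.
by move=> _ [x Kx <-]; exact: hr.
Qed.

(** The width equation adds the support bounds of [x] in direction [u] and of [y] in direction
    [- u]. It plays the part of the diameter bound. *)
Lemma dot_diff_le x y u : K x -> K y -> dot (x - y) u <= enorm u.
Proof.
move=> Kx Ky; have [_ _ <-] := KK.
by rewrite dotBl -dotNr; apply: lerD; exact: dot_le_support.
Qed.

(** Moving [p] to the origin makes every point [x - p] of the body change its value by at most
    [enorm (u - v)], so the constant 1 is independent of the position of the body. *)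
Lemma support_centered_lipschitz p u v : K p ->
  `|(H u - dot p u) - (H v - dot p v)| <= enorm (u - v).
Proof.
move=> Kp.
have half u' v' : (H u' - dot p u') - (H v' - dot p v') <= enorm (u' - v').
  rewrite lerBlDr lerBlDr; apply: support_le => x Kx.
  have := dot_le_support v' Kx; have := dot_diff_le (u' - v') Kx Kp.
  by rewrite dotBl !dotBr; lra.
rewrite ler_norml; apply/andP; split; last exact: half.
by have := half v u; rewrite -(enormN (v - u)) (opprB v u); lra.
Qed.

Lemma support_centered_bounds p u : K p -> 0 <= H u - dot p u <= enorm u.
Proof.
move=> Kp; rewrite subr_ge0 dot_le_support//= lerBlDr.
by apply: support_le => x Kx; have := dot_diff_le u Kx Kp; rewrite dotBl; lra.
Qed.

End support.

(** [G] is the centred support function minus [1/2]. On unit vectors the centred function lies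
    between 0 and 1, whence the bound, and constant width becomes oddness. All quantitative control
    is put into [G], as [p] can be arbitrarily large. *)
Lemma width_class_normalize (g : S2 R -> R) : width_class g ->
  exists (p : 'rV[R]_3) (G : 'rV[R]_3 -> R),
    [/\ forall x y, `|G x - G y| <= enorm (x - y),
        forall w : S2 R, g w = G (emb w) + dot p (emb w) &
        forall x, enorm x = 1 -> `|G x| <= 2^-1 /\ G (- x) = - G x].
Proof.
move=> [K KK gE]; have [p Kp] := body_nonempty KK.
exists p, (fun x => support_function K x - dot p x - 2^-1); split.
- move=> x y; have := support_centered_lipschitz KK x y Kp.
  by congr (`| _ | <= _); ring.
- by move=> u; rewrite -gE; ring.
- move=> x x1; have := support_centered_bounds KK x Kp; rewrite x1 => b.
  split; first by rewrite ler_norml; lra.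
  have [_ _ /(_ x)] := KK; rewrite x1 dotNr; lra.
Qed.

Lemma enorm_emb (w : S2 R) : enorm (emb w) = 1.
Proof.
rewrite /enorm; have := set_valP (w : set_type (sphere R)).
by rewrite /sphere /emb /= => ->; rewrite sqrtr1.
Qed.

Lemma sup_norm_ge0 (f : S2 R -> R) : 0 <= sup_norm f.
Proof.
rewrite /sup_norm; set E := [set _ | _ in _].
have [hs|hs] := pselect (has_sup E); last by rewrite sup_out.
apply: (@le_trans _ _ `|f point|) => //.
by apply: sup_upper_bound => //; exists point.
Qed.

Lemma class_norm_ge0 (g : S2 R -> R) : 0 <= class_norm g.
Proof.
apply: lb_le_inf; first by exists (sup_norm (g \+ restr_linear 0)), 0.
by move=> _ [a _ <-]; exact: sup_norm_ge0.
Qed.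

Lemma class_norm_le (g : S2 R -> R) (c : 'rV[R]_3) (e : R) :
  (forall w : S2 R, `|g w - dot c (emb w)| <= e) -> class_norm g <= e.
Proof.
move=> ge; apply: (@le_trans _ _ (sup_norm (g \+ restr_linear (- c)))).
  apply: ge_inf; last by exists (- c).
  by exists 0 => _ [a _ <-]; exact: sup_norm_ge0.
apply: ge_sup; first by exists `|(g \+ restr_linear (- c)) point|, point.
by move=> _ [w _ <-]; rewrite /= /restr_linear dotNl.
Qed.

End constant_width_geometry.

(** * Lipschitz bounds and surjectivity of the octant coordinates *)

Section octant_coordinates.
Context {R : realType}.

Lemma sin_lipschitz (x y : R) : `|sin x - sin y| <= `|x - y|.
Proof.
wlog yx : x y / y <= x => [hw|].
  by have [/hw//|/ltW/hw] := leP y x; rewrite distrC (distrC x).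
rewrite [leRHS]ger0_norm ?subr_ge0// -[leRHS]mul1r.
apply: (increment_le yx (@continuous_cos R)) => t _.
by rewrite ler_norml cos_geN1 cos_le1.
Qed.

Lemma cos_lipschitz (x y : R) : `|cos x - cos y| <= `|x - y|.
Proof.
wlog yx : x y / y <= x => [hw|].
  by have [/hw//|/ltW/hw] := leP y x; rewrite distrC (distrC x).
rewrite [leRHS]ger0_norm ?subr_ge0// -[leRHS]mul1r.
apply: (@increment_le R cos (fun t => - sin t)) => //.
  by move=> t; apply: cvgN; exact: continuous_sin.
by move=> t _; rewrite normrN ler_norml sin_geN1 sin_le1.
Qed.

Lemma mul_lipschitz (a b c d : R) : `|a| <= 1 -> `|d| <= 1 ->
  `|a * b - c * d| <= `|a - c| + `|b - d|.
Proof.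
move=> a1 d1; have -> : a * b - c * d = (a - c) * d + a * (b - d) by ring.
apply: le_trans (ler_normD _ _) _; rewrite !normrM; apply: lerD.
  by rewrite ler_piMr.
by rewrite ler_piMl.
Qed.

Lemma norm_sin_le1 (x : R) : `|sin x| <= 1.
Proof. by rewrite ler_norml sin_geN1 sin_le1. Qed.

Lemma norm_cos_le1 (x : R) : `|cos x| <= 1.
Proof. by rewrite ler_norml cos_geN1 cos_le1. Qed.

Lemma signr_dist (s : bool) (a b : R) : `|(-1) ^+ s * a - (-1) ^+ s * b| = `|a - b|.
Proof. by rewrite -mulrBr normrMsign. Qed.

Lemma oct_lipschitz s t w (z z' : R * R) j :
  `|oct s t w z 0 j - oct s t w z' 0 j| <= `|z.1 - z'.1| + `|z.2 - z'.2|.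
Proof.
have s1 := sin_lipschitz z.1 z'.1; have c1 := cos_lipschitz z.1 z'.1.
have s2 := sin_lipschitz z.2 z'.2; have c2 := cos_lipschitz z.2 z'.2.
rewrite /oct !vec3E; case: ifP => _; [|case: ifP => _]; rewrite signr_dist.
- apply: le_trans (mul_lipschitz _ _ _ _) _; [exact: norm_sin_le1|exact: norm_cos_le1|lra].
- apply: le_trans (mul_lipschitz _ _ _ _) _; [exact: norm_sin_le1|exact: norm_sin_le1|lra].
- by apply: le_trans c1 _; rewrite lerDl.
Qed.

(** The 2 is a rounded [sqrt 3]. *)
Lemma enorm_le (v : 'rV[R]_3) (d : R) : 0 <= d -> (forall j, `|v 0 j| <= d) ->
  enorm v <= 2 * d.
Proof.
move=> d0 vd; rewrite -(@ler_pXn2r _ 2)// ?nnegrE ?mulr_ge0 ?sqrtr_ge0//.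
rewrite enorm_sq dot3.
have sq j : v 0 j * v 0 j <= d ^+ 2.
  by rewrite -expr2 -[leLHS]real_normK ?num_real// lerXn2r// nnegrE.
have := sq 0; have := sq 1; have := sq 2%:R.
have : 0 <= d ^+ 2 by exact: sqr_ge0.
have -> : (2 * d) ^+ 2 = 4 * d ^+ 2 by ring.
lra.
Qed.

Lemma oct_unit s t w (z : R * R) : enorm (oct s t w z) = 1.
Proof.
rewrite /enorm dot_vec3.
have sq (b : bool) : ((-1) ^+ b : R) ^+ 2 = 1 by rewrite -exprM mulnC exprM sqrrN expr1n expr1n.
rewrite !exprMn !sq !mul1r -mulrDr.
have e1 := cos2Dsin2 z.1; have e2 := cos2Dsin2 z.2.
by rewrite e2 mulr1 addrC e1 sqrtr1.
Qed.

Lemma oct_onto (x : 'rV[R]_3) : enorm x = 1 ->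
  exists s t w z, [/\ 0 <= z.1 <= pi / 2, 0 <= z.2 <= pi / 2 & x = oct s t w z].
Proof.
move=> x1; have xx : x 0 0 ^+ 2 + x 0 1 ^+ 2 + x 0 2%:R ^+ 2 = 1.
  by rewrite !expr2 -dot3 -enorm_sq x1 expr1n.
have sgnE (r : R) : exists s : bool, r = (-1) ^+ s * `|r|.
  by exists (r < 0); rewrite mulr_sign_norm.
have [s hs] := sgnE (x 0 0); have [t ht] := sgnE (x 0 1); have [w hw] := sgnE (x 0 2%:R).
have [h0 h2] := @hpi_bounds R.
set A := `|x 0 0| in hs *; set B := `|x 0 1| in ht *; set C := `|x 0 2%:R| in hw *.
have [A0 B0 C0] : [/\ 0 <= A, 0 <= B & 0 <= C] by split; exact: normr_ge0.
have ABC : A ^+ 2 + B ^+ 2 + C ^+ 2 = 1 by rewrite /A /B /C !real_normK ?num_real.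
have sqA := sqr_ge0 A; have sqB := sqr_ge0 B; have sqC := sqr_ge0 C.
have le1 (r : R) : 0 <= r -> r ^+ 2 <= 1 -> r <= 1.
  by move=> r0; rewrite -{1}(expr1n _ 2) ler_pXn2r// nnegrE.
have arc (c d : R) : 0 <= c -> 0 <= d -> c ^+ 2 + d ^+ 2 = 1 ->
    exists r, [/\ 0 <= r <= pi / 2, cos r = c & sin r = d].
  move=> c0 d0 cd.
  have c1 : c <= 1 by apply: le1 => //; have := sqr_ge0 d; lra.
  have cin : -1 <= c <= 1 by lra.
  exists (acos c); split.
  - rewrite acos_ge0//= leNgt; apply/negP => hlt; have hle := acos_lepi cin.
    have : cos (acos c) < 0.
      have -> : acos c = pi / 2 + (acos c - pi / 2) by ring.
      rewrite cosD cos_pihalf sin_pihalf mul0r mul1r sub0r oppr_lt0.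
      by apply: sin_gt0_pi; lra.
    by rewrite acosK ?in_itv//= ltNge c0.
  - by rewrite acosK.
  - rewrite sin_acos// -cd addrAC subrr add0r sqrtr_sqr ger0_norm//.
have eth : C ^+ 2 + Num.sqrt (1 - C ^+ 2) ^+ 2 = 1 by rewrite sqr_sqrtr; lra.
have [th [thb cth sth]] := arc C (Num.sqrt (1 - C ^+ 2)) C0 (sqrtr_ge0 _) eth.
have sth2 : sin th ^+ 2 = A ^+ 2 + B ^+ 2 by rewrite sth sqr_sqrtr; lra.
(* At the pole the azimuth is undetermined and [0] is taken; elsewhere division by [sin th] puts the
   horizontal part on the unit circle. *)
have [s0|s0] := eqVneq (sin th) 0.
  have A00 : A = 0.
    by apply/eqP; rewrite -sqrf_eq0; apply/eqP; move: sth2; rewrite s0 expr0n /=; lra.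
  have B00 : B = 0.
    by apply/eqP; rewrite -sqrf_eq0; apply/eqP; move: sth2; rewrite s0 expr0n /=; lra.
  exists s, t, w, (th, 0); split => /=; [lra|lra|].
  apply/rowP => j; rewrite vec3E /= s0 cth !mul0r !mulr0.
  case: j => -[|[|[|//]]] hj /=.
  - by rewrite (_ : Ordinal hj = 0) ?hs ?A00 ?mulr0//; apply/val_inj.
  - by rewrite (_ : Ordinal hj = 1) ?ht ?B00 ?mulr0//; apply/val_inj.
  - by rewrite -hw; congr (x 0 _); apply/val_inj.
have sp : 0 < sin th.
  by rewrite lt_neqAle eq_sym s0 sth sqrtr_ge0.
have eph : (A / sin th) ^+ 2 + (B / sin th) ^+ 2 = 1.
  by rewrite !expr_div_n -mulrDl -sth2 divff// expf_neq0.
have [ph [phb cph sph]] := arc (A / sin th) (B / sin th)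
  (divr_ge0 A0 (ltW sp)) (divr_ge0 B0 (ltW sp)) eph.
exists s, t, w, (th, ph); split => //=.
apply/rowP => j; rewrite vec3E /= cph sph cth.
case: j => -[|[|[|//]]] hj /=.
- by rewrite [sin th * _]mulrC divfK// -hs; congr (x 0 _); apply/val_inj.
- by rewrite [sin th * _]mulrC divfK// -ht; congr (x 0 _); apply/val_inj.
- by rewrite -hw; congr (x 0 _); apply/val_inj.
Qed.

End octant_coordinates.

(** * Approximation by smooth functions *)

Section sobolev_approximation.
Context {R : realType}.
Local Notation sigma := (@surface_measure R).
Local Notation oct_int F :=
  (boxI 0 (pi / 2) 0 (pi / 2) (fun z => sin z.1 * osum (fun s t w => F (oct s t w z)))).

Lemma measurable_emb (F : 'rV[R]_3 -> R) : continuous F ->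
  measurable_fun setT (fun u : S2 R => F (emb u)).
Proof.
move=> cF; apply: (measurability _ (RGenOpens.measurableE R)).
move=> _ [_ [a [b ->]] <-]; rewrite setTI; apply: sub_sigma_algebra.
have cemb : continuous (@emb R) by exact: initial_continuous.
have c1 : continuous (F \o @emb R).
  by move=> u; apply: continuous_comp; [exact: cemb|exact: cF].
by move/continuousP : c1; apply; exact: interval_open.
Qed.

Lemma integrable_emb (F : 'rV[R]_3 -> R) : continuous F -> (forall x, 0 <= F x) ->
  sigma.-integrable setT (fun u => (F (emb u))%:E).
Proof.
move=> cF F0; apply/integrableP; split.
  by apply/measurable_EFinP; exact: measurable_emb.
rewrite (eq_integral (fun u => (F (emb u))%:E)); last first.
  by move=> u _; rewrite /= ger0_norm.
by rewrite integral_surface_octants// ltry.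
Qed.

Lemma Rintegral_emb (F : 'rV[R]_3 -> R) : continuous F -> (forall x, 0 <= F x) ->
  \int[sigma]_u F (emb u) = oct_int F.
Proof. by move=> cF F0; rewrite /Rintegral integral_surface_octants. Qed.

Lemma integrable_ge0 (F : S2 R -> R) : measurable_fun setT F -> (forall u, 0 <= F u) ->
  (\int[sigma]_u (F u)%:E < +oo)%E -> sigma.-integrable setT (EFin \o F).
Proof.
move=> mF F0 Foo; apply/integrableP; split; first exact/measurable_EFinP.
rewrite (eq_integral (fun u => (F u)%:E))// => u _.
by rewrite /= ger0_norm.
Qed.

Lemma measurable_enorm_sq (V : S2 R -> 'rV[R]_3) :
  (forall i, measurable_fun setT (fun u => V u 0 i)) ->
  measurable_fun setT (fun u => enorm (V u) ^+ 2).
Proof.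
move=> mV.
rewrite (_ : (fun u => _) = (fun u => V u 0 0 * V u 0 0 + V u 0 1 * V u 0 1
   + V u 0 2%:R * V u 0 2%:R)); last by apply/funext => u; rewrite enorm_sq dot3.
by apply: measurable_funD; first apply: measurable_funD; apply: measurable_funM.
Qed.

(** The free weight keeps the coefficient of the main term as close to 1 as desired. The error [d]
    then has a large coefficient, harmless because it is made small after [s] is fixed. *)
Lemma young_sq (x d s : R) : 0 < s ->
  (x - d) ^+ 2 <= (1 + s) * x ^+ 2 + (1 + s^-1) * d ^+ 2.
Proof.
move=> s0; rewrite -subr_ge0.
have -> : (1 + s) * x ^+ 2 + (1 + s^-1) * d ^+ 2 - (x - d) ^+ 2 = (s * x + d) ^+ 2 / s.
  by field; rewrite gt_eqF.
by rewrite divr_ge0 ?sqr_ge0// ltW.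
Qed.

Lemma young_sq_ge (x d s : R) : 0 < s ->
  (1 - s) * x ^+ 2 <= (x - d) ^+ 2 + s^-1 * d ^+ 2.
Proof.
move=> s0; rewrite -subr_ge0.
have -> : (x - d) ^+ 2 + s^-1 * d ^+ 2 - (1 - s) * x ^+ 2 = d ^+ 2 + (s * x - d) ^+ 2 / s.
  by field; rewrite gt_eqF.
by rewrite addr_ge0 ?divr_ge0 ?sqr_ge0// ltW.
Qed.

Lemma young_enorm (x y : 'rV[R]_3) (s : R) : 0 < s ->
  enorm y ^+ 2 <= (1 + s) * enorm x ^+ 2 + (1 + s^-1) * enorm (x - y) ^+ 2.
Proof.
move=> s0; rewrite !enorm_sq !dot3 !mxE.
have h i := @young_sq (x 0 i) (x 0 i - y 0 i) s s0.
have := h 0; have := h 1; have := h 2%:R.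
rewrite !subKr !expr2; lra.
Qed.

Lemma measurable_tangential_grad (phi : 'rV[R]_3 -> R) i : C1 phi ->
  measurable_fun setT (fun u : S2 R => tangential_grad phi u 0 i).
Proof.
move=> Cphi.
have cF : continuous (fun x => (full_grad phi x - dot (full_grad phi x) x *: x) 0 i).
  rewrite (_ : (fun x => _) = (fun x => partial phi i x
    - (dot (full_grad phi x) x) * x 0 i)); last by apply/funext => x; rewrite !mxE.
  have cid : continuous (fun x : 'rV[R]_3 => x) by move=> x; exact: cvg_id.
  have cfg : continuous (full_grad phi).
    apply: continuous_rV3 => j1 j; rewrite (_ : (fun q => _) = partial phi j).
      exact: continuous_partial.
    by apply/funext => x; rewrite mxE.
  apply: continuous_sub; first exact: continuous_partial.
  by apply: continuous_mul; [exact: (continuous_dot cfg cid)|exact: coord_continuous].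
exact: (measurable_emb cF).
Qed.

Lemma measurable_grad_error (V : S2 R -> 'rV[R]_3) (phi : 'rV[R]_3 -> R) :
  (forall i, measurable_fun setT (fun u => V u 0 i)) -> C1 phi ->
  measurable_fun setT (fun u => enorm (V u - tangential_grad phi u) ^+ 2).
Proof.
move=> mV Cphi; apply: measurable_enorm_sq => i.
rewrite (_ : (fun u => _) = (fun u => V u 0 i - tangential_grad phi u 0 i)).
  by apply: measurable_funB; [exact: mV|exact: measurable_tangential_grad].
by apply/funext => u; rewrite !mxE.
Qed.

Lemma sgradP (g : S2 R -> R) : H1 g -> is_sobolev_grad g (sgrad g).
Proof. by move=> Hg; rewrite /sgrad; apply: xgetPex; exact: Hg. Qed.

Lemma cvg0_lt (a : nat -> \bar R) (e : R) : 0 < e -> a @ \oo --> 0%E ->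
  \forall n \near \oo, (a n < e%:E)%E.
Proof.
move=> e0 ca; have e0' : (0 < e%:E :> \bar R)%E by rewrite lte_fin.
exact: (ca _ (open_ereal_lt' e0')).
Qed.

Lemma integrable_tangential_sq (phi : 'rV[R]_3 -> R) : C1 phi ->
  sigma.-integrable setT (fun u => (tangential_sq phi (emb u))%:E).
Proof.
move=> Cphi; apply: integrable_emb; first exact: continuous_tangential_sq.
by move=> x; exact: sqr_ge0.
Qed.

(** One approximant at finite L^2 distance is enough: its own gradient is continuous, hence square
    integrable. *)
Lemma integrable_sgrad_sq (g : S2 R -> R) : H1 g ->
  sigma.-integrable setT (fun u => (enorm (sgrad g u) ^+ 2)%:E).
Proof.
move=> /sgradP[_ mV [phi Cphi [_ cV]]].
have [n _ hn] := cvg0_lt ltr01 cV; have {}hn := hn n (leqnn n).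
have iD : sigma.-integrable setT
    (fun u => (enorm (sgrad g u - tangential_grad (phi n) u) ^+ 2)%:E).
  apply: integrable_ge0; last exact: lt_trans hn (ltry _).
    exact: measurable_grad_error.
  by move=> u; exact: sqr_ge0.
have i1 := integrableD measurableT
  (integrableZl measurableT 2 (integrable_tangential_sq (Cphi n)))
  (integrableZl measurableT 2 iD).
apply: le_integrable i1 => //; first by apply/measurable_EFinP; exact: measurable_enorm_sq.
move=> u _ /=; rewrite lee_fin ger0_norm ?sqr_ge0// ger0_norm; last first.
  by rewrite addr_ge0// mulr_ge0// sqr_ge0.
have := @young_enorm (tangential_grad (phi n) u) (sgrad g u) 1 ltr01.
rewrite invr1 -(enormN (sgrad g u - _)) opprB.
by have -> : 1 + 1 = 2 :> R by ring.
Qed.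

(** The continuous extension [gh] allows the error to be written in octant coordinates as well. Only
    an upper bound on the energy of [Phi] is recorded: the matching lower bound will come from the
    ground state estimates. *)
Lemma sobolev_approximation (g : S2 R -> R) (gh : 'rV[R]_3 -> R) (kappa : R) :
  continuous gh -> (forall u, g u = gh (emb u)) -> H1 g -> 0 < kappa ->
  exists Phi, [/\ C1 Phi,
    oct_int (tangential_sq Phi) - 2 * oct_int (fun x => Phi x ^+ 2) <=
      2 * (\int[sigma]_u (2^-1 * enorm (sgrad g u) ^+ 2 - g u ^+ 2)) + kappa &
    oct_int (fun x => (Phi x - gh x) ^+ 2) <= kappa].
Proof.
move=> cgh gE Hg k0; pose V := sgrad g.
have [mg mV [phi Cphi [cg cV]]] := sgradP Hg; rewrite -/V in mV cV.
have sq0 (F : 'rV[R]_3 -> R) x : 0 <= F x ^+ 2 by exact: sqr_ge0.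
have csq (F : 'rV[R]_3 -> R) : continuous F -> continuous (fun x => F x ^+ 2).
  exact: continuous_expr2.
have V0 u : 0 <= enorm (V u) ^+ 2 by exact: sqr_ge0.
have mV2 : measurable_fun setT (fun u => enorm (V u) ^+ 2) by exact: measurable_enorm_sq.
have mD n : measurable_fun setT (fun u => enorm (V u - tangential_grad (phi n) u) ^+ 2).
  exact: measurable_grad_error.
have close e : 0 < e -> exists n,
    (\int[sigma]_u ((g u - phi n (emb u)) ^+ 2)%:E < e%:E)%E /\
    (\int[sigma]_u (enorm (V u - tangential_grad (phi n) u) ^+ 2)%:E < e%:E)%E.
  move=> e0.
  have := cvg0_lt e0 cg; have := cvg0_lt e0 cV => h1 h2.
  have [N _ hN] : \forall n \near \oo, (\int[sigma]_u ((g u - phi n (emb u)) ^+ 2)%:E < e%:E)%E /\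
    (\int[sigma]_u (enorm (V u - tangential_grad (phi n) u) ^+ 2)%:E < e%:E)%E.
    by near=> n; split; near: n.
  by exists N; apply: hN => /=.
have tsE n u : enorm (tangential_grad (phi n) u) ^+ 2 = tangential_sq (phi n) (emb u) by [].
have ts0 n x : 0 <= tangential_sq (phi n) x by exact: sqr_ge0.
have iT n := integrable_tangential_sq (Cphi n).
have iVT n e : (\int[sigma]_u (enorm (V u - tangential_grad (phi n) u) ^+ 2)%:E < e%:E)%E ->
    sigma.-integrable setT (fun u => (enorm (V u - tangential_grad (phi n) u) ^+ 2)%:E).
  by move=> h; apply: integrable_ge0 => //; exact: lt_trans h (ltry _).
have iV := integrable_sgrad_sq Hg; rewrite -/V in iV.
have igh : sigma.-integrable setT (fun u => (gh (emb u) ^+ 2)%:E).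
  by apply: (integrable_emb (F := fun x => gh x ^+ 2)) => //; exact: csq.
set X := \int[sigma]_u (enorm (V u) ^+ 2).
set W := \int[sigma]_u (gh (emb u) ^+ 2).
have X0 : 0 <= X by exact: Rintegral_ge0.
have W0 : 0 <= W by apply: Rintegral_ge0.
have -> : \int[sigma]_u (2^-1 * enorm (sgrad g u) ^+ 2 - g u ^+ 2) = 2^-1 * X - W.
  rewrite -/V; under eq_Rintegral do rewrite gE.
  rewrite RintegralB//; last exact: (integrableZl measurableT (2^-1) iV).
  by rewrite RintegralZl.
(* By the two Young inequalities the energy of [phi n] exceeds [X - 2 * W] by at most
   [s * (X + 2 * W) + (1 + 3 / s) * e]; [s] and then [e] make each term at most [kappa / 2]. *)
pose s := kappa / (2 * (X + 2 * W + 1)).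
have s0 : 0 < s by rewrite divr_gt0// mulr_gt0//; clear -X0 W0; clearbody X W; lra.
pose e := Num.min kappa (kappa / (2 * (1 + 3 * s^-1))).
have si : 0 < s^-1 by rewrite invr_gt0.
have e0 : 0 < e by rewrite lt_min k0 divr_gt0// mulr_gt0//; lra.
have [n [he1 he2]] := close e e0.
have iD := iVT n _ he2.
have cphi := C1_continuous (Cphi n).
have cd : continuous (fun x => phi n x - gh x) by exact: continuous_sub.
have id : sigma.-integrable setT (fun u => ((phi n (emb u) - gh (emb u)) ^+ 2)%:E).
  by apply: (integrable_emb (F := fun x => (phi n x - gh x) ^+ 2)) => [|x]; [exact: csq cd|exact: sqr_ge0].
have iphi : sigma.-integrable setT (fun u => (phi n (emb u) ^+ 2)%:E).
  by apply: (integrable_emb (F := fun x => phi n x ^+ 2)) => [|x]; [exact: csq cphi|exact: sqr_ge0].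
set Y := \int[sigma]_u (tangential_sq (phi n) (emb u)).
set Z := \int[sigma]_u (phi n (emb u) ^+ 2).
set D := \int[sigma]_u (enorm (V u - tangential_grad (phi n) u) ^+ 2).
set d := \int[sigma]_u ((phi n (emb u) - gh (emb u)) ^+ 2).
have De : D <= e.
  rewrite -lee_fin /D /Rintegral fineK; last exact: integrable_fin_num iD.
  exact: ltW.
have de : d <= e.
  rewrite -lee_fin /d /Rintegral fineK; last exact: integrable_fin_num id.
  apply: le_trans (ltW he1); apply: ge0_le_integral => //.
  - by move=> u _; rewrite lee_fin sqr_ge0.
  - by case/integrableP : id.
  - apply/measurable_EFinP; apply: measurable_funX; apply: measurable_funB => //.
    exact: measurable_emb.
  - by move=> u _; rewrite lee_fin gE -(opprB (gh _)) sqrrN.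
have iV1 := integrableZl measurableT (1 + s) iV.
have iD1 := integrableZl measurableT (1 + s^-1) iD.
have hY : Y <= (1 + s) * X + (1 + s^-1) * D.
  rewrite /X /D -!RintegralZl//.
  rewrite -(RintegralD measurableT iV1 iD1).
  apply: le_Rintegral => //; [exact: iT|exact: (integrableD measurableT iV1 iD1)|].
  by move=> u _; rewrite -tsE; exact: young_enorm.
have iW1 := integrableZl measurableT (1 - s) igh.
have id1 := integrableZl measurableT s^-1 id.
have hZ : (1 - s) * W <= Z + s^-1 * d.
  rewrite /Z /d /W -!RintegralZl//.
  rewrite -(RintegralD measurableT iphi id1).
  apply: le_Rintegral => //; first exact: (integrableD measurableT iphi id1).
  move=> u _; have := @young_sq_ge (gh (emb u)) (gh (emb u) - phi n (emb u)) s s0.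
  by rewrite subKr -(opprB (phi n _)) sqrrN.
exists (phi n); split => //.
- rewrite -(Rintegral_emb (continuous_tangential_sq (Cphi n)) (ts0 n)).
  rewrite -(Rintegral_emb (csq _ cphi) (sq0 _)) -/Y -/Z.
  have D0 : 0 <= D by apply: Rintegral_ge0 => u _; exact: sqr_ge0.
  have d0 : 0 <= d by apply: Rintegral_ge0 => u _; exact: sqr_ge0.
  have Z0 : 0 <= Z by apply: Rintegral_ge0 => u _; exact: sqr_ge0.
  have hs : s * (X + 2 * W) <= kappa / 2.
    rewrite /s -mulrA invfM -!mulrA ler_wpM2l ?(ltW k0)// ler_piMr ?invr_ge0//.
    by rewrite mulrC ler_pdivrMr; clear -X0 W0; clearbody X W; lra.
  have he : (1 + 3 * s^-1) * e <= kappa / 2.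
    have : e <= kappa / (2 * (1 + 3 * s^-1)) by rewrite ge_min lexx orbT.
    rewrite ler_pdivlMr; last by rewrite mulr_gt0//; clear -si; clearbody s; lra.
    by move=> h; rewrite ler_pdivlMr//; rewrite (mulrC _ e) -mulrA (mulrC _ 2).
  have k1 : (1 + s^-1) * D <= (1 + s^-1) * e.
    by rewrite ler_wpM2l//; clear -si; clearbody s; lra.
  have k2 : s^-1 * d <= s^-1 * e by rewrite ler_wpM2l// ltW.
  clear -hY hZ hs he k1 k2; clearbody X W Y Z D d s e; lra.
- rewrite -(Rintegral_emb (csq _ cd) (sq0 _)) -/d.
  by apply: le_trans de _; rewrite ge_min lexx.
Unshelve. all: by end_near.
Qed.

End sobolev_approximation.

(** * Oscillation of the quotient by an eigenfunction *)

Section oscillation.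
Context {R : realType}.
Implicit Types (h F : R * R -> R).

Lemma bmeas_swap a b c d F : bmeas (box a b c d) F ->
  bmeas (box c d a b) (fun z => F (z.2, z.1)).
Proof.
move=> [mF [M FM]]; split.
  apply: (@measurable_comp _ _ _ _ _ _ (box a b c d)) => //.
    by move=> _ [z /boxE[z1 z2] <-]; exact: in_box.
  apply: measurable_funTS; apply: measurable_fun_pair.
    exact: measurable_snd.
  exact: measurable_fst.
by exists M => z /boxE[z1 z2]; apply: FM; exact: in_box.
Qed.

Lemma boxI_swap a b c d F : bmeas (box a b c d) F ->
  boxI a b c d F = boxI c d a b (fun z => F (z.2, z.1)).
Proof. by move=> bF; rewrite boxI_iter1// boxI_iter2//; exact: bmeas_swap. Qed.

Lemma subbox a b c d a' b' c' d' : a' <= a -> b <= b' -> c' <= c -> d <= d' ->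
  @box R a b c d `<=` box a' b' c' d'.
Proof. by move=> ? ? ? ? [x y] /boxE[/= ? ?]; apply: in_box; lra. Qed.

(* Averages of [h] over translated squares stand in for its values: unlike
   values, they pass to the [L^2] limit. *)
Lemma average_shift (a b c d s s' t rho : R) h h1 :
  bmeas (box a b c d) h -> bmeas (box a b c d) h1 ->
  (forall x y, a <= x <= b -> c <= y <= d ->
    is_derive x (1 : R) ((fun r => h (r, y)) : R -> R^o) (h1 (x, y))) ->
  (forall y, c <= y <= d -> {in `[a, b], continuous (fun x => h1 (x, y))}) ->
  0 <= rho -> a <= s -> s + rho <= b -> a <= s' -> s' + rho <= b ->
  c <= t -> t + rho <= d ->
  `|boxI s' (s' + rho) t (t + rho) h - boxI s (s + rho) t (t + rho) h| <=
  2 * rho * boxI a b c d (fun z => `|h1 z|).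
Proof.
move=> bh bh1 dh ch1 rho0 as_ sb as' s'b ct td.
have ab : a <= b by lra.
have cd : c <= d by lra.
have bn := bmeas_norm bh1.
pose V y := itvI a b (fun x => `|h1 (x, y)|).
have bV : bmeas `[c, d] V by exact: (bmeas_inner2 bn ab).
have V0 y : 0 <= V y by apply: Rintegral_ge0.
have bV' : bmeas `[t, t + rho] V.
  by apply: bmeasS bV => // y; rewrite /= !in_itv /= => ?; lra.
have near x y : a <= x <= b -> c <= y <= d -> `|h (x, y) - h (a, y)| <= V y.
  move=> /andP[ax xb] ycd.
  have bs := bmeas_sec2 bh1 ycd.
  have bs' : bmeas `[a, x] (fun x => h1 (x, y)).
    by apply: bmeasS bs => // z; rewrite /= !in_itv /= => ?; lra.
  have <- : itvI a x (fun x => h1 (x, y)) = h (x, y) - h (a, y).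
    apply: (@itvI_FTC _ a x _ (fun r => h (r, y))) => // z; rewrite in_itv /= => hz.
      by apply: (ch1 y ycd); rewrite in_itv /=; lra.
    by apply: dh => //; lra.
  apply: le_trans (le_normr_Rintegral _ (bmeas_itv_integrable bs')) _ => //.
  apply: itvI_sub => //; exact: (bmeas_norm bs).
have bsub u : a <= u -> u + rho <= b -> bmeas (box u (u + rho) t (t + rho)) h.
  by move=> ? ?; apply: bmeasS bh => //; apply: subbox => //; lra.
(* Both averages are compared with the common reference [rho * h (a, y)], which is the source of the
   factor 2. *)
have avg u y : a <= u -> u + rho <= b -> c <= y <= d ->
    `|itvI u (u + rho) (fun x => h (x, y)) - rho * h (a, y)| <= rho * V y.
  move=> au ub ycd.
  have bs : bmeas `[u, u + rho] (fun x => h (x, y)).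
    have := bmeas_sec2 bh ycd.
    by apply: bmeasS => // z; rewrite /= !in_itv /= => ?; lra.
  have uu : u <= u + rho by lra.
  have e1 r : itvI u (u + rho) (cst r) = rho * r.
    by rewrite itvI_cst// mulrC; congr (_ * _); ring.
  rewrite ler_distl; apply/andP; split.
  - rewrite -mulrBr -e1; apply: itvI_le => //; first exact: bmeas_cst.
    move=> x xu; have : `|h (x, y) - h (a, y)| <= V y by apply: near => //; lra.
    by rewrite ler_distl /cst; lra.
  - rewrite -mulrDr -e1; apply: itvI_le => //; first exact: bmeas_cst.
    move=> x xu; have : `|h (x, y) - h (a, y)| <= V y by apply: near => //; lra.
    by rewrite ler_distl /cst; lra.
rewrite (boxI_iter2 (bsub _ as' s'b)) (boxI_iter2 (bsub _ as_ sb)).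
have bi u : a <= u -> u + rho <= b ->
    bmeas `[t, t + rho] (fun y => itvI u (u + rho) (fun x => h (x, y))).
  by move=> au ub; apply: (bmeas_inner2 (bsub _ au ub)); lra.
rewrite -itvIB; [|exact: bi|exact: bi].
have bd := bmeasB (bi _ as' s'b) (bi _ as_ sb).
apply: le_trans (le_normr_Rintegral _ (bmeas_itv_integrable bd)) _ => //.
have b2 : bmeas `[t, t + rho] (fun y => 2 * rho * V y).
  by apply: bmeasM => //; exact: bmeas_cst.
apply: (@le_trans _ _ (itvI t (t + rho) (fun y => 2 * rho * V y))).
  apply: itvI_le => //; first exact: bmeas_norm.
  move=> y yt; have ycd : c <= y <= d by lra.
  have := avg s' y as' s'b ycd; have := avg s y as_ sb ycd.
  rewrite !ler_distl; lra.
rewrite /itvI RintegralZl//; last exact: bmeas_itv_integrable.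
rewrite ler_wpM2l ?mulr_ge0// -/(itvI _ _ V) (boxI_iter2 bn) -/V.
by apply: itvI_sub => //; lra.
Qed.

Lemma average_value (s t rho L : R) h : 0 <= rho ->
  bmeas (box s (s + rho) t (t + rho)) h ->
  (forall x y, s <= x <= s + rho -> t <= y <= t + rho ->
    `|h (x, y) - h (s, t)| <= L) ->
  `|boxI s (s + rho) t (t + rho) h - rho ^+ 2 * h (s, t)| <= rho ^+ 2 * L.
Proof.
move=> rho0 bh hL.
have e1 r : boxI s (s + rho) t (t + rho) (cst r) = rho ^+ 2 * r.
  rewrite boxI_cst; [|lra|lra].
  by rewrite mulrC expr2; congr (_ * _); congr (_ * _); ring.
rewrite ler_distl; apply/andP; split.
- rewrite -mulrBr -e1; apply: boxI_le => //; first exact: bmeas_cst.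
  by move=> [x y] /boxE[/= hx hy]; have := hL x y hx hy; rewrite ler_distl /cst; lra.
- rewrite -mulrDr -e1; apply: boxI_le => //; first exact: bmeas_cst.
  by move=> [x y] /boxE[/= hx hy]; have := hL x y hx hy; rewrite ler_distl /cst; lra.
Qed.

(* Comes from [v <= lam + v ^ 2 / (4 lam)] integrated over a square of side at
   most 2, with [m] a lower bound of the weights; small with [e], then [lam]. *)
Definition amgm_bound (m lam e : R) : R := (4 * lam + e / (4 * lam * m)) / m.

Section quotient_oscillation.
Variables (a b : R) (p q : R -> R) (f ft fk psi fg : R * R -> R) (m L kappa : R).
Hypotheses (a0 : 0 <= a) (b2 : b <= pi / 2) (ba : b - a <= 2).
Hypothesis fC : polar_C1 f ft fk.
Hypothesis cp : {in `[a, b], continuous p}.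
Hypothesis cq : {in `[a, b], continuous q}.
Hypothesis cpsi : continuous psi.
Hypothesis cfg : continuous fg.
Hypothesis dpsi1 : forall x y, a <= x <= b -> a <= y <= b ->
  is_derive x (1 : R) ((fun r => psi (r, y)) : R -> R^o) (p x * psi (x, y)).
Hypothesis dpsi2 : forall x y, a <= x <= b -> a <= y <= b ->
  is_derive y (1 : R) ((fun r => psi (x, r)) : R -> R^o) (q y * psi (x, y)).
Hypotheses (m0 : 0 < m) (m1 : m <= 1).
Hypothesis psi_ge : forall z, box a b a b z -> m <= psi z.
Hypothesis sin_ge : forall x, a <= x <= b -> m <= sin x.
Hypothesis fg_close :
  boxI 0 (pi / 2) 0 (pi / 2) (fun z => sin z.1 * (f z - fg z) ^+ 2) <= kappa.
Hypothesis fg_lip : forall x y x' y', a <= x <= b -> a <= y <= b ->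
  a <= x' <= b -> a <= y' <= b ->
  `|fg (x, y) / psi (x, y) - fg (x', y') / psi (x', y')| <= L * (`|x - x'| + `|y - y'|).

Let B := box a b a b.
Let bf : bmeas B f.
Proof. by have [cf _ _ _ _] := fC; exact: continuous_bmeas_box. Qed.
Let bft : bmeas B ft.
Proof. by have [_ cf _ _ _] := fC; exact: continuous_bmeas_box. Qed.
Let bfk : bmeas B fk.
Proof. by have [_ _ cf _ _] := fC; exact: continuous_bmeas_box. Qed.
Let bp : bmeas B (fun z => p z.1).
Proof. by apply: bmeas_fst; exact: continuous_in_bmeas. Qed.
Let bq : bmeas B (fun z => q z.2).
Proof. by apply: bmeas_snd; exact: continuous_in_bmeas. Qed.
Let bs : bmeas B (fun z => sin z.1).
Proof. by apply: (bmeas_fst _ _ (f := sin)); apply: continuous_bmeas; exact: continuous_sin. Qed.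

Let psi_gt0 z : B z -> 0 < psi z.
Proof. by move=> /psi_ge; exact: lt_le_trans. Qed.

(** [psi] may vanish off the box, so its inverse is first regularised by [Num.max m], which changes
    nothing on the box. *)
Let bpsiV : bmeas B (fun z => (psi z)^-1).
Proof.
have cm : continuous (fun z : R * R => (Num.max m (psi z))^-1).
  move=> z; apply: cvgV; first by rewrite gt_eqF// lt_max m0.
  by apply: (@continuous_max R _ (cst m) psi); [exact: cvg_cst|exact: cpsi].
apply: bmeas_eq (continuous_bmeas_box a b a b cm) => z; rewrite inE => /psi_ge hz.
by rewrite max_r.
Qed.

(** [h1] and [h2] are the partial derivatives of [h], so [psi * h1] and [psi * h2] are the
    expressions squared in [S]; [hg] is the quotient whose oscillation is wanted. *)
Let h z := f z / psi z.
Let h1 z := (ft z - p z.1 * f z) / psi z.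
Let h2 z := (sin z.1 * fk z - q z.2 * f z) / psi z.
Let hg z := fg z / psi z.
Let S := ground_squares p q f ft fk.

Let bh : bmeas B h. Proof. exact: bmeasM. Qed.
Let bh1 : bmeas B h1.
Proof. by apply: bmeasM => //; apply: bmeasB => //; exact: bmeasM. Qed.
Let bh2 : bmeas B h2.
Proof. by apply: bmeasM => //; apply: bmeasB; exact: bmeasM. Qed.
Let bhg : bmeas B hg.
Proof. by apply: bmeasM => //; exact: continuous_bmeas_box. Qed.
Let bS : bmeas B S.
Proof.
have bsV : bmeas B (fun z => (sin z.1)^-1).
  apply: (bmeas_fst _ _ (f := fun x => (sin x)^-1)); apply: continuous_in_bmeas => x.
  rewrite in_itv /= => /sin_ge hx; apply: cvgV; first by rewrite gt_eqF// (lt_le_trans m0).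
  exact: continuous_sin.
apply: bmeasD.
  by apply: bmeasM => //; apply: bmeasX; apply: bmeasB => //; exact: bmeasM.
by apply: bmeasM => //; apply: bmeasX; apply: bmeasB; exact: bmeasM.
Qed.

Let amgm (u lam : R) : 0 < lam -> `|u| <= lam + u ^+ 2 / (4 * lam).
Proof.
move=> l0; rewrite -lerBlDl ler_pdivlMr; last by rewrite mulr_gt0.
have := sqr_ge0 (`|u| - 2 * lam).
rewrite -[u ^+ 2]real_normK ?num_real//; set v := `|u| => hv.
have : (v - 2 * lam) ^+ 2 = v ^+ 2 - (v - lam) * (4 * lam) by ring.
by move=> e; rewrite e in hv; lra.
Qed.

Local Notation bound := (amgm_bound m).

Let boxI_bound (F G : R * R -> R) lam : 0 < lam -> a <= b ->
  bmeas B F -> bmeas B G ->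
  (forall z, B z -> `|F z| <= (lam + G z / (4 * lam * m)) / m) ->
  boxI a b a b (fun z => `|F z|) <= bound lam (boxI a b a b G).
Proof.
move=> l0 ab bF bG FG; have ba2 := ba.
have bc (r : R) : bmeas B (cst r) by exact: bmeas_cst.
have b1 := bmeasM (bc m^-1) (bmeasD (bc lam) (bmeasM (bc (4 * lam * m)^-1) bG)).
apply: le_trans (boxI_le (bmeas_norm bF) b1 _) _.
  by move=> z /FG /le_trans; apply; rewrite /cst mulrC (mulrC _^-1 (G z)).
rewrite /cst boxIZ; last exact: (bmeasD (bc lam) (bmeasM (bc (4 * lam * m)^-1) bG)).
rewrite (boxID (bc lam) (bmeasM (bc _) bG)) boxIZ// boxI_cst//.
rewrite /amgm_bound mulrC ler_wpM2r ?invr_ge0 ?(ltW m0)//.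
rewrite [_^-1 * _]mulrC lerD2r mulrC ler_wpM2r ?(ltW l0)//.
have -> : 4 = 2 * 2 :> R by ring.
by apply: ler_pM => //; lra.
Qed.

Let div_le (u v : R) z : B z -> `|u| <= v -> `|u / psi z| <= v / m.
Proof.
move=> Bz uv; have p0 := psi_gt0 Bz; have pm := psi_ge Bz.
rewrite normrM (gtr0_norm (_ : 0 < (psi z)^-1)) ?invr_gt0//.
by apply: ler_pM => //; rewrite ?invr_ge0 ?(ltW p0)// lef_pV2// posrE.
Qed.

Let S_ge z : B z -> (ft z - p z.1 * f z) ^+ 2 <= S z / m /\
  (sin z.1 * fk z - q z.2 * f z) ^+ 2 <= S z / m.
Proof.
move=> Bz; have /boxE[zx _] := Bz; have sm := sin_ge zx; have m1' := m1; have m0' := m0.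
have s1 := sin_le1 z.1.
rewrite !ler_pdivlMr// /S /ground_squares.
set u := (ft z - _) ^+ 2; set v := (_ - q z.2 * f z) ^+ 2.
have u0 : 0 <= u by exact: sqr_ge0.
have v0 : 0 <= v by exact: sqr_ge0.
have s0 : 0 < sin z.1 by lra.
have k1 : u * m <= sin z.1 * u by rewrite mulrC ler_wpM2r.
have k2 : 0 <= v / sin z.1 by rewrite divr_ge0// ltW.
have k3 : v * m <= v / sin z.1.
  apply: ler_wpM2l => //; rewrite -[leLHS]mulr1 -[leRHS]mul1r; apply: ler_pM => //.
  - exact: ltW.
  - by rewrite invf_ge1.
have k4 : 0 <= sin z.1 * u by rewrite mulr_ge0// ltW.
by split; lra.
Qed.

Let S_ge0 z : B z -> 0 <= S z.
Proof.
move=> /boxE[zx _]; have s0 : 0 < sin z.1 by apply: lt_le_trans m0 _; exact: sin_ge.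
by apply: addr_ge0; rewrite mulr_ge0 ?invr_ge0 ?sqr_ge0// ltW.
Qed.

Let h12_bound lam : 0 < lam -> a <= b ->
  boxI a b a b (fun z => `|h1 z|) <= bound lam (boxI a b a b S) /\
  boxI a b a b (fun z => `|h2 z|) <= bound lam (boxI a b a b S).
Proof.
move=> l0 ab.
have k u e : u ^+ 2 <= e / m -> `|u| <= lam + e / (4 * lam * m).
  move=> ue; apply: le_trans (amgm _ l0) _; rewrite lerD2l.
  rewrite ler_pdivrMr ?mulr_gt0//; apply: le_trans ue _.
  by rewrite le_eqVlt; apply/orP; left; apply/eqP; field; rewrite !gt_eqF.
split; apply: boxI_bound => // z Bz; apply: div_le => //; apply: k; by have [] := S_ge Bz.
Qed.

(** The same AM-GM step as for the derivatives, now turning weighted L^2 closeness into L^1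
    closeness of the quotients. *)
Let hgh_bound lam : 0 < lam -> a <= b ->
  boxI a b a b (fun z => `|hg z - h z|) <= bound lam kappa.
Proof.
move=> l0 ab.
have [cf _ _ _ _] := fC.
have cd : continuous (fun z => sin z.1 * (f z - fg z) ^+ 2).
  have -> : (fun z => sin z.1 * (f z - fg z) ^+ 2) =
            (fun z => sin z.1 * ((f z - fg z) * (f z - fg z))).
    by apply/funext => z; rewrite expr2.
  have cdf : continuous (fun z => f z - fg z).
    by move=> z; apply: cvgB; [exact: cf|exact: cfg].
  move=> z; apply: cvgM; last by apply: cvgM; exact: cdf.
  by apply: (continuous_comp (g := sin)); [exact: cvg_fst|exact: continuous_sin].
have hpi0 : 0 <= pi :> R by exact: pi_ge0.
apply: le_trans (@boxI_bound _ (fun z => sin z.1 * (f z - fg z) ^+ 2) lam l0 ab _ _ _) _.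
- exact: bmeasB.
- exact: continuous_bmeas_box.
- move=> z Bz; rewrite -mulrBl; apply: div_le => //.
  apply: le_trans (amgm _ l0) _; rewrite lerD2l.
  have /boxE[zx _] := Bz; have sm := sin_ge zx.
  have -> : (fg z - f z) ^+ 2 = (f z - fg z) ^+ 2 by ring.
  rewrite ler_pdivrMr ?mulr_gt0//; set X := (_ - _) ^+ 2.
  have -> : sin z.1 * X / (4 * lam * m) * (4 * lam) = X * (sin z.1 / m).
    by field; rewrite !gt_eqF.
  by rewrite ler_peMr ?sqr_ge0// ler_pdivlMr// mul1r.
rewrite /amgm_bound ler_wpM2r ?invr_ge0 ?(ltW m0)// lerD2l ler_wpM2r//.
  by rewrite invr_ge0 !mulr_ge0 ?(ltW m0) ?(ltW l0).
apply: le_trans fg_close; apply: boxI_sub.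
- exact: continuous_bmeas_box.
- move=> z /boxE[/andP[z0 z1] _]; rewrite mulr_ge0 ?sqr_ge0//.
  by apply: sin_ge0_pi; lra.
- by have a0' := a0; have b2' := b2; apply: subbox.
Qed.

Let dh1 x y : a <= x <= b -> a <= y <= b ->
  is_derive x (1 : R) ((fun r => h (r, y)) : R -> R^o) (h1 (x, y)).
Proof.
move=> hx hy; have [_ _ _ d1 _] := fC.
have p0 := psi_gt0 (in_box hx hy).
have dV := @is_deriveV _ (fun r => psi (r, y)) x _ _ (lt0r_neq0 p0) (dpsi1 hx hy).
have df := d1 x y.
apply: is_derive_eq; rewrite /h1 /GRing.scale /=.
by field; rewrite gt_eqF.
Qed.

Let dh2 x y : a <= x <= b -> a <= y <= b ->
  is_derive y (1 : R) ((fun r => h (x, r)) : R -> R^o) (h2 (x, y)).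
Proof.
move=> hx hy; have [_ _ _ _ d2] := fC.
have p0 := psi_gt0 (in_box hx hy).
have dV := @is_deriveV _ (fun r => psi (x, r)) y _ _ (lt0r_neq0 p0) (dpsi2 hx hy).
have df := d2 x y.
apply: is_derive_eq; rewrite /h2 /GRing.scale /=.
by field; rewrite gt_eqF.
Qed.

Let csec1 (F : R * R -> R) x y : continuous F -> {for x, continuous (fun r => F (r, y))}.
Proof.
move=> cF; apply: (continuous_comp (g := F)); last exact: cF.
by apply: continuous_pair => z; [exact: cvg_id|exact: cvg_cst].
Qed.

Let csec2 (F : R * R -> R) x y : continuous F -> {for y, continuous (fun r => F (x, r))}.
Proof.
move=> cF; apply: (continuous_comp (g := F)); last exact: cF.
by apply: continuous_pair => z; [exact: cvg_cst|exact: cvg_id].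
Qed.

Let ch1 y : a <= y <= b -> {in `[a, b], continuous (fun x => h1 (x, y))}.
Proof.
move=> hy x xab; have hx : a <= x <= b by rewrite in_itv in xab.
have p0 := psi_gt0 (in_box hx hy); have [cf cft _ _ _] := fC.
have := @csec1 _ x y cf; have := @csec1 _ x y cft; have := @csec1 _ x y cpsi.
have := cp xab => c1 c2 c3 c4.
apply: cvgM; last by apply: cvgV; [rewrite gt_eqF|exact: c2].
by apply: cvgB; [exact: c3|apply: cvgM; [exact: c1|exact: c4]].
Qed.

Let ch2 x : a <= x <= b -> {in `[a, b], continuous (fun y => h2 (x, y))}.
Proof.
move=> hx y yab; have hy : a <= y <= b by rewrite in_itv in yab.
have p0 := psi_gt0 (in_box hx hy); have [cf _ cfk _ _] := fC.
have := @csec2 _ x y cf; have := @csec2 _ x y cfk; have := @csec2 _ x y cpsi.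
have := cq yab => c1 c2 c3 c4.
apply: cvgM; last by apply: cvgV; [rewrite gt_eqF|exact: c2].
apply: cvgB; first by apply: (@cvgM _ _ _ _ (cst (sin x))); [exact: cvg_cst|exact: c3].
by apply: cvgM; [exact: c1|exact: c4].
Qed.

Let L0 : a < b -> 0 <= L.
Proof.
move=> ab; have lip := @fg_lip a a b a.
have k : `|a - b| + `|a - a| = b - a :> R by rewrite subrr normr0 addr0 distrC gtr0_norm ?subr_gt0.
have : 0 <= L * (b - a).
  by rewrite -k (le_trans (normr_ge0 _) (lip _ _ _ _))// ?lexx ?(ltW ab).
by rewrite pmulr_lge0// subr_gt0.
Qed.

(** The two values are joined by a chain: value of [hg], average of [hg], average of [h], a shift of
    the square in each variable, and back. Passing between value and average costs [2 * L * rho] per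
    unit area, passing between [hg] and [h] costs [Z], each shift [2 * Z]. Division by the area
    [rho ^+ 2] gives the bound; the count yields 4 and 6, which 8 and 16 round up. *)
Lemma quotient_oscillation (rho lam s t s' t' : R) :
  0 < rho <= 1 -> 0 < lam ->
  a <= s <= b - rho -> a <= t <= b - rho -> a <= s' <= b - rho -> a <= t' <= b - rho ->
  `|fg (s', t') / psi (s', t') - fg (s, t) / psi (s, t)| <=
  8 * L * rho + 16 * bound lam (boxI a b a b S + kappa) / rho ^+ 2.
Proof.
move=> /andP[r0 r1] l0 hs ht hs' ht'.
have ab : a <= b by lra.
have lo u : a <= u <= b - rho -> a <= u by case/andP.
have hi u : a <= u <= b - rho -> u + rho <= b by move=> ?; lra.
have within u x : a <= u <= b - rho -> u <= x <= u + rho -> a <= x <= b by move=> ? ?; lra.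
have start u : u <= u <= u + rho by lra.
have dist_le u x : u <= x <= u + rho -> `|x - u| <= rho.
  by move=> /andP[ux xu]; rewrite ger0_norm; lra.
have LL : 0 <= L by apply: L0; lra.
have S0 : 0 <= boxI a b a b S by apply: boxI_ge0 => z; exact: S_ge0.
have k0 : 0 <= kappa.
  apply: le_trans fg_close; apply: boxI_ge0 => z /boxE[/andP[z0 z1] _].
  have hpi0 : 0 <= pi :> R by exact: pi_ge0.
  by rewrite mulr_ge0 ?sqr_ge0//; apply: sin_ge0_pi; lra.
set Z := bound lam _.
have mono e e' : e <= e' -> bound lam e <= bound lam e'.
  move=> ee; rewrite /amgm_bound ler_wpM2r ?invr_ge0 ?(ltW m0)// lerD2l ler_wpM2r//.
  by rewrite invr_ge0 !mulr_ge0 ?(ltW m0) ?(ltW l0).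
have [H1 H2] := h12_bound l0 ab.
have {}H1 : boxI a b a b (fun z => `|h1 z|) <= Z by apply: le_trans H1 _; apply: mono; rewrite lerDl.
have {}H2 : boxI a b a b (fun z => `|h2 z|) <= Z by apply: le_trans H2 _; apply: mono; rewrite lerDl.
have H3 : boxI a b a b (fun z => `|hg z - h z|) <= Z.
  by apply: le_trans (hgh_bound l0 ab) _; apply: mono; rewrite lerDr.
have Z0 : 0 <= Z by apply: le_trans H1; exact: boxI_ge0.
pose A F u v := boxI u (u + rho) v (v + rho) F.
have sub u v : a <= u <= b - rho -> a <= v <= b - rho ->
    box u (u + rho) v (v + rho) `<=` B.
  by move=> hu hv; apply: subbox; [exact: lo|exact: hi|exact: lo|exact: hi].
have Ag u v : a <= u <= b - rho -> a <= v <= b - rho -> `|A hg u v - A h u v| <= Z.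
  move=> hu hv; have sB := sub u v hu hv.
  have bb F : bmeas B F -> bmeas (box u (u + rho) v (v + rho)) F.
    exact: (bmeasS (measurable_box _ _ _ _) sB).
  rewrite /A -boxIB; [|exact: bb|exact: bb].
  apply: le_trans (boxI_norm (bmeasB (bb _ bhg) (bb _ bh))) _.
  apply: le_trans H3; apply: boxI_sub => //.
  by apply: bmeas_norm; exact: bmeasB.
have Av u v : a <= u <= b - rho -> a <= v <= b - rho ->
    `|A hg u v - rho ^+ 2 * hg (u, v)| <= rho ^+ 2 * (2 * L * rho).
  move=> hu hv; apply: average_value; first exact: ltW.
    exact: (bmeasS (measurable_box _ _ _ _) (sub _ _ hu hv) bhg).
  move=> x y hx hy; apply: le_trans (@fg_lip _ _ _ _ _ _ _ _) _.
  - exact: within hu hx.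
  - exact: within hv hy.
  - exact: within hu (start u).
  - exact: within hv (start v).
  rewrite (mulrC 2 L) -mulrA ler_wpM2l// mulr_natl mulr2n.
  by apply: lerD; exact: dist_le.
have sh1 u u' v : a <= u <= b - rho -> a <= u' <= b - rho -> a <= v <= b - rho ->
    `|A h u' v - A h u v| <= 2 * Z.
  move=> hu hu' hv.
  have := @average_shift a b a b u u' v rho h h1 bh bh1 dh1 ch1.
  move=> /(_ (ltW r0) (lo _ hu) (hi _ hu) (lo _ hu') (hi _ hu') (lo _ hv) (hi _ hv))/le_trans; apply.
  by apply: ler_pM => //; [rewrite mulr_ge0// ltW|exact: boxI_ge0|rewrite ler_piMr].
have sh2 u v v' : a <= u <= b - rho -> a <= v <= b - rho -> a <= v' <= b - rho ->
    `|A h u v' - A h u v| <= 2 * Z.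
  move=> hu hv hv'.
  have swp w : a <= w <= b - rho -> A h u w =
      boxI w (w + rho) u (u + rho) (fun z => h (z.2, z.1)).
    by move=> hw; rewrite /A boxI_swap//; exact: (bmeasS (measurable_box _ _ _ _) (sub _ _ hu hw) bh).
  rewrite !swp//.
  have := @average_shift a b a b v v' u rho (fun z => h (z.2, z.1)) (fun z => h2 (z.2, z.1))
    (bmeas_swap bh) (bmeas_swap bh2) (fun x y hx hy => dh2 hy hx) ch2.
  move=> /(_ (ltW r0) (lo _ hv) (hi _ hv) (lo _ hv') (hi _ hv') (lo _ hu) (hi _ hu))/le_trans; apply.
  have -> : boxI a b a b (fun z => `|h2 (z.2, z.1)|) = boxI a b a b (fun z => `|h2 z|).
    by rewrite [RHS]boxI_swap//; exact: bmeas_norm.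
  by apply: ler_pM => //; [rewrite mulr_ge0// ltW|exact: boxI_ge0|rewrite ler_piMr].
have main : rho ^+ 2 * `|hg (s', t') - hg (s, t)| <= rho ^+ 2 * (8 * L * rho) + 16 * Z.
  have := Av s t hs ht; have := Av s' t' hs' ht'.
  have := Ag s t hs ht; have := Ag s' t' hs' ht'.
  have := sh1 s s' t hs hs' ht; have := sh2 s' t t' hs' ht ht'.
  have -> : rho ^+ 2 * `|hg (s', t') - hg (s, t)| =
      `|rho ^+ 2 * hg (s', t') - rho ^+ 2 * hg (s, t)|.
    by rewrite -mulrBr normrM (ger0_norm (sqr_ge0 _)).
  have e : 0 <= rho ^+ 2 * (L * rho) by rewrite !mulr_ge0 ?sqr_ge0// ltW.
  have -> : rho ^+ 2 * (8 * L * rho) = 8 * (rho ^+ 2 * (L * rho)) by ring.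
  have -> : rho ^+ 2 * (2 * L * rho) = 2 * (rho ^+ 2 * (L * rho)) by ring.
  rewrite !ler_norml.
  move: (rho ^+ 2 * (L * rho)) e => e e0.
  move: (A h _ _) (A h _ _) (A h _ _) (A hg _ _) (A hg _ _) => A1 A2 A3 A4 A5.
  move: (rho ^+ 2 * _) (rho ^+ 2 * _) => u v; lra.
have rr : 0 < rho ^+ 2 by rewrite exprn_gt0.
rewrite -(ler_pM2l rr); apply: le_trans main _.
by rewrite mulrDr lerD2l [leRHS]mulrC divfK ?gt_eqF.
Qed.

End quotient_oscillation.
End oscillation.

(** * Sign components *)

Section characters.
Context {R : realType}.
Implicit Types (Phi gh : 'rV[R]_3 -> R).
Local Notation octI F := (boxI 0 (pi / 2) 0 (pi / 2) F).
Local Notation oct_int F :=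
  (octI (fun z => sin z.1 * osum (fun s t w => F (oct s t w z)))).

Lemma ocharB a b c (G G' : bool -> bool -> bool -> R) :
  ochar a b c (fun s t w => G s t w - G' s t w) = ochar a b c G - ochar a b c G'.
Proof. by rewrite /ochar /osum /=; ring. Qed.

(** The antipode flips all three signs and multiplies a character by the parity of the number of
    [true] slots. An even character weights antipodal values equally, and these cancel. *)
Lemma ochar_antipodal a b c (G : bool -> bool -> bool -> R) :
  (forall s t w, G (~~ s) (~~ t) (~~ w) = - G s t w) -> ~~ (a (+) b (+) c) ->
  ochar a b c G = 0.
Proof.
move=> h; rewrite /ochar /osum /=.
have := h true true true; have := h true true false; have := h true false true.
have := h true false false => /= -> -> -> ->.
by case: a; case: b; case: c => //= _; rewrite ?expr0 ?expr1; ring.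
Qed.

Definition sign_comp Phi a b c (z : R * R) : R := ochar a b c (fun s t w => Phi (oct s t w z)).
Definition comp_theta Phi a b c (z : R * R) : R := ochar a b c (fun s t w => oct_theta Phi s t w z).
Definition comp_phi Phi a b c (z : R * R) : R := ochar a b c (fun s t w => oct_phi Phi s t w z).
Definition comp_energy Phi a b c : R * R -> R :=
  polar_energy (sign_comp Phi a b c) (comp_theta Phi a b c) (comp_phi Phi a b c).

Lemma polar_C1_comp Phi a b c : C1 Phi ->
  polar_C1 (sign_comp Phi a b c) (comp_theta Phi a b c) (comp_phi Phi a b c).
Proof. by move=> CPhi; apply: polar_C1_ochar => s t w; exact: polar_C1_oct. Qed.

Lemma continuous_osum (F : bool -> bool -> bool -> R * R -> R) :
  (forall s t w, continuous (F s t w)) -> continuous (fun z => osum (fun s t w => F s t w z)).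
Proof.
move=> h.
have c0 := continuous_add (continuous_add (continuous_add
  (h false false false) (h true false false)) (h false true false)) (h true true false).
have c1 := continuous_add (continuous_add (continuous_add
  (h false false true) (h true false true)) (h false true true)) (h true true true).
exact: (continuous_add c0 c1).
Qed.

Lemma continuous_comp_oct Phi s t w : continuous Phi -> continuous (fun z => Phi (oct s t w z)).
Proof.
move=> cP z; apply: (continuous_comp (g := Phi)); first exact: continuous_oct.
exact: cP.
Qed.

Lemma continuous_component Phi a b c : continuous Phi -> continuous (sign_comp Phi a b c).
Proof.
move=> cP; apply: continuous_mul; first exact: cst_continuous.
apply: continuous_osum => s t w; apply: continuous_mul; first exact: cst_continuous.
exact: continuous_comp_oct.
Qed.

Lemma continuous_oct_int Phi : continuous Phi ->
  continuous (fun z => sin z.1 * osum (fun s t w => Phi (oct s t w z))).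
Proof.
move=> cP; apply: continuous_mul; first exact: continuous_sin1.
by apply: continuous_osum => s t w; exact: continuous_comp_oct.
Qed.

Lemma continuous_polar_energy (f ft fk : R * R -> R) : polar_C1 f ft fk ->
  continuous (polar_energy f ft fk).
Proof.
move=> [cf cft cfk _ _]; apply: continuous_mul; first exact: continuous_sin1.
apply: continuous_sub; last first.
  by apply: continuous_mul; [exact: cst_continuous|exact: continuous_expr2].
by move=> z; apply: cvgD; exact: continuous_expr2.
Qed.

(** The even components of [Phi] may have negative energy. There [Y = 0], so [X ^+ 2] is itself the
    squared error and the last term absorbs [- 2 * X ^+ 2]; everything else that is dropped is a sum
    of squares. *)
Lemma odd_part_le (S : R) (X Y T K en : bool -> bool -> bool -> R) :
  0 <= S -> (forall a b c, ~~ (a (+) b (+) c) -> Y a b c = 0) ->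
  (forall a b c, en a b c = S * (T a b c ^+ 2 + K a b c ^+ 2 - 2 * X a b c ^+ 2)) ->
  8 * (en true false false + en false true false + en false false true + en true true true) <=
  S * (8 * osum (fun a b c => T a b c ^+ 2) + 8 * osum (fun a b c => K a b c ^+ 2))
  - 2 * (S * (8 * osum (fun a b c => X a b c ^+ 2)))
  + 2 * (S * (8 * osum (fun a b c => (X a b c - Y a b c) ^+ 2))).
Proof.
move=> S0 Y0 enE; rewrite !enE /osum.
rewrite (Y0 false false false)// (Y0 true true false)// (Y0 true false true)// (Y0 false true true)//.
rewrite !subr0 -subr_ge0.
set d1 := (X true false false - _) ^+ 2; set d2 := (X false true false - _) ^+ 2.
set d3 := (X false false true - _) ^+ 2; set d4 := (X true true true - _) ^+ 2.
rewrite [leRHS](_ : _ = S * (8 * (T false false false ^+ 2 + T true true false ^+ 2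
  + T true false true ^+ 2 + T false true true ^+ 2 + K false false false ^+ 2
  + K true true false ^+ 2 + K true false true ^+ 2 + K false true true ^+ 2)
  + 16 * (d1 + d2 + d3 + d4))); last by ring.
by rewrite mulr_ge0// !addr_ge0 ?mulr_ge0 ?addr_ge0 ?sqr_ge0.
Qed.

Lemma odd_components_le Phi gh (e kappa : R) :
  C1 Phi -> continuous gh -> (forall x, enorm x = 1 -> gh (- x) = - gh x) ->
  oct_int (tangential_sq Phi) - 2 * oct_int (fun x => Phi x ^+ 2) <= e ->
  oct_int (fun x => (Phi x - gh x) ^+ 2) <= kappa ->
  8 * (octI (comp_energy Phi true false false) + octI (comp_energy Phi false true false)
   + octI (comp_energy Phi false false true) + octI (comp_energy Phi true true true))
  <= e + 2 * kappa.
Proof.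
move=> CPhi cgh gh_odd he hk.
have cP := C1_continuous CPhi; have cT := continuous_tangential_sq CPhi.
have cP2 : continuous (fun x => Phi x ^+ 2) by exact: continuous_expr2.
have cd2 : continuous (fun x => (Phi x - gh x) ^+ 2).
  by apply: continuous_expr2; exact: continuous_sub.
have bT := continuous_bmeas_box 0 (pi / 2) 0 (pi / 2) (continuous_oct_int cT).
have bP2 := continuous_bmeas_box 0 (pi / 2) 0 (pi / 2) (continuous_oct_int cP2).
have bd2 := continuous_bmeas_box 0 (pi / 2) 0 (pi / 2) (continuous_oct_int cd2).
have bE a b c := continuous_bmeas_box 0 (pi / 2) 0 (pi / 2)
  (continuous_polar_energy (polar_C1_comp a b c CPhi)).
have b2 (r : R) := @bmeas_cst _ (measurableTypeR R * measurableTypeR R)%type R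
  (box 0 (pi / 2) 0 (pi / 2)) r.
have bE2 := bmeasD (bE true false false) (bE false true false).
have bE3 := bmeasD bE2 (bE false false true).
have bE4 := bmeasD bE3 (bE true true true).
rewrite -(boxID (bE true false false) (bE false true false)).
rewrite -(boxID bE2 (bE false false true)) -(boxID bE3 (bE true true true)) -(boxIZ _ bE4).
apply: (@le_trans _ _ (oct_int (tangential_sq Phi) - 2 * oct_int (fun x => Phi x ^+ 2) +
  2 * oct_int (fun x => (Phi x - gh x) ^+ 2))); last by lra.
have bP22 := bmeasM (b2 2) bP2; have bd22 := bmeasM (b2 2) bd2.
rewrite -(boxIZ 2 bP2) -(boxIZ 2 bd2) -(boxIB bT bP22) -(boxID (bmeasB bT bP22) bd22).
apply: boxI_le.
- exact: bmeasM (b2 8) bE4.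
- exact: (bmeasD (bmeasB bT bP22) bd22).
move=> z /boxE[/andP[z0 z1] _].
have [h0 h2] := @hpi_bounds R.
have s0 : 0 <= sin z.1 by apply: sin_ge0_pi; lra.
have odd3 s t w : gh (oct (~~ s) (~~ t) (~~ w) z) = - gh (oct s t w z).
  rewrite -gh_odd ?oct_unit//; congr gh; apply/rowP => j; rewrite /oct [RHS]mxE !vec3E.
  by case: ifP => _; [|case: ifP => _]; rewrite signrN mulNr.
have ev a b c : ~~ (a (+) b (+) c) -> sign_comp gh a b c z = 0.
  by move=> abc; apply: ochar_antipodal.
have -> : osum (fun s t w => tangential_sq Phi (oct s t w z)) =
  osum (fun s t w => oct_theta Phi s t w z ^+ 2) + osum (fun s t w => oct_phi Phi s t w z ^+ 2).
  rewrite -osumD; congr osum; apply/funext => s; apply/funext => t; apply/funext => w.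
  exact: tangential_sq_oct.
have Pt : osum (fun s t w => oct_theta Phi s t w z ^+ 2) =
  8 * osum (fun a b c => comp_theta Phi a b c z ^+ 2) by exact: ochar_parseval.
have Pp : osum (fun s t w => oct_phi Phi s t w z ^+ 2) =
  8 * osum (fun a b c => comp_phi Phi a b c z ^+ 2) by exact: ochar_parseval.
have P0 : osum (fun s t w => Phi (oct s t w z) ^+ 2) =
  8 * osum (fun a b c => sign_comp Phi a b c z ^+ 2) by exact: ochar_parseval.
have Pd : osum (fun s t w => (Phi (oct s t w z) - gh (oct s t w z)) ^+ 2) =
  8 * osum (fun a b c => (sign_comp Phi a b c z - sign_comp gh a b c z) ^+ 2).
  rewrite (ochar_parseval (fun s t w => Phi (oct s t w z) - gh (oct s t w z))).
  congr (_ * osum _); apply/funext => a; apply/funext => b; apply/funext => c.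
  by congr (_ ^+ 2); exact: ocharB.
rewrite Pt Pp P0 Pd.
exact: (odd_part_le (en := fun a b c => comp_energy Phi a b c z)).
Qed.

Lemma component_close Phi gh (kappa : R) a b c :
  continuous Phi -> continuous gh ->
  oct_int (fun x => (Phi x - gh x) ^+ 2) <= kappa ->
  octI (fun z => sin z.1 * (sign_comp Phi a b c z - sign_comp gh a b c z) ^+ 2) <= kappa.
Proof.
move=> cP cgh hk; apply: le_trans hk.
have cd2 : continuous (fun x => (Phi x - gh x) ^+ 2).
  by apply: continuous_expr2; exact: continuous_sub.
have cdd := continuous_sub (@continuous_component Phi a b c cP) (@continuous_component gh a b c cgh).
apply: boxI_le.
- exact: (continuous_bmeas_box 0 (pi / 2) 0 (pi / 2)
    (continuous_mul (@continuous_sin1 R) (continuous_expr2 cdd))).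
- exact: (continuous_bmeas_box 0 (pi / 2) 0 (pi / 2) (continuous_oct_int cd2)).
move=> z /boxE[/andP[z0 z1] _].
have [h0 h2] := @hpi_bounds R.
have s0 : 0 <= sin z.1 by apply: sin_ge0_pi; lra.
(* By Parseval the squared errors of all eight components add up to one eighth of the total, so one
   of them is bounded by the total. *)
rewrite ler_wpM2l// (ochar_parseval (fun s t w => Phi (oct s t w z) - gh (oct s t w z))).
rewrite /sign_comp -ocharB.
set F := fun a b c => ochar a b c _ ^+ 2.
have F0 x y w : 0 <= F x y w by exact: sqr_ge0.
rewrite -/(F a b c) /osum.
have := F0 false false false; have := F0 true true false.
have := F0 true false true; have := F0 false true true.
have := F0 true false false; have := F0 false true false.
have := F0 false false true; have := F0 true true true.
by clear cdd; case: a; case: b; case: c; lra.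
Qed.

Lemma comp_vanish_x Phi b c (z : R * R) : sin z.1 * cos z.2 = 0 -> sign_comp Phi true b c z = 0.
Proof. by move=> h; apply: ochar_x => t w; rewrite /oct h !mulr0. Qed.

Lemma comp_vanish_y Phi a c (z : R * R) : sin z.1 * sin z.2 = 0 -> sign_comp Phi a true c z = 0.
Proof. by move=> h; apply: ochar_y => s w; rewrite /oct h !mulr0. Qed.

Lemma comp_vanish_z Phi a b (z : R * R) : cos z.1 = 0 -> sign_comp Phi a b true z = 0.
Proof. by move=> h; apply: ochar_z => s t; rewrite /oct h !mulr0. Qed.

Lemma polar_C1_bounded (f ft fk : R * R -> R) : polar_C1 f ft fk ->
  exists M, forall z : R * R, box 0 (pi / 2) 0 (pi / 2) z ->
    [/\ `|f z| <= M, `|ft z| <= M & `|fk z| <= M].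
Proof.
move=> [c1 c2 c3 _ _].
have [_ [M1 h1]] := continuous_bmeas_box 0 (pi / 2) 0 (pi / 2) c1.
have [_ [M2 h2]] := continuous_bmeas_box 0 (pi / 2) 0 (pi / 2) c2.
have [_ [M3 h3]] := continuous_bmeas_box 0 (pi / 2) 0 (pi / 2) c3.
exists (Num.max M1 (Num.max M2 M3)) => z Oz.
by rewrite !le_max (h1 _ Oz) (h2 _ Oz) (h3 _ Oz) !orbT.
Qed.

Lemma components_ge (Phi : 'rV[R]_3 -> R) (delta : R) : C1 Phi -> 0 < delta -> delta <= pi / 4 ->
  let S p q a b c := ground_squares p q (sign_comp Phi a b c) (comp_theta Phi a b c) (comp_phi Phi a b c) in
  [/\ innerI delta (S cot (fun y => - tan y) true false false) <= octI (comp_energy Phi true false false),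
      innerI delta (S cot cot false true false) <= octI (comp_energy Phi false true false),
      innerI delta (S (fun x => - tan x) (cst 0) false false true) <= octI (comp_energy Phi false false true) &
      innerI delta (S (fun x => - tan x) (cst 0) true true true) <= octI (comp_energy Phi true true true)].
Proof.
move=> CPhi d0 dh S.
have bnd a b c := polar_C1_bounded (polar_C1_comp a b c CPhi).
split; rewrite /S.
- have [M hM] := bnd true false false.
  apply: (component_x (polar_C1_comp _ _ _ CPhi) d0 dh hM) => u; apply: comp_vanish_x => /=.
    by rewrite sin0 mul0r.
  by rewrite cos_pihalf mulr0.
- have [M hM] := bnd false true false.
  apply: (component_y (polar_C1_comp _ _ _ CPhi) d0 dh hM) => u; apply: comp_vanish_y => /=.
    by rewrite sin0 mul0r.
  by rewrite sin0 mulr0.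
- have [M hM] := bnd false false true.
  by apply: (component_z (polar_C1_comp _ _ _ CPhi) d0 dh hM) => u; apply: comp_vanish_z => /=; rewrite cos_pihalf.
(* Of the three coordinate planes where this component vanishes, [z = 0] already makes [cos(theta)]
   an admissible ground state. *)
- have [M hM] := bnd true true true.
  by apply: (component_z (polar_C1_comp _ _ _ CPhi) d0 dh hM) => u; apply: comp_vanish_z => /=; rewrite cos_pihalf.
Qed.

End characters.

(** * The three ground states away from the boundary, and Lipschitz bounds for quotients by them *)

Section flatness.
Context {R : realType}.
Implicit Types (Phi G gh : 'rV[R]_3 -> R) (z : R * R).
Local Notation sigma := (@surface_measure R).

Lemma sin_le_hpi (x y : R) : 0 <= x -> x <= y -> y <= pi / 2 -> sin x <= sin y.
Proof.
move=> x0 xy yh; rewrite -subr_ge0.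
have <- : itvI x y cos = sin y - sin x.
  by apply: itvI_FTC => // t _; [exact: continuous_cos|exact: is_derive_sin].
apply: Rintegral_ge0 => t /=; rewrite in_itv /= => ht.
by apply: cos_ge0_pihalf; lra.
Qed.

Definition psi_x z : R := sin z.1 * cos z.2.
Definition psi_y z : R := sin z.1 * sin z.2.
Definition psi_z z : R := cos z.1.

Definition dist1 z z' : R := `|z.1 - z'.1| + `|z.2 - z'.2|.

Definition eigenstate (a b m : R) (p q : R -> R) (psi : R * R -> R) :=
  [/\ {in `[a, b], continuous p}, {in `[a, b], continuous q} & continuous psi] /\
  [/\ forall x y : R, a <= x <= b -> a <= y <= b ->
        is_derive x (1 : R) ((fun r => psi (r, y)) : R -> R^o) (p x * psi (x, y)),
      forall x y : R, a <= x <= b -> a <= y <= b ->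
        is_derive y (1 : R) ((fun r => psi (x, r)) : R -> R^o) (q y * psi (x, y)),
      forall z, box a b a b z -> m <= psi z &
      forall z z', `|psi z - psi z'| <= dist1 z z'].

Section states.
Variable delta : R.
Hypotheses (d0 : 0 < delta) (d4 : delta <= pi / 4).
Let a := delta.
Let b := pi / 2 - delta.
(** On the box each sine or cosine is at least [sin delta], and a ground state has at most two such
    factors. *)
Let m := sin delta ^+ 2.

Let sin_ge x : a <= x <= b -> sin delta <= sin x.
Proof.
have h := d0; have h' := d4; rewrite /a /b => hx.
by apply: sin_le_hpi; lra.
Qed.

Let cos_ge x : a <= x <= b -> sin delta <= cos x.
Proof.
have h := d0; have h' := d4; rewrite /a /b => hx.
by rewrite -sin_hpiB; apply: sin_le_hpi; lra.
Qed.

Lemma sin_delta_gt0 : 0 < sin delta.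
Proof. by have h := d0; have h' := d4; have [h1 _] := @hpi_bounds R; apply: sin_gt0_hpi; lra. Qed.

Let sin_gt0 x : a <= x <= b -> 0 < sin x.
Proof. by move=> /sin_ge; apply: lt_le_trans; exact: sin_delta_gt0. Qed.

Let cos_gt0 x : a <= x <= b -> 0 < cos x.
Proof. by move=> /cos_ge; apply: lt_le_trans; exact: sin_delta_gt0. Qed.

Lemma m_bounds : 0 < m <= 1.
Proof.
have s0 := sin_delta_gt0; have s1 := @sin_le1 R delta.
by rewrite /m exprn_gt0//= expr_le1// ltW.
Qed.

Lemma sin_ge_m x : a <= x <= b -> m <= sin x.
Proof.
move=> /sin_ge; apply: le_trans; rewrite /m expr2 ler_piMr ?sin_le1//.
by rewrite ltW// sin_delta_gt0.
Qed.

Let ccot : {in `[a, b], continuous (@cot R)}.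
Proof.
move=> x; rewrite in_itv /= => /sin_gt0 s0.
apply: cvgM; first exact: continuous_cos.
by apply: cvgV; [rewrite gt_eqF|exact: continuous_sin].
Qed.

Let ctan : {in `[a, b], continuous (fun x : R => - tan x)}.
Proof.
move=> x; rewrite in_itv /= => /cos_gt0 s0.
by apply: cvgN; apply: continuous_tan; rewrite gt_eqF.
Qed.

Let c1 (h : R -> R) : continuous h -> continuous (fun z : R * R => h z.1).
Proof. by move=> ch z; apply: (continuous_comp (g := h)); [exact: cvg_fst|exact: ch]. Qed.
Let c2 (h : R -> R) : continuous h -> continuous (fun z : R * R => h z.2).
Proof. by move=> ch z; apply: (continuous_comp (g := h)); [exact: cvg_snd|exact: ch]. Qed.

Lemma eigenstate_x : eigenstate a b m cot (fun y => - tan y) psi_x.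
Proof.
split; first split.
- exact: ccot.
- exact: ctan.
- by apply: continuous_mul; [exact: (c1 (@continuous_sin R))|exact: (c2 (@continuous_cos R))].
split.
- move=> x y hx hy; have s0 := sin_gt0 hx; rewrite /psi_x /=; apply: is_derive_eq.
  by rewrite /GRing.scale /cot /=; field; rewrite gt_eqF.
- move=> x y hx hy; have s0 := cos_gt0 hy; rewrite /psi_x /=; apply: is_derive_eq.
  by rewrite /GRing.scale /tan /=; field; rewrite gt_eqF.
- move=> z /boxE[/sin_ge h1 /cos_ge h2]; have s0 := ltW sin_delta_gt0.
  by rewrite /m /psi_x expr2; apply: ler_pM.
- move=> z z'; apply: le_trans (mul_lipschitz _ _ _ _) _; [exact: norm_sin_le1|exact: norm_cos_le1|].
  by apply: lerD; [exact: sin_lipschitz|exact: cos_lipschitz].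
Qed.

Lemma eigenstate_y : eigenstate a b m cot cot psi_y.
Proof.
split; first split.
- exact: ccot.
- exact: ccot.
- by apply: continuous_mul; [exact: (c1 (@continuous_sin R))|exact: (c2 (@continuous_sin R))].
split.
- move=> x y hx hy; have s0 := sin_gt0 hx; rewrite /psi_y /=; apply: is_derive_eq.
  by rewrite /GRing.scale /cot /=; field; rewrite gt_eqF.
- move=> x y hx hy; have s0 := sin_gt0 hy; rewrite /psi_y /=; apply: is_derive_eq.
  by rewrite /GRing.scale /cot /=; field; rewrite gt_eqF.
- move=> z /boxE[/sin_ge h1 /sin_ge h2]; have s0 := ltW sin_delta_gt0.
  by rewrite /m /psi_y expr2; apply: ler_pM.
- move=> z z'; apply: le_trans (mul_lipschitz _ _ _ _) _; [exact: norm_sin_le1|exact: norm_sin_le1|].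
  by apply: lerD; exact: sin_lipschitz.
Qed.

Lemma eigenstate_z : eigenstate a b m (fun x => - tan x) (cst 0) psi_z.
Proof.
split; first split.
- exact: ctan.
- by move=> x _; exact: cvg_cst.
- exact: (c1 (@continuous_cos R)).
split.
- move=> x y hx hy; have s0 := cos_gt0 hx; rewrite /psi_z /=; apply: is_derive_eq.
  by rewrite /tan; field; rewrite gt_eqF.
- move=> x y hx hy; rewrite /psi_z /= mul0r; exact: (is_derive_cst (cos x : R^o)).
- move=> z /boxE[/cos_ge h1 _]; have s0 := ltW sin_delta_gt0.
  apply: le_trans h1; rewrite /m expr2 ler_piMr ?sin_le1//.
- by move=> z z'; apply: le_trans (cos_lipschitz _ _) _; rewrite lerDl.
Qed.

End states.

Lemma osum_norm (T : bool -> bool -> bool -> R) (M : R) :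
  (forall s t w, `|T s t w| <= M) -> `|osum T| <= M * 8.
Proof.
move=> hT; rewrite /osum.
have := hT false false false; have := hT true false false; have := hT false true false.
have := hT true true false; have := hT false false true; have := hT true false true.
have := hT false true true; have := hT true true true.
move: (T _ _ _) (T _ _ _) (T _ _ _) (T _ _ _) (T _ _ _) (T _ _ _) (T _ _ _) (T _ _ _).
by move=> t1 t2 t3 t4 t5 t6 t7 t8; rewrite !ler_norml; lra.
Qed.

Lemma ochar_norm a b c (F : bool -> bool -> bool -> R) (M : R) :
  (forall s t w, `|F s t w| <= M) -> `|ochar a b c F| <= M.
Proof.
move=> h; rewrite /ochar normrM ger0_norm ?invr_ge0// mulrC ler_pdivrMr//.
by apply: osum_norm => s t w; rewrite !normrM !normr_sign !mul1r.
Qed.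

Lemma ochar_inversion (F : bool -> bool -> bool -> R) s t w :
  F s t w = osum (fun a b c =>
    (-1) ^+ (a && s) * ((-1) ^+ (b && t) * (-1) ^+ (c && w)) * ochar a b c F).
Proof.
rewrite /ochar /osum /= !expr0.
by case: s; case: t; case: w; rewrite /= ?expr0 ?expr1; field.
Qed.

Section normalized.
Variables (p : 'rV[R]_3) (G : 'rV[R]_3 -> R).
Hypothesis Glip : forall x y, `|G x - G y| <= enorm (x - y).
Hypothesis Gunit : forall x, enorm x = 1 -> `|G x| <= 2^-1 /\ G (- x) = - G x.
Let gh x := G x + dot p x.

Lemma oct_G_lipschitz s t w z z' : `|G (oct s t w z) - G (oct s t w z')| <= 2 * dist1 z z'.
Proof.
apply: le_trans (Glip _ _) _; apply: enorm_le; first exact: addr_ge0.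
move=> j; have := oct_lipschitz s t w z z' j.
have -> : (oct s t w z - oct s t w z') 0 j = oct s t w z 0 j - oct s t w z' 0 j by rewrite !mxE.
by [].
Qed.

Lemma comp_G_lipschitz a b c z z' : `|sign_comp G a b c z - sign_comp G a b c z'| <= 2 * dist1 z z'.
Proof. by rewrite /sign_comp -ocharB; apply: ochar_norm => s t w; exact: oct_G_lipschitz. Qed.

Lemma comp_G_bound a b c z : `|sign_comp G a b c z| <= 2^-1.
Proof. by apply: ochar_norm => s t w; have [] := Gunit (oct_unit s t w z). Qed.

Lemma comp_gh a b c z : sign_comp gh a b c z = sign_comp G a b c z + sign_comp (dot p) a b c z.
Proof. by rewrite /sign_comp /gh /ochar /osum /=; ring. Qed.

Lemma comp_linear_x z : sign_comp (dot p) true false false z = p 0 0 * psi_x z.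
Proof. by rewrite /sign_comp /psi_x /ochar /osum !dot3 /oct !vec3E /= !expr0 !expr1; field. Qed.

Lemma comp_linear_y z : sign_comp (dot p) false true false z = p 0 1 * psi_y z.
Proof. by rewrite /sign_comp /psi_y /ochar /osum !dot3 /oct !vec3E /= !expr0 !expr1; field. Qed.

Lemma comp_linear_z z : sign_comp (dot p) false false true z = p 0 2%:R * psi_z z.
Proof. by rewrite /sign_comp /psi_z /ochar /osum !dot3 /oct !vec3E /= !expr0 !expr1; field. Qed.

Lemma comp_linear_xyz z : sign_comp (dot p) true true true z = 0 * psi_z z.
Proof. by rewrite /sign_comp /psi_z /ochar /osum !dot3 /oct !vec3E /= !expr0 !expr1; field. Qed.

(** The linear part contributes the constant [r] to the quotient and drops out of the difference,
    leaving a constant that depends on [m] alone and not on [p]. *)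
Lemma quotient_lipschitz (a0 b0 m r : R) (pp qq : R -> R) (psi : R * R -> R) a b c :
  0 < m -> m <= 1 -> eigenstate a0 b0 m pp qq psi ->
  (forall z, sign_comp (dot p) a b c z = r * psi z) ->
  forall z z', box a0 b0 a0 b0 z -> box a0 b0 a0 b0 z' ->
  `|sign_comp gh a b c z / psi z - sign_comp gh a b c z' / psi z'| <= 3 / m ^+ 2 * dist1 z z'.
Proof.
move=> m0 m1 [_ [_ _ psi_ge psi_lip]] lin z z' Bz Bz'.
have p1 := psi_ge z Bz; have p2 := psi_ge z' Bz'.
have p10 : 0 < psi z by exact: lt_le_trans p1.
have p20 : 0 < psi z' by exact: lt_le_trans p2.
have -> : sign_comp gh a b c z / psi z - sign_comp gh a b c z' / psi z' =
  ((sign_comp G a b c z - sign_comp G a b c z') * psi z' + sign_comp G a b c z' * (psi z' - psi z)) /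
  (psi z * psi z').
  by rewrite !comp_gh !lin; field; rewrite !gt_eqF.
set d := dist1 z z'; have dd : 0 <= d by exact: addr_ge0.
rewrite normrM (gtr0_norm (_ : 0 < (psi z * psi z')^-1)) ?invr_gt0 ?mulr_gt0//.
rewrite ler_pdivrMr ?mulr_gt0//.
apply: le_trans (ler_normD _ _) _.
rewrite (normrM (_ - _)) (normrM (sign_comp G a b c z')) (gtr0_norm p20).
have k1 := comp_G_lipschitz a b c z z'; have k2 := comp_G_bound a b c z'.
rewrite -/d in k1.
have k3' : `|psi z' - psi z| <= d by rewrite distrC; exact: psi_lip.
have k4 : `|sign_comp G a b c z - sign_comp G a b c z'| * psi z' <= 2 * d * psi z'.
  by rewrite ler_wpM2r// ltW.
have k5 : `|sign_comp G a b c z'| * `|psi z' - psi z| <= 2^-1 * d by exact: ler_pM.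
apply: le_trans (lerD k4 k5) _.
have mm : m * m <= psi z * psi z' by apply: ler_pM => //; exact: ltW.
have mi : 1 <= psi z / m by rewrite ler_pdivlMr// mul1r.
have e1 : 3 / m ^+ 2 * d * (psi z * psi z') =
  2 * d * psi z' * (psi z / m / m) + d * (psi z * psi z' / (m * m)) by field; rewrite gt_eqF.
rewrite e1; apply: lerD.
  rewrite ler_peMr//; first by rewrite !mulr_ge0// ltW.
  by rewrite ler_pdivlMr// mul1r; apply: le_trans mi.
rewrite mulrC ler_wpM2l//; apply: (@le_trans _ _ 1); first by lra.
by rewrite ler_pdivlMr ?mulr_gt0// mul1r.
Qed.

End normalized.
End flatness.

(** * Small energy forces a small norm *)

Lemma sin_cos_pi4 (R : realType) :
  [/\ sin (pi / 4) = cos (pi / 4) :> R, cos (pi / 4) ^+ 2 = 2^-1 :> R &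
      2^-1 <= cos (pi / 4) :> R].
Proof.
have [h0 _] := @hpi_bounds R.
have sc : sin (pi / 4) = cos (pi / 4) :> R.
  by rewrite -[in RHS](_ : pi / 2 - pi / 4 = pi / 4) ?cos_hpiB//; field.
have c2 : cos (pi / 4) ^+ 2 = 2^-1 :> R.
  by have := @cos2Dsin2 R (pi / 4); rewrite sc; lra.
have cc0 : 0 < cos (pi / 4) :> R by apply: cos_gt0_hpi; lra.
by split=> //; rewrite -c2 expr2 ler_piMl ?cos_le1// ltW.
Qed.

Section flat_bound.
Context {R : realType}.
Implicit Types (z : R * R).
Local Notation sigma := (@surface_measure R).
Local Notation octI F := (boxI 0 (pi / 2) 0 (pi / 2) F).

Lemma amgm_bound_le (m lam e e' : R) : 0 < m -> 0 < lam -> e <= e' ->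
  amgm_bound m lam e <= amgm_bound m lam e'.
Proof.
move=> m0 l0 ee; rewrite /amgm_bound ler_wpM2r ?invr_ge0 ?(ltW m0)// lerD2l ler_wpM2r//.
by rewrite invr_ge0 !mulr_ge0 ?(ltW m0) ?(ltW l0).
Qed.

Definition clamp (a b x : R) : R := Num.max a (Num.min x b).

Lemma clamp_itv a b x : a <= b -> a <= clamp a b x <= b.
Proof. by move=> ab; rewrite /clamp le_max lexx /= ge_max ab ge_min lexx orbT. Qed.

Lemma clamp_dist (a b x e : R) : 0 <= e -> a <= b -> a - e <= x <= b + e ->
  `|x - clamp a b x| <= e.
Proof.
move=> e0 ab /andP[cx xd]; rewrite /clamp.
have [xb|bx] := leP x b; have [ax|xa] := leP a _; rewrite ler_norml; lra.
Qed.

Section normalized.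
Variables (p : 'rV[R]_3) (G : 'rV[R]_3 -> R) (g : S2 R -> R).
Hypothesis Glip : forall x y, `|G x - G y| <= enorm (x - y).
Hypothesis Gunit : forall x, enorm x = 1 -> `|G x| <= 2^-1 /\ G (- x) = - G x.
Hypothesis gE : forall w : S2 R, g w = G (emb w) + dot p (emb w).
Let gh x := G x + dot p x.

Lemma continuous_gh : continuous gh.
Proof.
apply: continuous_add; first exact: enorm_lipschitz_continuous.
have cp : continuous (fun _ : 'rV[R]_3 => p) by exact: cst_continuous.
have cid : continuous (fun x : 'rV[R]_3 => x) by move=> x; exact: cvg_id.
exact: (continuous_dot cp cid).
Qed.

Lemma gh_odd x : enorm x = 1 -> gh (- x) = - gh x.
Proof. by move=> /Gunit[_ Gx]; rewrite /gh Gx dotNr opprD. Qed.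

Section oscillation.
Variables (delta rho lam kappa e : R) (Phi : 'rV[R]_3 -> R).
Hypotheses (d0 : 0 < delta) (d8 : delta <= pi / 8) (r0 : 0 < rho) (rd : rho <= delta).
Hypotheses (l0 : 0 < lam) (CPhi : C1 Phi).
Let m := sin delta ^+ 2.
(** The averaging squares of side [rho] are anchored at their lower corner, which must therefore
    stay [rho] below the upper end of the box. *)
Let bnd := pi / 2 - delta - rho.
Definition oscillation_bound :=
  8 * (3 / m ^+ 2) * rho + 16 * amgm_bound m lam (e + kappa) / rho ^+ 2.

Lemma component_flat a b c (pp qq : R -> R) (psi : R * R -> R) r :
  eigenstate delta (pi / 2 - delta) m pp qq psi ->
  (forall z, sign_comp (dot p) a b c z = r * psi z) ->
  innerI delta (ground_squares pp qq (sign_comp Phi a b c) (comp_theta Phi a b c) (comp_phi Phi a b c)) <= e ->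
  octI (fun z => sin z.1 * (sign_comp Phi a b c z - sign_comp gh a b c z) ^+ 2) <= kappa ->
  forall z z', box delta bnd delta bnd z -> box delta bnd delta bnd z' ->
  `|sign_comp gh a b c z' / psi z' - sign_comp gh a b c z / psi z| <= oscillation_bound.
Proof.
move=> est lin he hk [x y] [x' y'] /boxE[/= hx hy] /boxE[/= hx' hy'].
have dd0 := d0; have dd8 := d8; have rr0 := r0; have rrd := rd.
have [h0 h2] := @hpi_bounds R.
have d4 : delta <= pi / 4 by lra.
have bh : pi / 2 - delta <= pi / 2 by lra.
have ba : pi / 2 - delta - delta <= 2 by lra.
have r1 : 0 < rho <= 1 by lra.
have /andP[m0 m1] := m_bounds d0 d4; rewrite -/m in m0 m1.
have [[cp cq cpsi] [dp dq psi_ge psi_lip]] := est.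
have lip x1 y1 x2 y2 : delta <= x1 <= pi / 2 - delta -> delta <= y1 <= pi / 2 - delta ->
    delta <= x2 <= pi / 2 - delta -> delta <= y2 <= pi / 2 - delta ->
    `|sign_comp gh a b c (x1, y1) / psi (x1, y1) - sign_comp gh a b c (x2, y2) / psi (x2, y2)| <=
    3 / m ^+ 2 * (`|x1 - x2| + `|y1 - y2|).
  move=> ? ? ? ?.
  by apply: (quotient_lipschitz Glip Gunit m0 m1 est lin); exact: in_box.
have qo := @quotient_oscillation _ delta (pi / 2 - delta) pp qq (sign_comp Phi a b c)
  (comp_theta Phi a b c) (comp_phi Phi a b c) psi (sign_comp gh a b c) m (3 / m ^+ 2) kappa
  (ltW d0) bh ba (polar_C1_comp a b c CPhi) cp cq cpsi (@continuous_component _ gh a b c continuous_gh)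
  dp dq m0 m1 psi_ge (sin_ge_m d0 d4) hk lip rho lam x y x' y'.
apply: le_trans (qo r1 l0 hx hy hx' hy') _.
rewrite /oscillation_bound lerD2l ler_wpM2r ?invr_ge0 ?sqr_ge0// ler_wpM2l//.
by apply: amgm_bound_le => //; rewrite lerD2r.
Qed.

End oscillation.

(** The linear function to subtract has as coefficients the quotients at the centre of the square.
    On the square the remainder is small by flatness; the collar is reached by a Lipschitz bound on
    the remainder. *)
Lemma flat_components (delta rho eta : R) :
  0 < delta -> delta <= pi / 8 -> 0 < rho -> rho <= delta ->
  let Q := box delta (pi / 2 - delta - rho) delta (pi / 2 - delta - rho) in
  (forall z z', Q z -> Q z' -> `|sign_comp gh true false false z' / psi_x z' -
    sign_comp gh true false false z / psi_x z| <= eta) ->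
  (forall z z', Q z -> Q z' -> `|sign_comp gh false true false z' / psi_y z' -
    sign_comp gh false true false z / psi_y z| <= eta) ->
  (forall z z', Q z -> Q z' -> `|sign_comp gh false false true z' / psi_z z' -
    sign_comp gh false false true z / psi_z z| <= eta) ->
  (forall z z', Q z -> Q z' -> `|sign_comp gh true true true z' / psi_z z' -
    sign_comp gh true true true z / psi_z z| <= eta) ->
  class_norm g <= 4 * eta + 28 * delta.
Proof.
move=> d0 d8 r0 rd Q fx fy fz fw.
have [h0 h2] := @hpi_bounds R.
pose bnd := pi / 2 - delta - rho.
have db : delta <= bnd by rewrite /bnd; lra.
(* At this point all three ground states are at least [1/2]. *)
pose zc : R * R := (pi / 4, pi / 4).
have Qc : Q zc by apply: in_box; clear -d8 r0 rd h0 h2; lra.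
have [sc c2 cc] := sin_cos_pi4 R.
have px : psi_x zc = 2^-1 by rewrite /psi_x /= sc -expr2.
have py : psi_y zc = 2^-1 by rewrite /psi_y /= sc -expr2.
have pz : 2^-1 <= psi_z zc by [].
pose c1 := sign_comp gh true false false zc / psi_x zc.
pose c2' := sign_comp gh false true false zc / psi_y zc.
pose c3 := sign_comp gh false false true zc / psi_z zc.
pose cv := vec3 c1 c2' c3.
have Gb a b c : `|sign_comp G a b c zc| <= 2^-1 by exact: comp_G_bound.
(* Only the difference between the fitted coefficients and [p] is bounded, by [1/2] for [G] over
   [1/2] for the ground state. Hence the remainder [D] has Lipschitz constant [2 + 3 = 5], whatever
   [p] is. *)
have cp j : `|(cv - p) 0 j| <= 1.
  have dv (u v : R) : 2^-1 <= v -> `|u| <= 2^-1 -> `|u / v| <= 1.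
    move=> v2 u2; have v0 : 0 < v by apply: lt_le_trans v2; rewrite invr_gt0.
    by rewrite normrM normfV (gtr0_norm v0) ler_pdivrMr// mul1r; apply: le_trans v2.
  have e1 : c1 - p 0 0 = sign_comp G true false false zc / psi_x zc.
    by rewrite /c1 (comp_gh p G) comp_linear_x px; field.
  have e2 : c2' - p 0 1 = sign_comp G false true false zc / psi_y zc.
    by rewrite /c2' (comp_gh p G) comp_linear_y py; field.
  have e3 : c3 - p 0 2%:R = sign_comp G false false true zc / psi_z zc.
    by rewrite /c3 (comp_gh p G) comp_linear_z; field; rewrite gt_eqF//; lra.
  rewrite !mxE; case: j => -[|[|[|//]]] hj /=.
  - rewrite (_ : Ordinal hj = 0) ?e1; first by apply: dv; rewrite ?px.
    exact/val_inj.
  - rewrite (_ : Ordinal hj = 1) ?e2; first by apply: dv; rewrite ?py.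
    exact/val_inj.
  - rewrite (_ : Ordinal hj = 2%:R) ?e3; first by apply: dv.
    exact/val_inj.
have psi1 z : [/\ `|psi_x z| <= 1, `|psi_y z| <= 1 & `|psi_z z| <= 1].
  rewrite /psi_x /psi_y /psi_z; split; last exact: norm_cos_le1.
    by rewrite normrM mulr_ile1// ?norm_sin_le1 ?norm_cos_le1.
  by rewrite normrM mulr_ile1// ?norm_sin_le1.
have dev (h : R * R -> R) (psi : R * R -> R) z : Q z -> 0 < psi z -> `|psi z| <= 1 ->
    (forall z z', Q z -> Q z' -> `|h z' / psi z' - h z / psi z| <= eta) ->
    `|h z - h zc / psi zc * psi z| <= eta.
  move=> Qz p0 p1 hf.
  have -> : h z - h zc / psi zc * psi z = (h z / psi z - h zc / psi zc) * psi z.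
    by rewrite mulrBl divfK// gt_eqF.
  rewrite normrM; apply: le_trans (hf zc z Qc Qz); exact: ler_piMr.
have Qin z : Q z -> 0 < z.1 < pi / 2 /\ 0 < z.2 < pi / 2.
  case: z => x y /boxE[/= hx hy]; rewrite /bnd in hx hy.
  have k := conj hx hy; clear -k d0 r0; case: k => hx hy; split; lra.
have pos z : Q z -> [/\ 0 < psi_x z, 0 < psi_y z & 0 < psi_z z].
  move=> /Qin[z1 z2]; rewrite /psi_x /psi_y /psi_z; split.
  - by apply: mulr_gt0; [exact: sin_gt0_hpi|exact: cos_gt0_hpi].
  - by apply: mulr_gt0; exact: sin_gt0_hpi.
  - exact: cos_gt0_hpi.
have eta0 : 0 <= eta by apply: le_trans (fx zc zc Qc Qc); exact: normr_ge0.
(* The (---) component also vanishes on the plane x = 0, which rules out the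
   eigenfunction z. *)
have w_small z : Q z -> `|sign_comp gh true true true z| <= eta + 4 * (delta + rho).
  (* The corner of the square within [delta + rho] of the plane [x = 0]; its small polar angle keeps
     [psi_z] above [1/2]. *)
  move=> Qz; pose z1 : R * R := (delta, bnd).
  have Q1 : Q z1 by apply: in_box; rewrite /bnd; clear -d0 d8 r0 rd h0 h2; lra.
  have [_ _ pz0] := pos z Qz; have [_ _ pz1] := psi1 z.
  have v0 : sign_comp G true true true (delta, pi / 2) = 0.
    by apply: comp_vanish_x; rewrite /= cos_pihalf mulr0.
  have v1 : `|sign_comp gh true true true z1| <= 2 * (delta + rho).
    rewrite (comp_gh p G) comp_linear_xyz mul0r addr0.
    have := comp_G_lipschitz Glip true true true z1 (delta, pi / 2).
    rewrite v0 subr0 /dist1 /= subrr normr0 add0r /bnd.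
    have -> : pi / 2 - delta - rho - pi / 2 = - (delta + rho) by ring.
    have dr : 0 < delta + rho by exact: addr_gt0.
    by rewrite (normrN (delta + rho)) (gtr0_norm dr).
  have cd : 2^-1 <= psi_z z1.
    rewrite /psi_z /= -sin_hpiB; apply: le_trans cc _; rewrite -sc.
    by apply: sin_le_hpi; clear -d0 d8 r0 rd h0 h2; lra.
  have v2 : `|sign_comp gh true true true z1 / psi_z z1| <= 4 * (delta + rho).
    have p0 : 0 < psi_z z1 by lra.
    rewrite normrM normfV (gtr0_norm p0) ler_pdivrMr//; apply: le_trans v1 _.
    have : 4 * (delta + rho) * 2^-1 <= 4 * (delta + rho) * psi_z z1.
      by rewrite ler_wpM2l//; lra.
    lra.
  have v3 : `|sign_comp gh true true true z / psi_z z| <= eta + 4 * (delta + rho).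
    rewrite -(subrK (sign_comp gh true true true z1 / psi_z z1) (_ / psi_z z)).
    by apply: le_trans (ler_normD _ _) _; apply: lerD => //; exact: fw.
  apply: le_trans v3; rewrite -[in leLHS](divfK (lt0r_neq0 pz0) (sign_comp gh true true true z)).
  by rewrite (normrM (_ / _)) ler_piMr.
pose D x := gh x - dot cv x.
have DQ s t w z : Q z -> `|D (oct s t w z)| <= 4 * eta + 4 * (delta + rho).
  move=> Qz; have [px0 py0 pz0] := pos z Qz; have [px1 py1 pz1] := psi1 z.
  have dx := dev _ psi_x z Qz px0 px1 fx.
  have dy := dev _ psi_y z Qz py0 py1 fy.
  have dz := dev _ psi_z z Qz pz0 pz1 fz.
  have dw := w_small z Qz.
  have odd3 s' t' w' : gh (oct (~~ s') (~~ t') (~~ w') z) = - gh (oct s' t' w' z).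
    rewrite -gh_odd ?oct_unit//; congr gh; apply/rowP => j; rewrite /oct [RHS]mxE !vec3E.
    by case: ifP => _; [|case: ifP => _]; rewrite signrN mulNr.
  have ev a b c : ~~ (a (+) b (+) c) -> sign_comp gh a b c z = 0.
    by move=> abc; apply: ochar_antipodal.
  have inv : gh (oct s t w z) = (-1) ^+ s * sign_comp gh true false false z
     + (-1) ^+ t * sign_comp gh false true false z + (-1) ^+ w * sign_comp gh false false true z
     + (-1) ^+ s * (-1) ^+ t * (-1) ^+ w * sign_comp gh true true true z.
    rewrite (ochar_inversion (fun s t w => gh (oct s t w z))) /osum -!/(sign_comp gh _ _ _ z).
    rewrite (ev false false false)// (ev true true false)// (ev true false true)//.
    by rewrite (ev false true true)//= !expr0; ring.
  have -> : D (oct s t w z) =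
     (-1) ^+ s * (sign_comp gh true false false z - c1 * psi_x z)
     + (-1) ^+ t * (sign_comp gh false true false z - c2' * psi_y z)
     + (-1) ^+ w * (sign_comp gh false false true z - c3 * psi_z z)
     + (-1) ^+ s * (-1) ^+ t * (-1) ^+ w * sign_comp gh true true true z.
    rewrite /D inv dot3 /cv /oct !vec3E /psi_x /psi_y /psi_z /=; ring.
  have nm (b : bool) (v : R) : `|(-1) ^+ b * v| = `|v| by exact: normrMsign.
  have nm3 (v : R) : `|(-1) ^+ s * (-1) ^+ t * (-1) ^+ w * v| = `|v|.
    by rewrite -!mulrA !nm.
  apply: le_trans (ler_normD _ _) _; apply: le_trans (lerD (ler_normD _ _) (lexx _)) _.
  apply: le_trans (lerD (lerD (ler_normD _ _) (lexx _)) (lexx _)) _.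
  rewrite nm3 !nm; clear -dx dy dz dw; rewrite -/c1 -/c2' -/c3 in dx dy dz; lra.
have DE x : D x = G x - dot (cv - p) x by rewrite /D /gh dotBl; ring.
have Dlip s t w z z' : `|D (oct s t w z) - D (oct s t w z')| <= 5 * dist1 z z'.
  rewrite !DE.
  have -> : G (oct s t w z) - dot (cv - p) (oct s t w z) -
     (G (oct s t w z') - dot (cv - p) (oct s t w z')) =
     (G (oct s t w z) - G (oct s t w z')) - dot (cv - p) (oct s t w z - oct s t w z').
    by rewrite dotBr; ring.
  apply: le_trans (ler_normB _ _) _.
  have k1 := oct_G_lipschitz Glip s t w z z'.
  have k2 j : `|(cv - p) 0 j * (oct s t w z - oct s t w z') 0 j| <= dist1 z z'.
    rewrite normrM; apply: le_trans (ler_wpM2r (normr_ge0 _) (cp j)) _; rewrite mul1r.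
    have -> : (oct s t w z - oct s t w z') 0 j = oct s t w z 0 j - oct s t w z' 0 j by rewrite !mxE.
    exact: oct_lipschitz.
  have k3 : `|dot (cv - p) (oct s t w z - oct s t w z')| <= 3 * dist1 z z'.
    rewrite dot3; apply: le_trans (ler_normD _ _) _.
    apply: le_trans (lerD (ler_normD _ _) (lexx _)) _.
    have := k2 0; have := k2 1; have := k2 2%:R; lra.
  lra.
apply: (class_norm_le (c := cv)) => u.
have [s [t [w [z [z1 z2 uE]]]]] := oct_onto (enorm_emb u).
rewrite gE -/(gh _) -/(D _) uE.
(* Each angle moves by at most [delta + rho], so the collar adds [10 * (delta + rho)] to the
   [4 * (delta + rho)] valid on the square; with [rho <= delta] the sum is at most [28 * delta]. *)
pose z' : R * R := (clamp delta bnd z.1, clamp delta bnd z.2).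
have Qz' : Q z' by apply: in_box; exact: clamp_itv.
have k1 : `|z.1 - z'.1| <= delta + rho.
  by clear -z1 d0 r0 db; apply: clamp_dist => //; rewrite /bnd; lra.
have k2 : `|z.2 - z'.2| <= delta + rho.
  by clear -z2 d0 r0 db; apply: clamp_dist => //; rewrite /bnd; lra.
have k3 := Dlip s t w z z'; have k4 := DQ s t w z' Qz'; rewrite /dist1 in k3.
rewrite -[D _](subrK (D (oct s t w z'))); apply: le_trans (ler_normD _ _) _.
clear -k1 k2 k3 k4 rd; lra.
Qed.

(** Nonnegativity of the four integrals of squares lets the bound on their sum control each of them,
    and makes the right side nonnegative. *)
Let quarter_bounds (E kappa ex ey ez ew sx sy sz sw : R) :
  8 * (ex + ey + ez + ew) <= 2 * E + kappa + 2 * kappa ->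
  sx <= ex -> sy <= ey -> sz <= ez -> sw <= ew ->
  0 <= sx -> 0 <= sy -> 0 <= sz -> 0 <= sw ->
  let e := (2 * E + 3 * kappa) / 8 in
  0 <= 2 * E + 3 * kappa /\ [/\ sx <= e, sy <= e, sz <= e & sw <= e].
Proof. by move=> *; split; [lra|rewrite !ler_pdivlMr//; split; lra]. Qed.

Let squares_ge0 (delta : R) pp qq (f ft fk : R * R -> R) : 0 < delta ->
  0 <= innerI delta (ground_squares pp qq f ft fk).
Proof.
move=> d0; apply: boxI_ge0 => z /boxE[zx _].
have s0 : 0 < sin z.1 by apply: sin_gt0_hpi; lra.
by apply: addr_ge0; rewrite mulr_ge0 ?invr_ge0 ?sqr_ge0// ltW.
Qed.

(** As [kappa] is arbitrary, the first conclusion amounts to nonnegativity of the energy; the second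
    is the quantitative form of flatness with all parameters still free. *)
Lemma flat_bound (delta rho lam kappa : R) : H1 g ->
  0 < delta -> delta <= pi / 8 -> 0 < rho -> rho <= delta -> 0 < lam -> 0 < kappa ->
  let E := \int[sigma]_u (2^-1 * enorm (sgrad g u) ^+ 2 - g u ^+ 2) in
  0 <= 2 * E + 3 * kappa /\
  class_norm g <= 4 * oscillation_bound delta rho lam kappa ((2 * E + 3 * kappa) / 8) + 28 * delta.
Proof.
move=> Hg d0 d8 r0 rd l0 k0 E.
have [h0 h2] := @hpi_bounds R.
have d4 : delta <= pi / 4 by lra.
have [Phi [CPhi hE hk]] := sobolev_approximation continuous_gh gE Hg k0.
rewrite -/E in hE.
have hsum := odd_components_le CPhi continuous_gh gh_odd hE hk.
have close a b c := @component_close _ Phi gh kappa a b c (C1_continuous CPhi) continuous_gh hk.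
have := components_ge CPhi d0 d4 => /= -[].
set Sx := innerI _ _; set Sy := innerI _ _; set Sz := innerI _ _; set Sw := innerI _ _.
move=> Ex Ey Ez Ew.
have x0 : 0 <= Sx by exact: squares_ge0.
have y0 : 0 <= Sy by exact: squares_ge0.
have z0 : 0 <= Sz by exact: squares_ge0.
have w0 : 0 <= Sw by exact: squares_ge0.
have [e0 [ex ey ez ew]] := quarter_bounds hsum Ex Ey Ez Ew x0 y0 z0 w0.
split=> //.
apply: (flat_components d0 d8 r0 rd).
- exact: (component_flat d0 d8 r0 rd l0 CPhi (eigenstate_x d0 d4) (comp_linear_x p) ex (close _ _ _)).
- exact: (component_flat d0 d8 r0 rd l0 CPhi (eigenstate_y d0 d4) (comp_linear_y p) ey (close _ _ _)).
- exact: (component_flat d0 d8 r0 rd l0 CPhi (eigenstate_z d0 d4) (comp_linear_z p) ez (close _ _ _)).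
- exact: (component_flat d0 d8 r0 rd l0 CPhi (eigenstate_z d0 d4) (comp_linear_xyz p) ew (close _ _ _)).
Qed.

End normalized.
End flat_bound.

(** * Sign of the energy, and smallness of the class norm for small energy *)

Section width_class_energy.
Context {R : realType}.
Local Notation sigma := (@surface_measure R).
Implicit Types (g : S2 R -> R).
Local Notation dirichlet g :=
  (\int[sigma]_u (2^-1 * enorm (sgrad g u) ^+ 2 - g u ^+ 2)).

(** Taking the factor 2 out of the real-valued integral requires integrability: [g] has a continuous
    extension, and the gradient is square integrable by [integrable_sgrad_sq]. *)
Lemma Vinner_energy g : width_class g -> H1 g -> (Vinner g g)%:E = (2%:E * energy g)%E.
Proof.
move=> Kg Hg; rewrite /energy asboolT//; congr EFin.
have [p [G [Glip gE Gunit]]] := width_class_normalize Kg.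
pose gh x := G x + dot p x.
have cgh : continuous gh := continuous_gh Glip.
have iG : sigma.-integrable setT (fun u => (g u ^+ 2)%:E).
  rewrite (_ : (fun u => _) = (fun u : S2 R => (gh (emb u) ^+ 2)%:E)).
    apply: (integrable_emb (F := fun x => gh x ^+ 2)) => [|x]; last exact: sqr_ge0.
    exact: (continuous_expr2 cgh).
  by apply/funext => u; rewrite gE.
have iE : sigma.-integrable setT
    (EFin \o (fun u => 2^-1 * enorm (sgrad g u) ^+ 2 - g u ^+ 2)).
  exact: (integrableB measurableT
    (integrableZl measurableT 2^-1 (integrable_sgrad_sq Hg)) iG).
rewrite -(RintegralZl 2 measurableT iE) /Vinner; apply: eq_Rintegral => u _.
by rewrite enorm_sq; field.
Qed.

Lemma energy_ge0 g : H1 g -> (0 <= energy g)%E.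
Proof.
move=> Hg; rewrite /energy; case: asboolP => // Kg; rewrite lee_fin.
have [p [G [Glip gE Gunit]]] := width_class_normalize Kg.
have [h0 h2] := @hpi_bounds R.
have p8 : 0 < pi / 8 :> R by lra.
have bound kappa : 0 < kappa -> 0 <= 2 * dirichlet g + 3 * kappa.
  move=> k0.
  by have [] := flat_bound Glip Gunit gE Hg p8 (lexx _) p8 (lexx _) ltr01 k0.
rewrite leNgt; apply/negP => E0.
(* With this [kappa] the bound reads [0 <= dirichlet g]. *)
have := bound (- dirichlet g / 3); lra.
Qed.

Lemma energy_small_flat (eta : R) : 0 < eta -> exists2 eps : R, 0 < eps &
  forall g, H1 g -> (energy g < eps%:E)%E -> class_norm g <= eta.
Proof.
move=> eta0; have [h0 h2] := @hpi_bounds R.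
(* The target [eta] is split as [eta / 2] for [28 * delta], [eta / 6] for the term in [rho], and
   [eta / 6] for each of the two terms of [amgm_bound], governed by [lam] and by [kappa]. The last
   three are multiplied by 4 in [flat_bound], hence [eta / 24] each. *)
pose delta : R := Num.min (pi / 8) (eta / 56).
have d0 : 0 < delta by rewrite lt_min; apply/andP; split; lra.
have d8 : delta <= pi / 8 by rewrite ge_min lexx.
have d56 : delta <= eta / 56 by rewrite ge_min lexx orbT.
have d4 : delta <= pi / 4 by lra.
have /andP[m0 _] := m_bounds d0 d4; set m := _ ^+ 2 in m0.
pose rho := Num.min delta (eta * m ^+ 2 / 576).
have r0 : 0 < rho.
  rewrite /rho lt_min d0; apply: divr_gt0; last by rewrite ltr0n.
  by apply: mulr_gt0 => //; exact: exprn_gt0.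
have rd : rho <= delta by rewrite /rho ge_min lexx.
have rm : rho <= eta * m ^+ 2 / 576 by rewrite /rho ge_min lexx orbT.
pose lam := eta * m * rho ^+ 2 / 1536.
have l0 : 0 < lam.
  apply: divr_gt0; last by rewrite ltr0n.
  by apply: mulr_gt0; [exact: mulr_gt0|exact: exprn_gt0].
pose kappa := eta * lam * m ^+ 2 * rho ^+ 2 / 192.
have k0 : 0 < kappa.
  apply: divr_gt0; last by rewrite ltr0n.
  by apply: mulr_gt0; [apply: mulr_gt0; [exact: mulr_gt0|]|]; exact: exprn_gt0.
(* [kappa] is both the approximation error and the energy threshold: for an energy below [kappa],
   [e] is less than [5/8] of [kappa]. *)
exists kappa => // g Hg; rewrite /energy; case: asboolP => // Kg; rewrite lte_fin => Ek.
have [p [G [Glip gE Gunit]]] := width_class_normalize Kg.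
have [_] := flat_bound Glip Gunit gE Hg d0 d8 r0 rd l0 k0.
set e := (_ + 3 * kappa) / 8.
have ek : e + kappa <= 2 * kappa by rewrite /e; lra.
move=> /le_trans; apply; rewrite /oscillation_bound -/m.
have b1 : 8 * (3 / m ^+ 2) * rho <= eta / 24.
  have -> : eta / 24 = 8 * (3 / m ^+ 2) * (eta * m ^+ 2 / 576) by field; rewrite gt_eqF.
  by rewrite ler_wpM2l// !mulr_ge0 ?invr_ge0 ?sqr_ge0.
have b2 : 16 * amgm_bound m lam (e + kappa) / rho ^+ 2 <= eta / 12.
  apply: (@le_trans _ _ (16 * amgm_bound m lam (2 * kappa) / rho ^+ 2)).
    by rewrite ler_wpM2r ?invr_ge0 ?sqr_ge0// ler_wpM2l//; exact: amgm_bound_le.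
  rewrite le_eqVlt; apply/orP; left; apply/eqP.
  rewrite /amgm_bound /kappa /lam; field.
  by rewrite !gt_eqF.
lra.
Qed.

End width_class_energy.

(** * Decay in time *)

Section time_axis.
Context {R : realType}.
Local Notation leb := (@completed_lebesgue_measure R).
Implicit Types (N : set R) (M f : @time R -> \bar R).

Lemma measurable_time_itv (i : interval R) : measurable ([set` i] : set (@time R)).
Proof. by apply: sub_caratheodory; exact: (measurable_itv i). Qed.

Lemma leb_itv (a b : R) (b1 b2 : bool) : a <= b ->
  leb [set` Interval (BSide b1 a) (BSide b2 b)] = (b - a)%:E.
Proof.
move=> ab; rewrite -[LHS]/(lebesgue_measure _) lebesgue_measure_itv/= lte_fin.
by rewrite EFinB; case: ltP => // ba; rewrite (le_anti (_ : a <= b <= a)) ?ab// subee.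
Qed.

Lemma negligible_point (a : R) : leb.-negligible [set a].
Proof.
exists `[a, a]%classic; split; first exact: measurable_time_itv.
  by rewrite leb_itv// subrr.
by rewrite set_itv1.
Qed.

Lemma negligible_avoid N (a b : R) : leb.-negligible N -> a < b ->
  exists2 x, a < x < b & ~ N x.
Proof.
move=> [A [mA A0 NA]] ab; apply: contrapT => /forall2NP h.
have sub : `]a, b[ `<=` (A : set (@time R)).
  move=> x; rewrite /= in_itv /= => xab; apply: NA.
  by have [|/contrapT] := h x.
have : ((b - a)%:E <= 0)%E.
  rewrite -(leb_itv false true (ltW ab)) -A0.
  by apply: le_measure => //; rewrite inE//; exact: measurable_time_itv.
by rewrite lee_fin subr_le0 leNgt ab.
Qed.

(** The superlevel sets within the half-line are intervals. *)
Lemma measurable_nonincreasing M :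
  (forall s t, 0 <= s -> s <= t -> (M t <= M s)%E) ->
  measurable_fun (`[0, +oo[ : set (@time R)) M.
Proof.
move=> hM mD.
apply: (measurability _ (ErealGenOInfty.measurableE R)) => // _ [_ [x ->] <-].
apply: sub_caratheodory; apply: (@is_interval_measurable R) => s t.
rewrite /= !in_itv /= !andbT => -[s0 hs] [t0 ht] r /andP[sr rt].
rewrite !in_itv /= !andbT; split; first exact: le_trans sr.
apply: lt_le_trans ht _.
by apply: hM => //; exact: le_trans sr.
Qed.

(** For [t > 2 n] monotonicity gives [t M(t) / 2 <= (t - n) M(t)], which is at most the integral of
    [M] over []n, t]], a piece of a small tail. *)
Lemma nonincreasing_integrable_decay M (e : R) :
  (forall s t, 0 <= s -> s <= t -> (M t <= M s)%E) -> (forall t, (0 <= M t)%E) ->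
  (\int[leb]_(t in `[0%R, +oo[) M t < +oo)%E -> 0 < e ->
  exists2 A : R, 0 < A & forall t, A < t -> (t%:E * M t <= e%:E)%E.
Proof.
move=> hM M0 Moo e0; have mM := measurable_nonincreasing hM.
pose F (n : nat) : set (@time R) := `[0, n%:R]%classic.
have mF n : measurable (F n) by exact: measurable_time_itv.
have FE : \bigcup_n F n = `[0, +oo[%classic.
  apply/seteqP; split=> [t [n _]|t]; rewrite /F /= !in_itv /= andbT.
    by move=> /andP[].
  move=> t0; exists (Num.truncn t).+1 => //=; rewrite in_itv /= t0/= ltW//.
  exact: truncnS_gt.
have FS n : F n `<=` `[0, +oo[ by rewrite -FE; exact: bigcup_sup.
have ndF : nondecreasing_seq F.
  move=> n m nm; apply/subsetPset => t; rewrite /F /= !in_itv /= => /andP[-> tn] /=.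
  by apply: le_trans tn _; rewrite ler_nat.
have := ge0_nondecreasing_set_cvg_integral (mu := leb) ndF mF
  (fun n => measurable_funS (measurable_time_itv _) (@FS n) mM) (fun _ t _ => M0 t).
rewrite FE; set I := (\int[_]_(_ in _) _)%E => cI.
have I0 : (0 <= I)%E by exact: integral_ge0.
have [i iE] : exists i : R, I = i%:E.
  by exists (fine I); rewrite fineK// ge0_fin_numE.
have [n _ hn] : \forall n \near \oo, ((i - e / 2)%:E < \int[leb]_(t in F n) M t)%E.
  have h : ((i - e / 2)%:E < I)%E by rewrite iE lte_fin; lra.
  exact: (cI _ (open_ereal_gt' h)).
have {}hn := hn n (leqnn n).
exists (2 * n%:R + 1) => [|t tA]; first by rewrite ltr_wpDl// mulr_ge0.
have nt : n%:R < t by have : 0 <= n%:R :> R by []; lra.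
pose G : set (@time R) := `]n%:R, t]%classic.
have mG : measurable G by exact: measurable_time_itv.
have n0 : 0 <= n%:R :> R by [].
have GS : G `<=` `[0, +oo[.
  by move=> x; rewrite /G /= !in_itv /= andbT => /andP[x0 _]; exact: le_trans (ltW x0).
have split_le : (\int[leb]_(s in F n) M s + \int[leb]_(s in G) M s <= I)%E.
  rewrite -ge0_integral_setU//.
  - apply: ge0_subset_integral => //; first exact: measurableU.
    + exact: measurable_time_itv.
    + by move=> x [/FS|/GS].
  - by apply: (measurable_funS (measurable_time_itv _) _ mM) => x [/FS|/GS].
  - rewrite disj_set2E; apply/eqP/seteqP; split => // x.
    by rewrite /F /G /= !in_itv /= => -[/andP[_ x1] /andP[x2 _]]; move: (le_lt_trans x1 x2); rewrite ltxx.
have ge_cst : ((t - n%:R)%:E * M t <= \int[leb]_(s in G) M s)%E.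
  have <- : (\int[leb]_(s in G) cst (M t) s = (t - n%:R)%:E * M t)%E.
    rewrite integral_cst// muleC; congr (_ * _)%E.
    exact: (leb_itv false false (ltW nt)).
  apply: ge0_le_integral => //; first by move=> s _; exact: M0.
    exact: (measurable_funS (measurable_time_itv _) GS mM).
  move=> s; rewrite /G /= in_itv /= => /andP[ns st]; apply: hM => //.
  by apply: ltW; exact: le_lt_trans ns.
have X0 : (0 <= \int[leb]_(s in F n) M s)%E by exact: integral_ge0.
have Y0 : (0 <= \int[leb]_(s in G) M s)%E by exact: integral_ge0.
have M0t := M0 t.
move: X0 Y0 M0t hn split_le ge_cst; rewrite iE.
case: (\int[leb]_(s in F n) M s)%E => [x| |] //; case: (\int[leb]_(s in G) M s)%E => [y| |] //.
have tn0 : 0 < t - n%:R by lra.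
case: (M t) => [z| |] // _ _; last by rewrite gt0_muley ?lte_fin.
rewrite -!EFinD -!EFinM !lee_fin !lte_fin => z0 h1 h2 h3.
have : t * z <= 2 * ((t - n%:R) * z).
  rewrite mulrA ler_wpM2r//; lra.
lra.
Qed.

End time_axis.

(** * The energy along a weak solution *)

Section energy_decay.
Context {R : realType}.
Local Notation leb := (@completed_lebesgue_measure R).
Implicit Types (N : set R) (f : @time R -> \bar R) (xi : R -> MS2 R) (g : R -> CS2 R).

(** Running infimum over the good times up to [t] ([+oo] if there are none). It is monotone
    everywhere, hence measurable, and off [N] it agrees with an essentially nonincreasing [f]. *)
Definition envelope N f (t : @time R) : \bar R :=
  ereal_inf [set f s | s in [set s : @time R | 0 <= (s : R) <= t /\ ~ N s]].

Lemma envelopeE N f (t : R) : (forall s t, 0 <= s -> s <= t -> ~ N s -> ~ N t ->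
  (f t <= f s)%E) -> 0 <= t -> ~ N t -> envelope N f t = f t.
Proof.
move=> fN t0 Nt; apply/le_anti/andP; split.
  by apply: ereal_inf_lbound; exists t => //; rewrite /= t0 lexx.
by apply: le_ereal_inf_tmp => _ [s [/andP[s0 st] Ns] <-]; exact: fN.
Qed.

Lemma envelope_nonincreasing N f (s t : R) : s <= t -> (envelope N f t <= envelope N f s)%E.
Proof.
move=> st; apply: le_ereal_inf_tmp => _ [r [/andP[r0 rs] Nr] <-].
by apply: ereal_inf_lbound; exists r => //; rewrite /= r0 (le_trans rs).
Qed.

Lemma envelope_ge0 N f (t : R) : (forall s, 0 <= s -> ~ N s -> (0 <= f s)%E) ->
  (0 <= envelope N f t)%E.
Proof. by move=> f0; apply: le_ereal_inf_tmp => _ [s [/andP[s0 _] Ns] <-]; exact: f0. Qed.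

Lemma ae_eq_off N (D : set R) (f1 f2 : @time R -> \bar R) : leb.-negligible N ->
  (forall t, D t -> ~ N t -> f1 t = f2 t) -> ae_eq leb D f1 f2.
Proof.
move=> negN h; apply: negligibleS negN => t /=; apply: contra_notP => Nt Dt.
exact: h.
Qed.

Lemma completed_measurable_fun (D : set (@time R)) (f1 f2 : @time R -> \bar R) :
  ae_eq leb D f1 f2 -> measurable_fun D f1 -> measurable_fun D f2.
Proof. exact: (ae_measurable_fun completed_lebesgue_measure_is_complete). Qed.

(* An infinite energy at a time r > 0 would propagate to all earlier times and
   make the integral in the energy identity infinite. *)
Lemma width_class_path xi g N (r : R) : null_times N ->
  (forall s t, 0 <= s -> s <= t -> ~ N s -> ~ N t -> (energy (g t) <= energy (g s))%E) ->
  (forall s t, 0 <= s -> s <= t -> ~ N s -> ~ N t ->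
    ((2^-1 * dual_norm (xi s) ^+ 2 - 2^-1 * dual_norm (xi t) ^+ 2)%:E
         = energy_variation xi s t + \int[leb]_(r in `[s, t]) energy (g r))%E) ->
  0 < r -> ~ N r -> width_class (g r).
Proof.
move=> [_ negN] mono ident r0 Nr; apply: contrapT => Kr.
have Er : energy (g r) = +oo%E by rewrite /energy asboolF.
have [t /andP[t0 tr] Nt] := negligible_avoid negN r0.
have [s /andP[s0 st] Ns] := negligible_avoid negN t0.
have := ident s t (ltW s0) (ltW st) Ns Nt.
have ae : ae_eq leb `[s, t]%classic (cst +oo%E) (fun r : @time R => energy (g r)).
  apply: (ae_eq_off negN) => w; rewrite /= in_itv /= => /andP[sw wt] Nw; apply/esym/eqP.
  rewrite -leye_eq -Er; apply: mono => //.
    exact: le_trans (ltW s0) sw.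
  exact: le_trans wt (ltW tr).
have mc : measurable_fun (`[s, t] : set (@time R)) (cst +oo%E : @time R -> \bar R).
  exact: measurable_cst.
rewrite -(ae_eq_integral _ _ (measurable_time_itv _) mc (completed_measurable_fun ae mc) ae).
rewrite integral_cst; last exact: measurable_time_itv.
rewrite (_ : (_ * _)%E = (+oo * (t - s)%:E)%E); last first.
  by congr (_ * _)%E; exact: (leb_itv true false (ltW st)).
rewrite gt0_mulye ?lte_fin ?subr_gt0//.
(* The left side of the identity is a real number, while adding [+oo] to any variation gives an
   infinite value. *)
by case: (energy_variation xi s t).
Qed.

Lemma energy_path_decay xi g : corresponding xi g -> L2_V_path g ->
  ess_nonincreasing (fun t => energy (g t)) ->
  exists N, [/\ null_times N, forall t, 0 <= t -> ~ N t -> H1 (g t) &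
    forall e : R, 0 < e -> exists2 A : R, 0 < A &
      forall t, A < t -> ~ N t -> (t%:E * energy (g t) <= e%:E)%E].
Proof.
move=> [_ _ [N3 null3 ident]] [[N1 null1 VP] _ Voo] [N2 null2 mono].
pose N := N1 `|` N2 `|` N3.
have negN : leb.-negligible N.
  by case: null1 null2 null3 => _ n1 [_ n2] [_ n3]; do 2 apply: negligibleU => //.
have nullN : null_times N.
  by split=> //; case: null1 null2 null3 => n1 _ [n2 _] [n3 _] t [[/n1|/n2]|/n3].
pose f (t : @time R) := energy (g t).
have HN t : 0 <= t -> ~ N t -> H1 (g t).
  by move=> t0 Nt; have [] := VP t t0 (fun h => Nt (or_introl (or_introl h))).
have fN s t : 0 <= s -> s <= t -> ~ N s -> ~ N t -> (f t <= f s)%E.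
  by move=> s0 st Ns Nt; apply: mono => // h; [apply: Ns|apply: Nt]; left; right.
have f0 t : 0 <= t -> ~ N t -> (0 <= f t)%E.
  by move=> t0 Nt; apply: energy_ge0; exact: HN.
have KN r : 0 < r -> ~ N r -> width_class (g r).
  apply: (@width_class_path xi) => // s t s0 st Ns Nt.
  by apply: ident => // h; [apply: Ns|apply: Nt]; right.
exists N; split => // e e0.
(* The factor 2 makes [M] agree almost everywhere with [Vinner (g t) (g t)], whose integral is
   finite by [L2_V_path]. *)
pose M (t : @time R) := (2%:E * envelope N f t)%E.
have M0 t : (0 <= M t)%E by apply: mule_ge0 => //; exact: envelope_ge0.
have Mle s t : 0 <= s -> s <= t -> (M t <= M s)%E.
  by move=> _ st; apply: lee_wpmul2l => //; exact: envelope_nonincreasing.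
have mM := measurable_nonincreasing Mle.
have ae : ae_eq leb `[0, +oo[%classic M (fun t : @time R => (Vinner (g t) (g t))%:E).
  (* Time [0] is discarded as well: finiteness of the energy at a time is deduced from earlier
     times. *)
  apply: (ae_eq_off (negligibleU negN (negligible_point 0))) => t.
  rewrite /= in_itv /= andbT => t0 /not_orP[Nt tn0].
  have tp : 0 < t by rewrite lt_neqAle t0 andbT eq_sym; apply/eqP.
  by rewrite /M (envelopeE fN)// (Vinner_energy (KN _ tp Nt) (HN _ t0 Nt)).
have Moo : (\int[leb]_(t in `[0%R, +oo[) M t < +oo)%E.
  by rewrite (ae_eq_integral _ _ (measurable_time_itv _) mM (completed_measurable_fun ae mM) ae).
have [A A0 hA] := nonincreasing_integrable_decay Mle M0 Moo e0.
exists A => // t At Nt.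
have t0 : 0 <= t by apply: ltW; exact: lt_trans At.
apply: le_trans (hA t At); apply: lee_wpmul2l; first by rewrite lee_fin.
rewrite /M envelopeE// -[leLHS]mul1e; apply: lee_wpmul2r; first exact: f0.
by rewrite lee_fin; lra.
Qed.

End energy_decay.

Theorem corollary4p4 (R : realType) (g0 : CS2 R) (xi0 : MS2 R)
    (xi : R -> MS2 R) (g : R -> CS2 R)
    (g0_width : width_class g0)
    (xi0_perp : Pperp xi0)
    (xi0_g0 : duality_map g0 xi0)
    (xi_sol : weak_solution xi)
    (xi_var : finite_variation xi)
    (xi_init : forall h : CS2 R, width_class h -> pairing (xi 0) h = pairing xi0 h)
    (g_xi : corresponding xi g)
    (g_L2 : L2_V_path g)
    (E_noninc : ess_nonincreasing (fun t => energy (g t))) :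
  exists N : set R,
    [/\ null_times N,
        (t%:E * energy (g t))%E @[t --> within (~` N) +oo%R] --> (0 : \bar R)%E &
        class_norm (g t) @[t --> within (~` N) +oo%R] --> (0 : R)].
Proof.
have [N [nullN HN decay]] := energy_path_decay g_xi g_L2 E_noninc.
have near_off (A : R) (P : R -> Prop) : (forall t, A < t -> ~ N t -> P t) ->
    \forall t \near within (~` N) +oo%R, P t.
  move=> h; rewrite near_withinE; exists A; split=> [|t At Nt]; first exact: num_real.
  exact: h.
have E0 t : 0 <= t -> ~ N t -> (0 <= t%:E * energy (g t))%E.
  by move=> t0 Nt; apply: mule_ge0; rewrite ?lee_fin//; apply: energy_ge0; exact: HN.
exists N; split => //.
  apply/fine_cvgP; split.
    have [A A0 hA] := decay 1 ltr01; apply: (near_off A) => t At Nt.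
    rewrite ge0_fin_numE; first by apply: le_lt_trans (hA t At Nt) _; rewrite ltry.
    by apply: E0 => //; apply: ltW; exact: lt_trans At.
  apply/cvgrPdist_le => e e0.
  have [A A0 hA] := decay e e0; apply: (near_off A) => t At Nt /=.
  have t0 : 0 <= t by apply: ltW; exact: lt_trans At.
  rewrite sub0r normrN ger0_norm; last by apply: fine_ge0; exact: E0.
  have := hA t At Nt; have := E0 t t0 Nt.
  by case: (t%:E * energy (g t))%E => [x| |] //=; rewrite ?lee_fin.
apply/cvgrPdist_le => e e0.
have [eps eps0 flat] := energy_small_flat e0.
have [A A0 hA] := decay (eps / 2) (divr_gt0 eps0 (ltr0Sn _ _)).
(* For [t > 1] the energy is at most [t] times itself, hence at most [eps / 2] by the decay just
   proved; the half yields the strict inequality asked for by [flat]. *)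
apply: (near_off (Num.max A 1)) => t At Nt /=.
move: At; rewrite gt_max => /andP[At t1].
have t0 : 0 <= t by lra.
rewrite sub0r normrN ger0_norm ?class_norm_ge0//; apply: flat; first exact: HN.
apply: (@le_lt_trans _ _ (t%:E * energy (g t))%E).
  rewrite -[leLHS]mul1e; apply: lee_wpmul2r; last by rewrite lee_fin ltW.
  by apply: energy_ge0; exact: HN.
by apply: le_lt_trans (hA t At Nt) _; rewrite lte_fin; lra.
Qed.
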